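(* Let $d\ge1$, $a_0>0$, $0<L<\infty$, and let $X_1,X_2,\dots$ be i.i.d. random vectors in $\mathbb{R}^d$ with probability density $p$ satisfying $\|p\|_\infty\le L$. Let $K\in L_2(\mathbb{R}^d)$ be a kernel such that a version of its Fourier transform $\mathcal{F}[K]$ takes values in $[0,1]$ and satisfies $\mathcal{F}[K](h't)\ge\mathcal{F}[K](ht)$ for all $t\in\mathbb{R}^d$ and all $h>h'>0$. Suppose that $\inf_{h>0}R_n(\hat p_{n,h},p)\ge cn^{-1+\alpha}$ for some $c>0$, $\alpha>0$ (not depending on $n$). Then the (linear or convex) averaged kernel aggregate $\tilde p_n^{\mathbb{S},K}$ satisfies $$R_n(\tilde p_n^{\mathbb{S},K},p)\le\inf_{h>0}R_n(\hat p_{n,h},p)\,(1+o(1)),\qquad n\to\infty.$$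
   Context: $\|\cdot\|$ is the $L_2(\mathbb{R}^d)$ norm; for an estimator $\hat p$ based on $n$ i.i.d. observations with density $p$, $R_n(\hat p,p)=E_p^n\|\hat p-p\|^2$. The Fourier transform on $L_2(\mathbb{R}^d)$ is normalized so that $\mathcal{F}[f](t)=\int e^{ix^Tt}f(x)\,dx$ for $f\in L_1\cap L_2$. $K$ is real-valued, not assumed integrable. Kernel estimators: for a subsample of size $m\le n$ of $X_1,\dots,X_n$ and bandwidth $h>0$, $\hat p_{m,h}(x)=\frac{1}{mh^d}\sum K\big(\frac{X_i-x}{h}\big)$, the sum being over the $X_i$ in the subsample; $\hat p_{n,h}$ uses the full sample. Grid: $h_0=(n\log n)^{-1/d}$, $a_n=a_0/\log n$, $M$ is defined by $M-2=\max\{j\in\{0,1,2,\dots\}:h_0(1+a_n)^j<1\}$, $h_j=(1+a_n)^jh_0$ for $j=1,\dots,M-2$, $h_{M-1}=1$, and $\mathcal{H}=\{h_0,\dots,h_{M-1}\}$. Splits: $m=\lfloor n(1-(\log n)^{-1})\rfloor$, $\ell=n-m$. A split $\mathcal{S}$ divides the sample $(X_1,\dots,X_n)$ into a training subsample of size $m$ and a validation subsample of size $\ell$ (the complementary observations). $\mathbb{S}$ is an arbitrary (nonempty, fixed for each $n$) set of such splits. Aggregates: given functions $p_1,\dots,p_M\in L_2(\mathbb{R}^d)$ and validation data $Y_1,\dots,Y_\ell$, the linear aggregate is $\sum_{j=1}^{M'}\big(\frac1\ell\sum_{i=1}^\ell\phi_j(Y_i)\big)\phi_j$, where $\phi_1,\dots,\phi_{M'}$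 is an orthonormal basis in $L_2(\mathbb{R}^d)$ of the linear span of $p_1,\dots,p_M$; the convex aggregate is $\sum_{j=1}^M\hat\lambda_jp_j$ with $\hat\lambda\in\operatorname{argmin}_{\lambda\in\Lambda^M}\{\|\sum_j\lambda_jp_j\|^2-\frac2\ell\sum_{i=1}^\ell\sum_j\lambda_jp_j(Y_i)\}$, $\Lambda^M=\{\lambda\in\mathbb{R}^M:\lambda_j\ge0,\sum_j\lambda_j\le1\}$. For $\mathcal{S}\in\mathbb{S}$, $\tilde p_n^{\mathcal{S}}$ is the linear (respectively convex) aggregate of $p_j=\hat p_{m,h_{j-1}}$, $j=1,\dots,M$, computed from the training subsample of $\mathcal{S}$, using the validation subsample of $\mathcal{S}$. Finally $\tilde p_n^{\mathbb{S},K}=\frac{1}{\mathrm{card}(\mathbb{S})}\sum_{\mathcal{S}\in\mathbb{S}}\tilde p_n^{\mathcal{S}}$. The statement holds for both the linear and the convex version. *)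

(* Defs.v *)
From HB Require Import structures.
From mathcomp Require Import all_boot all_order all_algebra.
From mathcomp Require Import finmap.
From mathcomp Require Import all_classical all_reals all_analysis.
From mathcomp Require Import complex.

Set Implicit Arguments.
Unset Strict Implicit.
Unset Printing Implicit Defensive.
Import Order.TTheory GRing.Theory Num.Theory.
Import numFieldNormedType.Exports.
Local Open Scope classical_set_scope.
Local Open Scope ring_scope.

(* R^d is [d.-tuple R], with the product sigma-algebra. *)

Section lebesgue_step.
Context {R : realType} (n : nat).
Variable mu : {sigma_finite_measure set (n.-tuple R) -> \bar R}.

Definition tcons (x : measurableTypeR R * n.-tuple R) : n.+1.-tuple R :=
  [tuple of x.1 :: x.2].

Lemma measurable_tcons : measurable_fun [set: _] tcons.
Proof. by apply: measurable_cons; [exact: measurable_fst|exact: measurable_snd]. Qed.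

Definition lebesgue_step : set (n.+1.-tuple R) -> \bar R :=
  pushforward (@lebesgue_measure R \x mu)%E tcons.

Let pf : {measure set (n.+1.-tuple R) -> \bar R} :=
  @measure_function_pushforward__canonical__measure_function_Measure
    _ _ _ _ _ (@lebesgue_measure R \x mu)%E _ measurable_tcons.

Let lebesgue_step0 : lebesgue_step set0 = 0%E. Proof. exact: (measure0 pf). Qed.

Let lebesgue_step_ge0 A : (0 <= lebesgue_step A)%E.
Proof. exact: (measure_ge0 pf). Qed.

Let lebesgue_step_sigma_additive : semi_sigma_additive lebesgue_step.
Proof. exact: (@measure_semi_sigma_additive _ _ _ pf). Qed.

HB.instance Definition _ := isMeasure.Build _ _ _ lebesgue_step
  lebesgue_step0 lebesgue_step_ge0 lebesgue_step_sigma_additive.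

Lemma lebesgue_step_sigma_finite : sigma_finite setT lebesgue_step.
Proof.
have /sigma_finiteP[F [FT Fnd Foo]] := sigma_finiteT (@lebesgue_measure R).
have /sigma_finiteP[G [GT Gnd Goo]] := sigma_finiteT mu.
exists (fun k => [set t : n.+1.-tuple R | F k (thead t) /\
                                          G k [tuple of behead t]]).
  apply/seteqP; split=> // t _.
  have [i _ Fi] : (\bigcup_i F i) (thead t) by rewrite -FT.
  have [j _ Gj] : (\bigcup_i G i) [tuple of behead t] by rewrite -GT.
  exists (maxn i j) => //=; split.
    by move: Fi; exact/subsetPset/Fnd/leq_maxl.
  by move: Gj; exact/subsetPset/Gnd/leq_maxr.
move=> k; have [mF Fk] := Foo k; have [mG Gk] := Goo k; split.
  apply: measurableI; rewrite -[X in measurable X]setTI.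
    exact: (@measurable_tnth _ R n.+1 ord0).
  exact: (@measurable_behead _ R n).
rewrite /lebesgue_step /pushforward.
rewrite (_ : _ @^-1` _ = F k `*` G k); last first.
  apply/seteqP; split=> -[x t] /=; rewrite theadE.
    by case=> Fx; rewrite (_ : [tuple of _] = t)//; exact: val_inj.
  by case=> Fx Gt; split=> //; rewrite (_ : [tuple of _] = t)//; exact: val_inj.
by rewrite product_measure1E// lte_mul_pinfty// ge0_fin_numE.
Qed.

HB.instance Definition _ :=
  Measure_isSigmaFinite.Build _ _ _ lebesgue_step lebesgue_step_sigma_finite.

End lebesgue_step.

(* The base case is the unit mass on the one-point space R^0. *)
Fixpoint lebesgueRd {R : realType} (d : nat) :
    {sigma_finite_measure set (d.-tuple R) -> \bar R} :=
  match d with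
  | 0 => \d_([tuple] : 0.-tuple R)
  | d'.+1 => lebesgue_step (lebesgueRd d')
  end.

Lemma lebesgueRd_box {R : realType} (d : nat) (A : 'I_d -> set R) :
  (forall k, measurable (A k)) ->
  lebesgueRd d [set t : d.-tuple R | forall k, A k (tnth t k)] =
  (\prod_(k < d) @lebesgue_measure R (A k))%E.
Proof.
elim: d A => [|d IH] A mA /=.
  by rewrite big_ord0 diracE mem_set//= => -[].
have mB : measurable [set t : d.-tuple R | forall k, A (lift ord0 k) (tnth t k)].
  rewrite (_ : mkset _ = \bigcap_(k in [set: 'I_d])
      ((@tnth d R)^~ k @^-1` A (lift ord0 k))); last first.
    by apply/seteqP; split => t /= h k; [move=> _|]; exact: h.
  apply: fin_bigcap_measurable => // k _; rewrite -[X in measurable X]setTI.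
  exact: (@measurable_tnth _ R d k).
rewrite big_ord_recl -IH// -product_measure1E//.
rewrite /lebesgue_step /pushforward; congr product_measure1.
apply/seteqP; split => -[x t] /=.
  by move=> h; split => [|k]; [exact: (h ord0)|have := h (lift ord0 k); rewrite tnthS].
by move=> [Ax At] k; case: (unliftP ord0 k) => [j ->|->]; rewrite ?tnthS//; exact: At.
exact: (mA ord0).
Qed.

Definition scalev {R : realType} {d} (h : R) (t : d.-tuple R) : d.-tuple R :=
  [tuple h * tnth t k | k < d].

Definition dotv {R : realType} {d} (x t : d.-tuple R) : R :=
  \sum_(k < d) tnth x k * tnth t k.

Definition L2norm {R : realType} {d} (f : d.-tuple R -> R) : \bar R :=
  'N[lebesgueRd d]_2%:E[EFin \o f]%E.

Definition L2dot {R : realType} {d} (f g : d.-tuple R -> R) : R :=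
  \int[lebesgueRd d]_x (f x * g x).

Definition fourierL1 {R : realType} {d} (f : d.-tuple R -> R)
    (t : d.-tuple R) : R[i] :=
  Complex (\int[lebesgueRd d]_x (cos (dotv x t) * f x))
          (\int[lebesgueRd d]_x (sin (dotv x t) * f x)).

(* F is a version of the Fourier transform of f in L_2: the latter is the
   extension by L_2-continuity of [fourierL1] from L_1 and L_2 to L_2. *)
Definition is_fourierL2 {R : realType} {d} (f : d.-tuple R -> R)
    (F : d.-tuple R -> R[i]) : Prop :=
  [/\ measurable_fun setT (fun t => complex.Re (F t)),
      measurable_fun setT (fun t => complex.Im (F t)) &
      exists u : nat -> d.-tuple R -> R,
        [/\ forall k, u k \in Lfun (lebesgueRd d) 1%E,
            forall k, u k \in Lfun (lebesgueRd d) 2%:E,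
            L2norm (fun x => u k x - f x) @[k --> \oo] --> 0%E &
            L2norm (fun t => Normc.normc (fourierL1 (u k) t - F t))
              @[k --> \oo] --> 0%E]].

Definition mutually_independent {R : realType} {d} {dT : measure_display}
    {T : measurableType dT} {P : probability T R}
    (X : nat -> {RV P >-> d.-tuple R}) : Prop :=
  forall (J : {fset nat}) (A : nat -> set (d.-tuple R)),
    (forall i, measurable (A i)) ->
    P (\bigcap_(i in [set` J]) X i @^-1` A i) =
    (\prod_(i <- J) P (X i @^-1` A i))%E.

Definition iid_with_density {R : realType} {d} {dT : measure_display}
    {T : measurableType dT} {P : probability T R}
    (X : nat -> {RV P >-> d.-tuple R}) (p : d.-tuple R -> R) : Prop :=
  [/\ mutually_independent X,
      measurable_fun setT p,
      forall x, 0 <= p x &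
      forall i A, measurable A ->
        distribution P (X i) A = (\int[lebesgueRd d]_(x in A) (p x)%:E)%E].

Definition estimator (R : realType) (d n : nat) :=
  n.-tuple (d.-tuple R) -> d.-tuple R -> R.

Definition risk {R : realType} {d} {dT : measure_display}
    {T : measurableType dT} {P : probability T R}
    (X : nat -> {RV P >-> d.-tuple R}) (p : d.-tuple R -> R)
    (n : nat) (e : estimator R d n) : \bar R :=
  (\int[P]_w (L2norm (fun x => e [tuple X i w | i < n] x - p x)%R ^+ 2))%E.

Definition kernel_estimator {R : realType} {d n} (K : d.-tuple R -> R)
    (S : {set 'I_n}) (h : R) : estimator R d n := fun xs x =>
  (#|S|%:R * h ^+ d)^-1 *
  \sum_(i in S) K [tuple (tnth (tnth xs i) k - tnth x k) / h | k < d].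

Definition kernel_oracle_risk {R : realType} {d} {dT : measure_display}
    {T : measurableType dT} {P : probability T R}
    (X : nat -> {RV P >-> d.-tuple R}) (p K : d.-tuple R -> R)
    (n : nat) : \bar R :=
  ereal_inf [set risk X p (kernel_estimator K [set: 'I_n] h) |
             h in [set h : R | 0 < h]].

Section grid.
Context {R : realType}.
Variables (d : nat) (a0 : R) (n : nat).

Definition grid_h0 : R := (n%:R * ln n%:R) `^ (- d%:R^-1).
Definition grid_a : R := a0 / ln n%:R.
Definition grid_geom (j : nat) : R := grid_h0 * (1 + grid_a) ^+ j.

(* [xget] picks the (unique) element, the default 0 being used only for the
   finitely many n where the set below has no maximum. *)
Definition grid_size : nat :=
  (xget 0%N [set j | grid_geom j < 1 /\
                     forall i, grid_geom i < 1 -> (i <= j)%N]).+2.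

Definition grid (j : nat) : R :=
  if j == grid_size.-1 then 1 else grid_geom j.

End grid.

Definition training_size (R : realType) (n : nat) : nat :=
  Num.truncn (n%:R * (1 - (ln n%:R)^-1) : R).

Definition lincomb {R : realType} {d M} (f : 'I_M -> d.-tuple R -> R)
    (c : 'I_M -> R) : d.-tuple R -> R := fun x => \sum_j c j * f j x.

Definition sample_mean {R : realType} {d n} (ys : n.-tuple (d.-tuple R))
    (V : {set 'I_n}) (g : d.-tuple R -> R) : R :=
  #|V|%:R^-1 * \sum_(i in V) g (tnth ys i).

Definition orthonormal_basis_of_span {R : realType} {d M r}
    (f : 'I_M -> d.-tuple R -> R) (phi : 'I_r -> d.-tuple R -> R) : Prop :=
  [/\ forall j, exists c, phi j = lincomb f c,
      forall j k, L2dot (phi j) (phi k) = (j == k)%:R &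
      forall j, exists c, f j = lincomb phi c %[ae lebesgueRd d]].

Definition is_linear_aggregate {R : realType} {d M n}
    (f : 'I_M -> d.-tuple R -> R) (ys : n.-tuple (d.-tuple R))
    (V : {set 'I_n}) (g : d.-tuple R -> R) : Prop :=
  exists (r : nat) (phi : 'I_r -> d.-tuple R -> R),
    orthonormal_basis_of_span f phi /\
    g = lincomb phi (fun j => sample_mean ys V (phi j)).

Definition in_Lambda {R : realType} {M} (l : 'I_M -> R) : Prop :=
  (forall j, 0 <= l j) /\ \sum_j l j <= 1.

Definition convex_criterion {R : realType} {d M n}
    (f : 'I_M -> d.-tuple R -> R) (ys : n.-tuple (d.-tuple R))
    (V : {set 'I_n}) (l : 'I_M -> R) : R :=
  fine (L2norm (lincomb f l)) ^+ 2 - 2 * sample_mean ys V (lincomb f l).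

Definition is_convex_aggregate {R : realType} {d M n}
    (f : 'I_M -> d.-tuple R -> R) (ys : n.-tuple (d.-tuple R))
    (V : {set 'I_n}) (g : d.-tuple R -> R) : Prop :=
  exists l : 'I_M -> R,
    [/\ in_Lambda l,
        forall l', in_Lambda l' ->
          convex_criterion f ys V l <= convex_criterion f ys V l' &
        g = lincomb f l].

Variant aggregation := Linear | Convex.

Definition is_aggregate {R : realType} {d M n} (kind : aggregation) :
    ('I_M -> d.-tuple R -> R) -> n.-tuple (d.-tuple R) -> {set 'I_n} ->
    (d.-tuple R -> R) -> Prop :=
  match kind with
  | Linear => is_linear_aggregate
  | Convex => is_convex_aggregate
  end.

(* A split is represented by the set S of indices of its training subsample;
   the validation subsample is the complement of S. *)
Definition is_kernel_aggregate {R : realType} {d n} (kind : aggregation)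
    (a0 : R) (K : d.-tuple R -> R) (S : {set 'I_n}) (e : estimator R d n) :
    Prop :=
  forall xs, is_aggregate kind
    (fun j : 'I_(grid_size d a0 n) =>
       kernel_estimator K S (grid d a0 n j) xs)
    xs (~: S)%SET (e xs).

Definition averaged_estimator {R : realType} {d n} (SS : {set {set 'I_n}})
    (e : {set 'I_n} -> estimator R d n) : estimator R d n := fun xs x =>
  #|SS|%:R^-1 * \sum_(S in SS) e S xs x.

(* Main.v *)
Require Import Defs.
From mathcomp Require Import all_boot all_order all_algebra.
From mathcomp Require Import finmap.
From mathcomp Require Import all_classical all_reals all_analysis.
From mathcomp Require Import measurable_realfun ess_sup_inf complex.
From mathcomp Require Import ring lra.
Import Order.TTheory GRing.Theory Num.Theory.
Import numFieldNormedType.Exports.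
Import HBNNSimple.
Local Open Scope classical_set_scope.
Local Open Scope ring_scope.
Set Implicit Arguments.
Unset Strict Implicit.
Unset Printing Implicit Defensive.

(* The risk of a kernel estimator built on k observations is exactly
   ||K_h * p - p||^2 + (h^-d ||K||^2 - ||K_h * p||^2) / k. By Plancherel and the
   monotonicity of F[K] in [0,1], the first term is nondecreasing in h. Hence a
   bandwidth h in [h_0, 1) may be replaced by the grid point just below it at the
   price of a factor (n/m)(1 + a_n)^d up to O(1/n), while all h >= 1 and all
   h < h_0 compare with the bandwidth 1.

   Against a fixed member f_j of the family, both aggregates have excess loss at
   most sup_c (2 z.c - c'Gc), where G is the Gram matrix of f_1, ..., f_M and z
   the vector of centred validation means of the f_j. Regularising G by eps > 0,
   this supremum is the limit of z'(G + eps)^-1 z, whose expectation is at most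
   L tr((G + eps)^-1 G) / l <= L M / l because the density is bounded by L; Fatou's
   lemma lets eps -> 0. Convexity of the squared norm passes the bound to the
   average over splits. As M is of order (log n)^2 and l >= n / log n, every
   additive term is negligible against c n^(-1+alpha). *)

(** * Integration over tuples *)

(** The kernel is only square integrable, so its Fourier transform is an L2 limit. Every Fourier
    identity is therefore proved for the integrable approximants supplied by [is_fourierL2] and
    carried to [K] at a fixed bandwidth, where replacing one kernel by another costs h^-d times
    their squared distance. This passage uses (x + y)^2 <= (1 + e) x^2 + (1 + 1/e) y^2, because any
    constant larger than 1 in the comparison of biases would destroy the factor 1 + o(1).

    The second obstacle is that an aggregate is an arbitrary selection: a minimiser or an
    orthonormal basis is chosen separately for each sample, with no measurability in the sample.
    Hence the excess loss is dominated, for all coefficient vectors at once, by one measurable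
    function of the sample. The random rank of the span then disappears from the problem, and the
    ridge makes the inverse Gram matrix exist and depend measurably on the data. Conditioning on the
    training data is replaced by exchanging one observation for an independent copy. *)

Section affine_maps.
Context {R : realType} {d : nat}.

Definition affv (a : R) (v x : d.-tuple R) : d.-tuple R :=
  [tuple a * tnth x k + tnth v k | k < d].

Lemma tnth_affv a v x k : tnth (affv a v x) k = a * tnth x k + tnth v k.
Proof. by rewrite tnth_mktuple. Qed.

Lemma measurable_affv d' (T : measurableType d') (a : R) (f g : T -> d.-tuple R) :
  measurable_fun setT f -> measurable_fun setT g ->
  measurable_fun setT (fun x => affv a (f x) (g x)).
Proof.
move=> mf mg; apply/measurable_fun_tnthP => k.
rewrite [X in measurable_fun _ X](_ : _ =
  (fun x => a * tnth (g x) k + tnth (f x) k)); last first.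
  by apply/funext => x /=; rewrite tnth_affv.
apply: measurable_funD; [apply: measurable_funM => //|].
- exact: (measurableT_comp (measurable_tnth k) mg).
- exact: (measurableT_comp (measurable_tnth k) mf).
Qed.

Lemma measurable_affv1 (a : R) v : measurable_fun setT (affv a v).
Proof. exact: measurable_affv. Qed.

Lemma dotv_measurable d' (T : measurableType d') (f g : T -> d.-tuple R) :
  measurable_fun setT f -> measurable_fun setT g ->
  measurable_fun setT (fun x => dotv (f x) (g x)).
Proof.
move=> mf mg; apply: measurable_sum => k; apply: measurable_funM.
- exact: (measurableT_comp (measurable_tnth k) mf).
- exact: (measurableT_comp (measurable_tnth k) mg).
Qed.

End affine_maps.

Lemma affv_tcons (R : realType) d (a : R) (v : d.+1.-tuple R) x t :
  affv a v (tcons (x, t)) =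
  tcons (a * x + tnth v ord0, affv a [tuple of behead v] t).
Proof.
apply/eq_from_tnth => k; rewrite tnth_affv.
case: (unliftP ord0 k) => [j ->|->] /=; last by [].
by rewrite !tnthS tnth_affv [v in LHS]tuple_eta tnthS.
Qed.

Section integral_tuple.
Context {R : realType}.
Local Open Scope ereal_scope.
Local Notation leb := (@lebesgue_measure R).

(** Lebesgue measure is determined by its values on half-open intervals, and its image under x -> a
    x + b, rescaled by |a|, has the same values there. For a < 0 the preimages are closed on the
    other side, which does not change their length. *)
Lemma ge0_integral_affine (f : R -> \bar R) (a b : R) : a != 0%R ->
  measurable_fun setT f -> (forall x, 0 <= f x) ->
  \int[leb]_x f (a * x + b)%R = (`|a|^-1)%:E * \int[leb]_x f x.
Proof.
move=> a0 mf f0.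
pose phi := fun x : measurableTypeR R => (a * x + b : measurableTypeR R)%R.
have mphi : measurable_fun [set: measurableTypeR R] phi.
  by apply: measurable_funD => //; exact: measurable_funM.
pose pf : {measure set (measurableTypeR R) -> \bar R} :=
  @measure_function_pushforward__canonical__measure_function_Measure
    _ _ _ _ _ leb _ mphi.
pose c : {nonneg R} := NngNum (normr_ge0 a).
have E A : measurable A -> leb A = mscale c pf A.
  apply: (lebesgue_measure_unique (mu := mscale c pf)) => _ [[l r] _ <-] /=.
  rewrite /mscale/= /pushforward.
  case: (ltP 0%R a) => [ap|an].
    rewrite [_ @^-1` _](_ : _ = `]((l - b) / a)%R, ((r - b) / a)%R]%classic); last first.
      apply/seteqP; split => x /=; rewrite !in_itv/= /phi;
      by rewrite ltr_pdivrMr// ler_pdivlMr// ltrBlDr lerBrDr [(x * a)%R]mulrC.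
    rewrite !lebesgue_measure_itv/= !lte_fin ltr_pM2r ?invr_gt0// ltrD2r.
    case: ifPn => lr; last by rewrite mule0.
    by rewrite -!EFinD -EFinM gtr0_norm//; congr EFin; field; rewrite gt_eqF.
  have {}an : (a < 0)%R by rewrite lt_neqAle a0.
  rewrite [_ @^-1` _](_ : _ = `[((r - b) / a)%R, ((l - b) / a)%R[%classic); last first.
    apply/seteqP; split => x /=; rewrite !in_itv/= /phi;
    by rewrite ltr_ndivlMr// ler_ndivrMr// ltrBlDr lerBrDr [(x * a)%R]mulrC andbC.
  rewrite !lebesgue_measure_itv/= !lte_fin ltr_nM2r ?invr_lt0// ltrD2r.
  case: ifPn => lr; last by rewrite mule0.
  by rewrite -!EFinD -EFinM ltr0_norm//; congr EFin; field; rewrite lt_eqF.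
rewrite -[LHS]/(\int[leb]_x (f \o phi) x).
have -> : \int[leb]_x f x = \int[mscale c pf]_x f x.
  by apply: eq_measure_integral => A mA _; exact: E.
rewrite ge0_integral_mscale//=.
rewrite muleA -EFinM mulVf ?normr_eq0// mul1e.
by rewrite (ge0_integral_pushforward mphi).
Qed.

Lemma ge0_integral_lebesgueRdS d (f : d.+1.-tuple R -> \bar R) :
  measurable_fun setT f -> (forall x, 0 <= f x) ->
  \int[lebesgueRd d.+1]_t f t =
  \int[leb]_x \int[lebesgueRd d]_t f (tcons (x, t)).
Proof.
move=> mf f0 /=.
rewrite (_ : \int[_]_t f t = \int[pushforward (leb \x lebesgueRd d) (@tcons R d)]_t f t)//.
rewrite (ge0_integral_pushforward (@measurable_tcons R d))// preimage_setT.
rewrite fubini_tonelli1//; last by move=> x; exact: f0.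
by apply: measurableT_comp => //; exact: measurable_tcons.
Qed.

Lemma ge0_integral_affv d (f : d.-tuple R -> \bar R) (a : R) (v : d.-tuple R) :
  a != 0%R -> measurable_fun setT f -> (forall x, 0 <= f x) ->
  \int[lebesgueRd d]_x f (affv a v x) =
  (`|a| ^- d)%:E * \int[lebesgueRd d]_x f x.
Proof.
move=> a0; elim: d f v => [|d IH] f v mf f0.
  rewrite /= !integral_dirac//.
    by rewrite expr0 invr1 !mul1e !diracT !mul1e (_ : affv _ _ _ = [tuple])// tuple0.
  by apply: measurableT_comp => //; exact: measurable_affv1.
have mfa : measurable_fun setT (f \o affv a v).
  by apply: measurableT_comp => //; exact: measurable_affv1.
have mft : measurable_fun setT (f \o @tcons R d).
  by apply: measurableT_comp => //; exact: measurable_tcons.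
rewrite ge0_integral_lebesgueRdS//.
have mF : measurable_fun setT (fun x => \int[lebesgueRd d]_t f (tcons (x, t))).
  apply: (measurable_fun_fubini_tonelli_F (f \o @tcons R d)) => //.
  by move=> x; exact: f0.
have mfx x : measurable_fun setT (fun t => f (tcons (x, t))).
  by apply: (measurableT_comp mft).
under eq_integral => x _.
  under eq_integral do rewrite affv_tcons.
  rewrite (IH (fun t => f (tcons (_, t))) [tuple of behead v])//.
  over.
rewrite ge0_integralZl//; last 2 first.
- apply: (measurableT_comp mF).
  by apply: measurable_funD => //; exact: measurable_funM.
- by move=> x _; exact: integral_ge0.
rewrite (ge0_integral_affine _ a0 mF); last first.
  by move=> x; exact: integral_ge0.
rewrite -ge0_integral_lebesgueRdS// muleA -EFinM; congr (EFin _ * _).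
by rewrite exprSr invfM mulrC.
Qed.

End integral_tuple.

Section tuple_boxes.
Context {d : measure_display} {T : measurableType d} {n : nat}.

Definition boxes (G : set (set T)) : set (set (n.-tuple T)) :=
  [set B | exists2 A : 'I_n -> set T, (forall i, G (A i)) &
           B = [set t | forall i, A i (tnth t i)]].

Lemma boxes_setI (G : set (set T)) : setI_closed G -> setI_closed (boxes G).
Proof.
move=> GI _ _ [A GA ->] [A' GA' ->].
exists (fun i => A i `&` A' i); first by move=> i; exact: GI.
by apply/seteqP; split => t /=; [move=> [h h'] i|move=> h; split => i; have [] := h i].
Qed.

Lemma measurable_box (A : 'I_n -> set T) : (forall i, measurable (A i)) ->
  measurable [set t : n.-tuple T | forall i, A i (tnth t i)].
Proof.
move=> mA; rewrite (_ : mkset _ =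
    \bigcap_(i in [set: 'I_n]) ((@tnth n T)^~ i @^-1` A i)); last first.
  by apply/seteqP; split => t /= h i; [move=> _|]; exact: h.
apply: fin_bigcap_measurable => // i _; rewrite -[X in measurable X]setTI.
exact: measurable_tnth.
Qed.

(** For a fixed coordinate, the sets whose preimage lies in the sigma-algebra generated by boxes
    form a sigma-algebra containing [G]: such a preimage is a box whose other sides are [setT],
    whence the second hypothesis. Applied with open sides for the continuity of translations and
    with measurable sides for the law of the sample. *)
Lemma measurable_tuple_boxes (G : set (set T)) :
  measurable = <<s G >> -> G setT ->
  @measurable _ (n.-tuple T) = <<s boxes G >>.
Proof.
move=> mG GT; apply/seteqP; split; last first.
  apply: smallest_sub; first exact: sigma_algebra_measurable.
  move=> _ [A GA ->]; apply: measurable_box => i.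
  by rewrite mG; exact: sub_sigma_algebra.
rewrite [X in X `<=` _]/measurable/=.
apply: smallest_sub; first exact: smallest_sigma_algebra.
rewrite -bigcup_seq => B /= [i _ [A mA <-]]; rewrite setTI.
have H : <<s G >> `<=`
    image_set_system setT (fun t : n.-tuple T => tnth t i) <<s boxes G >>.
  apply: smallest_sub.
    by apply: sigma_algebra_image; exact: smallest_sigma_algebra.
  move=> C GC; rewrite /image_set_system/= setTI.
  apply: sub_sigma_algebra; exists (fun j => if j == i then C else setT).
    by move=> j; case: ifP.
  apply/seteqP; split => t /=; last by move=> /(_ i); rewrite eqxx.
  by move=> Ct j; case: eqP => // ->.
by move: mA; rewrite mG => /H; rewrite /image_set_system/= setTI.
Qed.

End tuple_boxes.

(** * Squared L2 norms and continuity of translations *)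

Section L2_tools.
Context d (T : measurableType d) (R : realType).
Variable mu : {measure set T -> \bar R}.
Local Open Scope ereal_scope.
Implicit Types f g : T -> R.

(** An integral in [\bar R] instead of the square of [L2norm]: pointwise polynomial inequalities can
    then be integrated without discussing finiteness. *)
Definition sqnorm (f : T -> R) : \bar R := \int[mu]_x ((f x) ^+ 2)%:E.

Lemma sqnorm_ge0 f : 0 <= sqnorm f.
Proof. by apply: integral_ge0 => x _; rewrite lee_fin sqr_ge0. Qed.

Lemma measurable_sqE f : measurable_fun setT f ->
  measurable_fun setT (fun x => ((f x) ^+ 2)%:E).
Proof. by move=> mf; apply/measurable_EFinP; exact: measurable_funX. Qed.

Lemma ge0_le_integralT (f g : T -> \bar R) :
  measurable_fun setT f -> measurable_fun setT g ->
  (forall x, 0 <= f x) -> (forall x, f x <= g x) ->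
  \int[mu]_x f x <= \int[mu]_x g x.
Proof. by move=> mf mg f0 fg; apply: ge0_le_integral. Qed.

Lemma sqnormZ (a : R) f : measurable_fun setT f ->
  sqnorm (fun x => a * f x)%R = (a ^+ 2)%:E * sqnorm f.
Proof.
move=> mf; rewrite /sqnorm.
under eq_integral do rewrite exprMn EFinM.
rewrite ge0_integralZl// ?lee_fin ?sqr_ge0//; first exact: measurable_sqE.
by move=> x _; rewrite lee_fin sqr_ge0.
Qed.

Lemma sqnormN f : sqnorm (fun x => - f x)%R = sqnorm f.
Proof. by apply: eq_integral => x _; rewrite sqrrN. Qed.

Lemma sqnormB f g : sqnorm (fun x => f x - g x)%R = sqnorm (fun x => g x - f x)%R.
Proof. by apply: eq_integral => x _; rewrite -sqrrN opprB. Qed.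

Lemma le_sqnorm f g : measurable_fun setT f -> measurable_fun setT g ->
  (forall x, `|f x| <= `|g x|)%R -> sqnorm f <= sqnorm g.
Proof.
move=> mf mg fg; apply: ge0_le_integralT; try exact: measurable_sqE.
  by move=> x; rewrite lee_fin sqr_ge0.
move=> x; rewrite lee_fin -(real_normK (num_real (f x))) -(real_normK (num_real (g x))).
by rewrite ler_sqr ?nnegrE// fg.
Qed.

Lemma sqnormD_le f g : measurable_fun setT f -> measurable_fun setT g ->
  sqnorm (fun x => f x + g x)%R <= 2%:E * sqnorm f + 2%:E * sqnorm g.
Proof.
move=> mf mg; rewrite /sqnorm.
rewrite -!ge0_integralZl//=; try (exact: measurable_sqE);
  try (by move=> x _; rewrite lee_fin sqr_ge0).
have m2 h : measurable_fun setT h -> measurable_fun setT (fun x : T => 2%:E * ((h x : R) ^+ 2)%:E).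
  by move=> mh; apply: measurable_funeM; exact: measurable_sqE.
rewrite -ge0_integralD//=; try (exact: m2);
  try (by move=> x _; rewrite -EFinM lee_fin mulr_ge0// sqr_ge0).
apply: ge0_le_integralT.
- exact/measurable_sqE/measurable_funD.
- by apply: emeasurable_funD; exact: m2.
- by move=> x; rewrite lee_fin sqr_ge0.
- by move=> x; rewrite -!EFinM -EFinD lee_fin -subr_ge0 [leRHS](_ : _ = (f x - g x) ^+ 2)%R ?sqr_ge0 //; ring.
Qed.

Lemma sqnorm_dct (F : T -> R) (g : nat -> T -> R) f :
  measurable_fun setT f -> (forall n, measurable_fun setT (g n)) ->
  measurable_fun setT F ->
  (forall n x, (f x - g n x) ^+ 2 <= F x)%R ->
  \int[mu]_x (F x)%:E < +oo ->
  (forall x, g n x @[n --> \oo] --> f x) ->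
  forall e : R, (0 < e)%R -> \forall n \near \oo,
    sqnorm (fun x => f x - g n x)%R <= e%:E.
Proof.
move=> mf mg mF fgF Foo gf e e0.
have F0 x : (0 <= F x)%R by apply: le_trans (fgF 0%N x); exact: sqr_ge0.
have iF : mu.-integrable setT (EFin \o F).
  apply/integrableP; split; first exact/measurable_EFinP.
  by under eq_integral do rewrite /= ger0_norm//.
have : (\int[mu]_x ((f x - g n x) ^+ 2)%:E @[n --> \oo] --> \int[mu]_x (cst 0 x))%E.
  apply: (@dominated_cvg _ _ _ mu setT measurableT _ _ (EFin \o F)) => //.
  - by move=> n; apply: measurable_sqE; exact: measurable_funB.
  - move=> x _; apply: cvg_EFin; first by apply: nearW.
    have h : (f x - g n x @[n --> \oo] --> (0 : R))%R.
      by rewrite -(subrr (f x)); apply: cvgB; [exact: cvg_cst|exact: gf].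
    by have := cvgM h h; rewrite mulr0; apply. 
  - by move=> n x _ /=; rewrite lee_fin ger0_norm ?sqr_ge0.
rewrite integral0 => /fine_cvgP[fin /cvgrPdist_le/(_ e e0)].
apply: filterS2 fin => n fin /=; rewrite sub0r normrN => h.
rewrite /sqnorm -(fineK fin) lee_fin; apply: le_trans h; exact: ler_norm.
Qed.

End L2_tools.

Section translation_continuity.
Context {R : realType} {d : nat}.
Local Open Scope ereal_scope.
Local Notation mu := (lebesgueRd d).
Local Notation V := (d.-tuple R).

Lemma sqnorm_affv (f : V -> R) (a : R) v : a != 0%R -> measurable_fun setT f ->
  sqnorm mu (f \o affv a v) = (`|a| ^- d)%:E * sqnorm mu f.
Proof.
move=> a0 mf; rewrite /sqnorm.
rewrite -(ge0_integral_affv v a0 (measurable_sqE mf))// => x.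
by rewrite lee_fin sqr_ge0.
Qed.

Lemma sqnorm_affv1 (f : V -> R) v : measurable_fun setT f ->
  sqnorm mu (f \o affv 1 v) = sqnorm mu f.
Proof.
by move=> mf; rewrite sqnorm_affv ?oner_eq0// normr1 expr1n invr1 mul1e.
Qed.

Variable z : nat -> V.
Hypothesis z0 : forall k, tnth (z n) k @[n --> \oo] --> (0 : R)%R.

Let tau n : V -> V := affv 1 (z n).

Let mtau n (f : V -> R) : measurable_fun setT f -> measurable_fun setT (f \o tau n).
Proof. by move=> mf; apply: measurableT_comp => //; exact: measurable_affv1. Qed.

(* The class of such f contains the indicators of open boxes and is stable under
   L2 approximation, hence contains every square integrable function. *)
Let good (f : V -> R) := measurable_fun setT f /\
  forall e : R, (0 < e)%R -> \forall n \near \oo,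
    sqnorm mu (fun x => f (tau n x) - f x)%R <= e%:E.

Let goodD f g : good f -> good g -> good (fun x => f x + g x)%R.
Proof.
move=> [mf gf] [mg gg]; split; first exact: measurable_funD.
move=> e e0; have e4 : (0 < e / 4)%R by rewrite divr_gt0.
near=> n.
rewrite (_ : (fun x => _) = (fun x => (f (tau n x) - f x) + (g (tau n x) - g x)))%R;
  last by apply/funext => x; rewrite opprD addrACA.
apply: (le_trans (sqnormD_le _ _ _)).
- by apply: measurable_funB => //; exact: mtau.
- by apply: measurable_funB => //; exact: mtau.
apply: (@le_trans _ _ (2%:E * (e / 4)%:E + 2%:E * (e / 4)%:E)).
  by apply: leeD; apply: lee_pmul; rewrite ?lee_fin ?sqnorm_ge0//; near: n; [exact: gf|exact: gg].
by rewrite -!EFinM -EFinD lee_fin; lra.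
Unshelve. all: by end_near. Qed.

Let goodZ a f : good f -> good (fun x => a * f x)%R.
Proof.
move=> [mf gf]; split; first exact: measurable_funM.
move=> e e0.
have a1 : (0 < a ^+ 2 + 1)%R by rewrite ltr_wpDl ?sqr_ge0.
near=> n.
rewrite (_ : (fun x => _) = (fun x => a * (f (tau n x) - f x)))%R;
  last by apply/funext => x; rewrite mulrBr.
rewrite sqnormZ; last by apply: measurable_funB => //; exact: mtau.
apply: (@le_trans _ _ ((a ^+ 2)%:E * (e / (a ^+ 2 + 1))%:E)).
  apply: lee_pmul; rewrite ?lee_fin ?sqnorm_ge0 ?sqr_ge0//.
  by near: n; apply: gf; rewrite divr_gt0.
by rewrite -EFinM lee_fin mulrCA ger_pMr// ler_pdivrMr// mul1r lerDl.
Unshelve. all: by end_near. Qed.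

(** Translations are isometries, so in the splitting f o tau - f = (f - g) o tau + (g o tau - g) +
    (g - f) the outer terms are as small as the approximation error. With each piece below e/16, the
    two uses of [sqnormD_le] give 10e/16. *)
Let good_lim (f : V -> R) : measurable_fun setT f ->
  (forall e : R, (0 < e)%R -> exists2 g, good g & sqnorm mu (fun x => f x - g x)%R <= e%:E) ->
  good f.
Proof.
move=> mf fg; split=> // e e0; have e16 : (0 < e / 16)%R by rewrite divr_gt0.
have [g [mg gg] fge] := fg _ e16.
have mfg : measurable_fun setT (fun x => f x - g x)%R by exact: measurable_funB.
near=> n.
rewrite (_ : (fun x => _) = (fun x => ((f \- g) \o tau n) x +
  ((g (tau n x) - g x) + (g x - f x))))%R;
  last by apply/funext => x /=; rewrite addrA subrKA subrKA.
have m1 : measurable_fun setT (fun x => g (tau n x) - g x)%R.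
  by apply: measurable_funB => //; exact: mtau.
have m2 : measurable_fun setT (fun x => g x - f x)%R by exact: measurable_funB.
apply: (le_trans (sqnormD_le _ _ _)).
- exact: mtau.
- exact: measurable_funD.
rewrite sqnorm_affv1//.
apply: (@le_trans _ _ (2%:E * (e / 16)%:E +
    2%:E * (2%:E * (e / 16)%:E + 2%:E * (e / 16)%:E))).
  apply: leeD; apply: lee_pmul; rewrite ?lee_fin ?sqnorm_ge0//.
  apply: (le_trans (sqnormD_le _ m1 m2)).
  apply: leeD; apply: lee_pmul; rewrite ?lee_fin ?sqnorm_ge0//.
    by near: n; exact: gg.
  by rewrite sqnormB.
by rewrite -!(EFinM, EFinD) lee_fin; lra.
Unshelve. all: by end_near. Qed.

(** A point of an open box stays in it under small shifts, so dominated convergence handles the part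
    of B that is shifted out of B. The part shifted into B has the same measure, because translation
    preserves the finite volume of B. *)
Let good_box (A : 'I_d -> set R) : (forall k, open (A k)) ->
  mu [set t | forall k, A k (tnth t k)] < +oo ->
  good (\1_[set t : V | forall k, A k (tnth t k)]).
Proof.
move=> oA; set B := mkset _ => Boo.
have mB : measurable B.
  by apply: measurable_box => k; exact: open_measurable.
have m1 : measurable_fun setT (\1_B : V -> R) by exact: measurable_indic.
split=> // e e0; have e2 : (0 < e / 2)%R by rewrite divr_gt0.
have int1 : \int[mu]_x (\1_B x)%:E = mu B by rewrite integral_indic// setIT.
have key : \forall n \near \oo,
    sqnorm mu (fun x => \1_B x - (\1_B x * \1_B (tau n x)))%R <= (e / 2)%:E.
  apply: (sqnorm_dct (F := \1_B)) => //.
  - by move=> n; apply: measurable_funM => //; exact: mtau.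
  - by move=> n x; rewrite !indicE; case: (x \in B); case: (tau n x \in B) => /=; lra.
  - by rewrite int1.
  move=> x; rewrite indicE.
  have [xB|xB] := boolP (x \in B); last by under eq_fun do rewrite mul0r; exact: cvg_cst.
  apply: cvg_near_cst.
  have : \forall n \near \oo, forall k, A k (tnth (tau n x) k).
    apply: filter_forall => k.
    have /oA : A k (tnth x k) by move: xB; rewrite inE; exact.
    have h : tnth (tau n x) k @[n --> \oo] --> tnth x k.
      under eq_fun do rewrite /tau tnth_affv mul1r.
      have -> : nbhs (tnth x k) = nbhs (tnth x k + 0)%R by rewrite addr0.
      by apply: cvgD; [exact: cvg_cst|exact: z0].
    by move=> Ak; apply: h; exact: Ak.
  by apply: filterS => n h; rewrite mul1r indicE mem_set.
apply: filterS key => n key.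
have mt : measurable_fun setT (\1_B \o tau n : V -> R) by exact: mtau.
(* The symmetric difference of B and its translate has twice the measure of one of its halves; the
   identity is stated additively to avoid subtraction in [\bar R]. *)
have H : sqnorm mu (fun x => \1_B (tau n x) - \1_B x)%R + mu B =
   mu B + 2%:E * sqnorm mu (fun x => \1_B x - (\1_B x * \1_B (tau n x)))%R.
  have E : mu B = \int[mu]_x ((\1_B \o tau n) x)%:E.
    rewrite -int1 (ge0_integral_affv (f := fun x => (\1_B x)%:E) (z n) (oner_neq0 _))//.
      by rewrite normr1 expr1n invr1 mul1e.
    exact/measurable_EFinP.
  rewrite {2}E.
  rewrite -int1 /sqnorm.
  rewrite -ge0_integralZl//=; last first.
    + by move=> x _; rewrite lee_fin sqr_ge0.
    + by apply: measurable_sqE; apply: measurable_funB => //; exact: measurable_funM.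
  rewrite -!ge0_integralD//=.
  - apply: eq_integral => x _; rewrite -EFinM -!EFinD; congr EFin.
    by rewrite !indicE; case: (x \in B); case: (tau n x \in B) => /=; lra.
  - exact/measurable_EFinP.
  - by move=> x _; rewrite -EFinM lee_fin mulr_ge0// sqr_ge0.
  - apply: measurable_funeM; apply: measurable_sqE; apply: measurable_funB => //.
    exact: measurable_funM.
  - by move=> x _; rewrite lee_fin sqr_ge0.
  - by apply: measurable_sqE; apply: measurable_funB.
  - exact/measurable_EFinP.
have Bfin : mu B \is a fin_num by rewrite ge0_fin_numE.
move: H; rewrite [RHS]addeC => H.
have -> : sqnorm mu (fun x => \1_B (tau n x) - \1_B x)%R =
  2%:E * sqnorm mu (fun x => \1_B x - (\1_B x * \1_B (tau n x)))%R.
  by rewrite -[LHS](addeK _ Bfin) H addeK.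
apply: (@le_trans _ _ (2%:E * (e / 2)%:E)); first by apply: lee_pmul; rewrite ?lee_fin ?sqnorm_ge0.
by rewrite -EFinM lee_fin; lra.
Qed.

(** Bounded windows: intersected with [bigbox N], every measurable set has finite measure, so
    complements within the window and unions can be treated in L2. *)
Let oint (N : nat) : set R := [set` `](- N%:R)%R, (N%:R)%R[ ].

Let bigbox (N : nat) : set V := [set t | forall k, oint N (tnth t k)].

Let box_lty (N : nat) (A : 'I_d -> set R) : (forall k, measurable (A k)) ->
  mu [set t | forall k, (A k `&` oint N) (tnth t k)] < +oo.
Proof.
move=> mA; have mAN k : measurable (A k `&` oint N).
  by apply: measurableI => //; exact: measurable_itv.
rewrite (lebesgueRd_box mAN).
apply: (@le_lt_trans _ _ `|\prod_(k < d) lebesgue_measure (A k `&` oint N)|).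
  exact: lee_abs.
rewrite -fin_num_abs.
apply: prode_fin_num => k _; rewrite ge0_fin_numE//.
apply: (@le_lt_trans _ _ (lebesgue_measure (oint N))).
  by apply: le_measure; rewrite ?inE; [exact: mAN|exact: measurable_itv|exact: subIsetr].
by rewrite lebesgue_measure_itv/= lte_fin; case: ifP => _ //; rewrite -EFinD ltry.
Qed.

Let good_bigbox_open (N : nat) (A : 'I_d -> set R) : (forall k, open (A k)) ->
  good (\1_([set t : V | forall k, A k (tnth t k)] `&` bigbox N)).
Proof.
move=> oA.
have -> : [set t : V | forall k, A k (tnth t k)] `&` bigbox N =
    [set t : V | forall k, (A k `&` oint N) (tnth t k)].
  by apply/seteqP; split => t /=; [move=> [h h'] k|move=> h; split => k; have [] := h k].
apply: (@good_box (fun k => A k `&` oint N)).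
  by move=> k; apply: openI => //; exact: itv_open.
by apply: box_lty => k; exact: open_measurable.
Qed.

Let good_bigbox N : good (\1_(bigbox N)).
Proof.
have /= := @good_bigbox_open N (fun=> setT) (fun=> openT).
by rewrite (_ : mkset _ = setT) ?setTI//; apply/seteqP; split.
Qed.

Let mbigbox N : measurable (bigbox N).
Proof. by apply: (@measurable_box _ _ _ (fun=> oint N)) => k; exact: measurable_itv. Qed.

Let bigbox_lty N : mu (bigbox N) < +oo.
Proof.
have := @box_lty N (fun=> setT) (fun=> measurableT).
rewrite (_ : mkset _ = bigbox N)//.
by apply/seteqP; split => t /= h k; [have [] := h k|split => //; exact: h].
Qed.

Let good0 : good (fun=> 0%R).
Proof.
have := @goodZ 0%R _ (good_bigbox 0).
by rewrite (_ : (fun x => _) = cst 0%R)//; apply/funext => x; rewrite mul0r.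
Qed.

(** Dynkin's argument inside a fixed window. A complement is the difference of two good indicators,
    a disjoint union is a limit of finite sums; the latter converge in L2, not merely pointwise,
    because the window has finite measure. *)
Let good_indic (N : nat) (S : set V) : measurable S -> good (\1_(S `&` bigbox N)).
Proof.
have mR : (measurable : set (set R)) = <<s [set A : set R | open A] >>.
  apply/seteqP; split.
    have -> : (measurable : set (set R)) = <<s @RGenOInfty.G R >>.
      exact: RGenOInfty.measurableE.
    apply: sub_sigma_algebra2 => _ [x ->]; exact: rray_open.
  apply: smallest_sub; first exact: sigma_algebra_measurable.
  by move=> A oA; exact: open_measurable.
have mV := measurable_tuple_boxes (n := d) mR openT.
rewrite mV; move: S.
apply: (dynkin_induction mV).
- by apply: boxes_setI => A B; exact: openI.
- by rewrite setTI.
- by move=> _ [A oA ->]; exact: good_bigbox_open.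
- move=> S mS gS.
  have := goodD (good_bigbox N) (goodZ (-1) gS).
  congr good; apply/funext => x; rewrite !indicE !in_setI in_setC.
  by case: (x \in S); case: (x \in bigbox N) => /=; lra.
- move=> F mF tF gF.
  have mU m : measurable (\big[setU/set0]_(k < m) F k) by exact: bigsetU_measurable.
  have gU m : good (\1_(\big[setU/set0]_(k < m) F k `&` bigbox N)).
    elim: m => [|m IH].
      by rewrite big_ord0 set0I indic0; exact: good0.
    have := goodD IH (gF m).
    congr good; apply/funext => x; rewrite !indicE big_ord_recr/= !in_setI in_setU.
    have [xF|xF] := boolP (x \in F m); last by rewrite orbF andFb/= addr0.
    rewrite (_ : x \in \big[setU/set0]_(i < m) F i = false)/= ?add0r//.
    apply/negbTE/negP; rewrite inE -bigcup_mkord => -[k /= km Fk].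
    have := tF _ _ Logic.I Logic.I (ex_intro _ x (conj Fk (set_mem xF))).
    by move=> kE; rewrite kE ltnn in km.
  have mUN : measurable (\bigcup_k F k `&` bigbox N).
    by apply: measurableI => //; exact: bigcupT_measurable.
  apply: good_lim => // e e0.
  have [||||||m _ /(_ m (leqnn _)) h] := @sqnorm_dct _ _ _ mu (\1_(bigbox N))
      (fun m => \1_(\big[setU/set0]_(k < m) F k `&` bigbox N))
      (\1_(\bigcup_k F k `&` bigbox N)) _ _ _ _ _ _ e e0.
  - exact: measurable_indic.
  - by move=> m; apply: measurable_indic; exact: measurableI.
  - exact: measurable_indic.
  - move=> m x; rewrite !indicE !in_setI.
    by case: (x \in bigbox N); case: (x \in \bigcup_k F k);
      case: (x \in \big[setU/set0]_(k < m) F k) => /=; lra.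
  - by rewrite integral_indic ?setIT; [exact: bigbox_lty|exact: measurableT|exact: mbigbox].
  - move=> x; apply: cvg_near_cst.
    have [[k _ Fk]|nF] := pselect ((\bigcup_k F k) x).
      exists k.+1 => // m /= km; rewrite !indicE !in_setI; congr (nat_of_bool (_ && _))%:R.
      rewrite !mem_set//; first by exists k.
      by rewrite -bigcup_mkord; exists k.
    apply: nearW => m; rewrite !indicE !in_setI; congr (nat_of_bool (_ && _))%:R.
    rewrite !memNset//; rewrite -bigcup_mkord => -[k _ Fk]; apply: nF; by exists k.
  by exists (\1_(\big[setU/set0]_(k < m) F k `&` bigbox N)).
Qed.

Let good_sum (I : Type) (s : seq I) (f : I -> V -> R) :
  (forall i, good (f i)) -> good (fun x => \sum_(i <- s) f i x)%R.
Proof.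
move=> gf; elim: s => [|i s IH].
  by under [X in good X]funext do rewrite big_nil; exact: good0.
by under [X in good X]funext do rewrite big_cons; exact: goodD.
Qed.

Let good_sfun (N : nat) (f : {nnsfun V >-> R}) :
  good (fun x => f x * \1_(bigbox N) x)%R.
Proof.
have -> : (fun x => f x * \1_(bigbox N) x)%R = (fun x =>
    \sum_(y <- fset_set (range f)) (y * \1_(f @^-1` [set y] `&` bigbox N) x))%R.
  apply/funext => x; rewrite fimfunE fsbig_finite//= mulr_suml.
  by apply: eq_bigr => y _; rewrite indicI -mulrA.
apply: good_sum => y; apply: goodZ; apply: good_indic.
exact: measurable_sfunP.
Qed.

Let bigbox_near (x : V) : \forall N \near \oo, bigbox N x.
Proof.
apply: filter_forall => k.
near=> N; rewrite /oint/= in_itv/= -ltr_norml.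
by near: N; exact: nbhs_infty_gtr.
Unshelve. all: by end_near. Qed.

Let good_ge0 (f : V -> R) : measurable_fun setT f -> (forall x, 0 <= f x)%R ->
  sqnorm mu f < +oo -> good f.
Proof.
move=> mf f0 foo; apply: good_lim => // e e0.
have mEf : measurable_fun setT (EFin \o f) by exact/measurable_EFinP.
pose h := nnsfun_approx measurableT mEf.
have Ef0 x : setT x -> 0 <= (EFin \o f) x by rewrite lee_fin.
have hf x : h n x @[n --> \oo] --> f x.
  by have /fine_cvgP[] := cvg_nnsfun_approx measurableT mEf Ef0 (x := x) Logic.I.
have hle n x : (h n x <= f x)%R.
  by rewrite -lee_fin /h nnsfun_approxE; exact: (le_approx n Ef0).
(* The cut-off makes the approximant a finite combination of the indicators of [good_indic]; as 0 <=
   h n <= f, the squared error stays below f^2. *)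
pose g n x := (h n x * \1_(bigbox n) x)%R.
have mg n : measurable_fun setT (g n).
  by apply: measurable_funM => //; exact: measurable_indic.
have [||||||m _ /(_ m (leqnn _)) hm] := @sqnorm_dct _ _ _ mu (fun x => f x ^+ 2)%R g f _ _ _ _ _ _ e e0.
- exact: mf.
- exact: mg.
- exact: measurable_funX.
- move=> n x; rewrite /g indicE; have := hle n x; have : (0 <= h n x)%R by [].
  by case: (x \in bigbox n) => /= h0 hf'; have := f0 x; nra.
- exact: foo.
- move=> x; apply: cvg_trans (hf x); apply: near_eq_cvg.
  have := bigbox_near x; apply: filterS => n xn.
  by rewrite /g indicE mem_set// mulr1.
by exists (g m) => //; exact: good_sfun.
Qed.

Let good_L2 (f : V -> R) : measurable_fun setT f -> sqnorm mu f < +oo -> good f.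
Proof.
move=> mf foo.
have mp : measurable_fun setT (fun x => Num.max (f x) 0)%R by exact: measurable_maxr.
have mn : measurable_fun setT (fun x => Num.max (- f x) 0)%R.
  by apply: measurable_maxr => //; exact: measurableT_comp.
have := goodD (good_ge0 mp _ _) (goodZ (-1) (good_ge0 mn _ _)).
rewrite (_ : (fun x => _) = f).
  apply; try by move=> x; rewrite le_max lexx orbT.
  - apply: le_lt_trans foo; apply: le_sqnorm => // x.
    by case: (leP 0%R (f x)) => fx; rewrite ?normr0 ?normr_ge0.
  - apply: le_lt_trans foo; apply: le_sqnorm => // x.
    by case: (leP 0%R (- f x)%R) => fx; rewrite ?normrN ?normr0 ?normr_ge0.
by apply/funext => x; rewrite /Num.max; case: ifPn => h1; case: ifPn => h2; lra.
Qed.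

Lemma sqnorm_translation_cvg (f : V -> R) :
  measurable_fun setT f -> sqnorm mu f < +oo ->
  forall e : R, (0 < e)%R -> \forall n \near \oo,
    sqnorm mu (fun x => f (affv 1 (z n) x) - f x)%R <= e%:E.
Proof. by move=> mf foo; have [] := good_L2 mf foo. Qed.

End translation_continuity.

(** * Plancherel's theorem *)

Section Rintegral_tools.
Context d (T : measurableType d) (R : realType) (mu : {measure set T -> \bar R}).
Local Notation integrable f := (mu.-integrable setT (EFin \o f)).

Lemma EFin_Rintegral (f : T -> R) : integrable f ->
  (\int[mu]_x (f x)%:E)%E = (\int[mu]_x f x)%:E.
Proof. by move=> i; rewrite fineK//; exact: integrable_fin_num. Qed.

Lemma RintegralE (f : T -> R) (r : R) : (\int[mu]_x (f x)%:E)%E = r%:E ->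
  \int[mu]_x f x = r.
Proof. by rewrite /Rintegral => ->. Qed.

Lemma integrable_measurable (f : T -> R) : integrable f -> measurable_fun setT f.
Proof. by move=> /measurable_int/measurable_EFinP. Qed.

Lemma ge0_integrable (f : T -> R) : measurable_fun setT f -> (forall x, 0 <= f x) ->
  (\int[mu]_x (f x)%:E < +oo)%E -> integrable f.
Proof.
move=> mf f0 foo; apply/integrableP; split; first exact/measurable_EFinP.
by under eq_integral do rewrite /= ger0_norm//.
Qed.

Lemma integrable_lty_abs (f : T -> R) : integrable f -> (\int[mu]_x `|f x|%:E < +oo)%E.
Proof. by move=> /integrableP[_]. Qed.

Lemma dominated_integrableR (f g : T -> R) : measurable_fun setT f ->
  integrable g -> (forall x, `|f x| <= g x) -> integrable f.
Proof.
move=> mf ig fg; apply: (le_integrable measurableT _ _ ig); first exact/measurable_EFinP.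
by move=> x _ /=; rewrite lee_fin (le_trans (fg x))// ler_norm.
Qed.

Lemma bounded_integrable (f g : T -> R) M : measurable_fun setT f ->
  (forall x, `|f x| <= M) -> integrable g -> integrable (fun x => f x * g x).
Proof.
move=> mf fM ig.
have ig' : integrable (fun x => M * `|g x|).
  have := integrableZl measurableT M (integrable_abse ig).
  by apply: eq_integrable => // x _; rewrite /= EFinM.
apply: dominated_integrableR ig' _.
  by apply: measurable_funM => //; exact: integrable_measurable.
by move=> x; rewrite normrM ler_wpM2r.
Qed.

Lemma integrableDR (f g : T -> R) : integrable f -> integrable g ->
  integrable (fun x => f x + g x).
Proof. by move=> fi gi; apply: eq_integrable (integrableD measurableT fi gi). Qed.

Lemma integrableBR (f g : T -> R) : integrable f -> integrable g ->
  integrable (fun x => f x - g x).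
Proof. by move=> fi gi; apply: eq_integrable (integrableB measurableT fi gi). Qed.

Lemma integrableZR a (f : T -> R) : integrable f -> integrable (fun x => a * f x).
Proof. by move=> fi; apply: eq_integrable (integrableZl measurableT a fi). Qed.

End Rintegral_tools.

(** * The Laplace kernel on the line and its Fourier transform *)

Section Laplace_1d.
Context {R : realType}.
Local Notation leb := (@lebesgue_measure R).

Definition laplace (t : R) : R := expR (- `|t|).
Definition cauchy (x : R) : R := 2 / (1 + x ^+ 2).

Lemma laplace_gt0 t : 0 < laplace t. Proof. exact: expR_gt0. Qed.

Lemma continuous_laplace : continuous laplace.
Proof.
move=> t; apply: continuous_comp; last exact: continuous_expR.
by apply: continuousN; exact: norm_continuous.
Qed.

Lemma measurable_laplace : measurable_fun setT laplace.
Proof. by apply: continuous_measurable_fun; exact: continuous_laplace. Qed.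

Lemma cauchy_gt0 x : 0 < cauchy x.
Proof. by rewrite divr_gt0// ltr_wpDr ?sqr_ge0. Qed.

Lemma measurable_cauchy : measurable_fun setT cauchy.
Proof.
apply: measurable_funM => //.
by apply: continuous_measurable_fun; exact: continuous_oneDsqrV.
Qed.

(** A primitive in t of exp(-t) (1 + cos(x t)). The summand 1 keeps the integrand nonnegative, as
    the improper fundamental theorem of calculus used below requires; the cosine integral is
    recovered afterwards by subtracting the integral of [laplace], itself the case x = 0. *)
Let F (x t : R) : R :=
  expR (- t) * ((x * sin (x * t) - cos (x * t)) / (1 + x ^+ 2) - 1).

Let is_derive_mulx (x t : R) : is_derive t 1 (fun t : R => x * t) x.
Proof.
have h := @is_deriveZ _ _ _ id x t 1 1 (is_derive_id t 1).
by apply: is_derive_eq; rewrite /GRing.scale/= mulr1.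
Qed.

Let dF (x t : R) : is_derive t 1 (F x) (expR (- t) * (1 + cos (x * t))).
Proof.
have d1 : is_derive t 1 (fun t => expR (- t)) (- expR (- t)).
  have := @is_derive1_comp _ expR -%R t _ _ (is_derive_expR _) (is_deriveNid t 1).
  by move=> h; apply: is_derive_eq; rewrite mulrN1.
have d2 : is_derive t 1 (fun t => sin (x * t)) (cos (x * t) * x).
  exact: (@is_derive1_comp _ sin (fun t => x * t) t _ _ (is_derive_sin _)).
have d3 : is_derive t 1 (fun t => cos (x * t)) (- sin (x * t) * x).
  exact: (@is_derive1_comp _ cos (fun t => x * t) t _ _ (is_derive_cos _)).
have d4 := is_deriveB (is_deriveZ x d2) d3.
have d5 := is_deriveB (is_deriveZ (1 + x ^+ 2)^-1 d4) (is_derive_cst (1 : R) t 1).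
have d6 := is_deriveM d1 d5.
have E : F x = (fun s => expR (- s)) * ((1 + x ^+ 2)^-1 *:
    (x *: (fun s => sin (x * s)) - (fun s => cos (x * s))) - cst 1).
  by apply/funext => s; rewrite /F [_ / (1 + x ^+ 2)]mulrC.
rewrite E; apply: (is_derive_eq d6); rewrite /GRing.scale/=.
have x0 : 1 + x ^+ 2 != 0 by rewrite gt_eqF// ltr_wpDr ?sqr_ge0.
rewrite (_ : (_ - cst 1) t = (1 + x ^+ 2)^-1 * (x * sin (x * t) - cos (x * t)) - 1)//.
by field.
Qed.

Let FTC x : (\int[leb]_(t in `[0%R, +oo[) (expR (- t) * (1 + cos (x * t)))%:E =
  (1 + (1 + x ^+ 2)^-1)%:E)%E.
Proof.
have cont : continuous (fun t => expR (- t) * (1 + cos (x * t))).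
  move=> t; apply: cvgM.
    by apply: continuous_comp; [exact: opp_continuous|exact: continuous_expR].
  apply: cvgD; first exact: cvg_cst.
  apply: continuous_comp; last exact: continuous_cos.
  exact: mulrl_continuous.
have cF t : {for t, continuous (F x)}.
  by apply: differentiable_continuous; apply/derivable1_diffP; have [] := dF x t.
rewrite (@ge0_continuous_FTC2y _ _ (F x) 0 0)//.
- rewrite /F -EFinD; congr EFin; rewrite oppr0 expR0 mulr0 sin0 cos0.
  by rewrite mulr0 !sub0r mul1r opprD mulN1r !opprK addrC.
- exact: continuous_subspaceT.
- apply/cvgr0Pnorm_le => e e0.
  (* [M] bounds the trigonometric factor of [F] uniformly in t. *)
  pose M := (`|x| + 1) / (1 + x ^+ 2) + 1.
  have M0 : 0 < M by rewrite ltr_wpDl// divr_ge0// addr_ge0// sqr_ge0.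
  have : \forall t \near +oo%R, expR (- t) <= e / M.
    have /cvgr0Pnorm_le/(_ (e / M)) : expR (- t) @[t --> +oo%R] --> (0 : R).
      exact: cvgr_expR.
    rewrite divr_gt0// => /(_ isT); apply: filterS => t.
    by rewrite ger0_norm ?expR_ge0.
  apply: filterS => t te; rewrite /F normrM ger0_norm ?expR_ge0//.
  have -> : e = e / M * M by rewrite divfK// gt_eqF.
  apply: ler_pM => //; rewrite ?expR_ge0//.
  apply: (le_trans (ler_normB _ _)); rewrite normr1 lerD2r normrM.
  rewrite [X in _ * X <= _]ger0_norm ?invr_ge0 ?addr_ge0 ?sqr_ge0//.
  rewrite ler_wpM2r ?invr_ge0 ?addr_ge0 ?sqr_ge0//.
  apply: (le_trans (ler_normB _ _)); apply: lerD; last exact: cos_max.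
  by rewrite normrM ler_piMr// sin_max.
- by apply: cvg_at_right_filter; exact: cF.
- by move=> t _; rewrite derive1E; have [_ ->] := dF x t.
Qed.

Let FTC_even x : (\int[leb]_t (laplace t * (1 + cos (x * t)))%:E =
  (2 * (1 + (1 + x ^+ 2)^-1))%:E)%E.
Proof.
rewrite ge0_symfun_integralT//.
- rewrite EFinM -FTC; congr (_ * _)%E; rewrite set_itvcy.
  by apply: eq_integral => t /[!inE]/= t0; rewrite /laplace ger0_norm.
- move=> t; rewrite mulr_ge0 ?expR_ge0// -lerBlDl sub0r; exact: cos_geN1.
- move=> t; apply: cvgM; first exact: continuous_laplace.
  apply: cvgD; first exact: cvg_cst.
  apply: continuous_comp; last exact: continuous_cos.
  exact: mulrl_continuous.
- by move=> t; rewrite /= /laplace normrN mulrN cosN.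
Qed.

Lemma integral_laplace : (\int[leb]_t (laplace t)%:E = 2%:E)%E.
Proof.
have := FTC_even 0.
have -> : (2 * (1 + (1 + 0 ^+ 2)^-1) = 2 * 2 :> R) by rewrite expr0n/= addr0 invr1.
rewrite (_ : (\int[leb]_t _ = \int[leb]_t (2%:E * (laplace t)%:E))%E); last first.
  by apply: eq_integral => t _; rewrite mul0r cos0 -EFinM mulrC.
rewrite ge0_integralZl//; last 2 first.
- by apply/measurable_EFinP; exact: measurable_laplace.
- by move=> t _; rewrite lee_fin expR_ge0.
rewrite EFinM => H; have := congr1 (fun z => (2^-1)%:E * z)%E H.
by rewrite !muleA -EFinM mulVf// !mul1e.
Qed.

Lemma integrable_laplace : leb.-integrable setT (EFin \o laplace).
Proof.
apply: ge0_integrable; first exact: measurable_laplace.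
  by move=> t; exact: expR_ge0.
by rewrite integral_laplace ltry.
Qed.

Lemma measurable_cosM (x : R) : measurable_fun setT (fun t => cos (x * t)).
Proof.
apply: measurableT_comp; first by apply: continuous_measurable_fun; exact: continuous_cos.
exact: mulrl_measurable.
Qed.

Lemma measurable_sinM (x : R) : measurable_fun setT (fun t => sin (x * t)).
Proof.
apply: measurableT_comp; first by apply: continuous_measurable_fun; exact: continuous_sin.
exact: mulrl_measurable.
Qed.

Lemma integrable_cos_laplace x :
  leb.-integrable setT (fun t => (cos (x * t) * laplace t)%:E).
Proof.
apply: (bounded_integrable (M := 1)); [exact: measurable_cosM| |exact: integrable_laplace].
by move=> t; exact: cos_max.
Qed.

Lemma integrable_sin_laplace x :
  leb.-integrable setT (fun t => (sin (x * t) * laplace t)%:E).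
Proof.
apply: (bounded_integrable (M := 1)); [exact: measurable_sinM| |exact: integrable_laplace].
by move=> t; exact: sin_max.
Qed.

Lemma integral_cos_laplace x :
  (\int[leb]_t (cos (x * t) * laplace t)%:E = (cauchy x)%:E)%E.
Proof.
have := FTC_even x.
rewrite (_ : (\int[leb]_t _ = \int[leb]_t ((laplace t)%:E + (cos (x * t) * laplace t)%:E))%E); last first.
  by apply: eq_integral => t _; rewrite -EFinD mulrDr mulr1 [laplace t * _]mulrC.
rewrite integralD//; [|exact: integrable_laplace|exact: integrable_cos_laplace].
rewrite integral_laplace (EFin_Rintegral (integrable_cos_laplace x)) -EFinD => -[H].
by congr EFin; rewrite /cauchy; lra.
Qed.

(** Oddness, used through the reflection t -> -t. Since the change of variables is stated for
    nonnegative functions, it is applied to the product of [laplace] with 1 + sin, whose reflection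
    is the product with 1 - sin. *)
Lemma integral_sin_laplace x : (\int[leb]_t (sin (x * t) * laplace t)%:E = 0)%E.
Proof.
pose G (s t : R) := ((laplace t)%:E + (s * (sin (x * t) * laplace t))%:E)%E.
have iG s : leb.-integrable setT (fun t => (s * (sin (x * t) * laplace t))%:E).
  exact: integrableZR (integrable_sin_laplace x).
have EG s : (\int[leb]_t G s t = 2%:E + s%:E * \int[leb]_t (sin (x * t) * laplace t)%:E)%E.
  rewrite integralD//; last exact: integrable_laplace.
  rewrite integral_laplace; congr (_ + _)%E.
  by under eq_integral do rewrite EFinM; rewrite integralZl//; exact: integrable_sin_laplace.
have : (\int[leb]_t G 1%R t = \int[leb]_t G (-1)%R t)%E.
  rewrite -[LHS]mul1e -(_ : (`|-1 : R|^-1)%:E = 1%E); last by rewrite normrN1 invr1.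
  rewrite -(ge0_integral_affine (f := G 1) 0); last 3 first.
  - by rewrite oppr_eq0 oner_eq0.
  - by apply: emeasurable_funD; apply/measurable_EFinP;
      [exact: measurable_laplace|exact: integrable_measurable (iG 1)].
  - move=> t; rewrite /G -EFinD lee_fin.
    rewrite (_ : _ + _ = (1 + sin (x * t)) * laplace t); last by ring.
    by apply: mulr_ge0; [rewrite -lerBlDl sub0r sin_geN1|exact: expR_ge0].
  apply: eq_integral => t _; rewrite /G addr0 mulN1r mulrN sinN /laplace normrN.
  by rewrite mul1r mulN1r mulNr.
rewrite !EG (EFin_Rintegral (integrable_sin_laplace x)) -!EFinM -!EFinD => -[] H.
by congr EFin; lra.
Qed.

Lemma integral_cauchy : (\int[leb]_x (cauchy x)%:E = (2 * pi)%:E)%E.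
Proof.
rewrite ge0_symfun_integralT.
- rewrite -set_itvcy EFinM; congr (_ * _)%E.
  rewrite [RHS](_ : _ = 2%:E * (pi / 2)%:E)%E; last by rewrite -EFinM mulrCA divff// mulr1.
  rewrite -integral0y_oneDsqr -ge0_integralZl//.
  - apply/measurable_EFinP; apply: measurable_funTS.
    by apply: continuous_measurable_fun; exact: continuous_oneDsqrV.
- by move=> x; exact/ltW/cauchy_gt0.
- by move=> x; apply: cvgM; [exact: cvg_cst|exact: continuous_oneDsqrV].
- by move=> x; rewrite /= /cauchy sqrrN.
Qed.

End Laplace_1d.

Section lebesgueRdS_integrable.
Context {R : realType} (d : nat).
Local Notation leb := (@lebesgue_measure R).

Lemma integrable_tcons (f : d.+1.-tuple R -> R) :
  (lebesgueRd d.+1).-integrable setT (EFin \o f) ->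
  (leb \x lebesgueRd d)%E.-integrable setT ((EFin \o f) \o @tcons R d).
Proof.
move=> fi; have mf : measurable_fun setT f by exact: integrable_measurable fi.
apply/integrableP; split.
  by apply: measurableT_comp; [exact/measurable_EFinP|exact: measurable_tcons].
have /integrableP[_] := fi; apply: le_lt_trans.
have := @ge0_integral_pushforward _ _ _ _ _ _ (@measurable_tcons R d)
  (leb \x lebesgueRd d)%E setT (fun t => `|f t|%:E) measurableT.
rewrite preimage_setT => <-//.
by apply/measurable_EFinP; exact: measurableT_comp.
Qed.

Lemma integral_lebesgueRdS (f : d.+1.-tuple R -> R) :
  (lebesgueRd d.+1).-integrable setT (EFin \o f) ->
  (\int[lebesgueRd d.+1]_t (f t)%:E =
   \int[leb]_x \int[lebesgueRd d]_t (f (tcons (x, t)))%:E)%E.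
Proof.
move=> fi /=; have ifc := integrable_tcons fi.
rewrite -[LHS]/(\int[pushforward (leb \x lebesgueRd d) (@tcons R d)]_t (f t)%:E)%E.
rewrite (@integral_pushforward _ _ _ _ _ _ (@measurable_tcons R d))//.
- by rewrite preimage_setT -integral12_prod_meas1.
- by apply/measurable_EFinP; exact: integrable_measurable fi.
Qed.

End lebesgueRdS_integrable.

Section Rintegral_tuples.
Context {R : realType}.
Local Notation leb := (@lebesgue_measure R).

Lemma Rintegral_lebesgueRdS d (f : d.+1.-tuple R -> R) :
  (lebesgueRd d.+1).-integrable setT (EFin \o f) ->
  (forall x, (lebesgueRd d).-integrable setT (fun t => (f (tcons (x, t)))%:E)) ->
  \int[lebesgueRd d.+1]_t f t = \int[leb]_x \int[lebesgueRd d]_t f (tcons (x, t)).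
Proof.
move=> fi ft; apply: RintegralE; rewrite integral_lebesgueRdS//.
rewrite -EFin_Rintegral//.
  by apply: eq_integral => x _; exact: (EFin_Rintegral (ft x)).
have ifc : (leb \x lebesgueRd d)%E.-integrable setT ((EFin \o f) \o @tcons R d).
  exact: integrable_tcons.
apply: eq_integrable (integrable_fubini_F ifc) => // x _.
exact: (EFin_Rintegral (ft x)).
Qed.

Lemma Rintegral_affv d (f : d.-tuple R -> R) (a : R) v : a != 0 ->
  (lebesgueRd d).-integrable setT (EFin \o f) ->
  (lebesgueRd d).-integrable setT (EFin \o (f \o affv a v)) /\
  \int[lebesgueRd d]_x f (affv a v x) = `|a| ^- d * \int[lebesgueRd d]_x f x.
Proof.
move=> a0 fi; have mf := integrable_measurable fi.
have mEf : measurable_fun setT (EFin \o f) by exact/measurable_EFinP.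
have ifa : (lebesgueRd d).-integrable setT (EFin \o (f \o affv a v)).
  apply/integrableP; split.
    by apply/measurable_EFinP; apply: measurableT_comp => //; exact: measurable_affv1.
  rewrite (ge0_integral_affv (f := fun x => `|f x|%:E) v a0)//.
    rewrite lte_mul_pinfty// ?lee_fin ?invr_ge0 ?exprn_ge0//.
    exact: integrable_lty_abs.
  by apply/measurable_EFinP; exact: measurableT_comp.
split=> //; apply: RintegralE.
rewrite integralE.
transitivity ((`|a| ^- d)%:E * \int[lebesgueRd d]_x ((EFin \o f)^\+ x) -
    (`|a| ^- d)%:E * \int[lebesgueRd d]_x ((EFin \o f)^\- x))%E.
  congr (_ - _)%E.
  - transitivity (\int[lebesgueRd d]_x ((EFin \o f)^\+ (affv a v x)))%E.
      by apply: eq_integral => x _; rewrite !funeposE.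
    by apply: ge0_integral_affv => //; exact: measurable_funepos.
  - transitivity (\int[lebesgueRd d]_x ((EFin \o f)^\- (affv a v x)))%E.
      by apply: eq_integral => x _; rewrite !funenegE.
    by apply: ge0_integral_affv => //; exact: measurable_funeneg.
rewrite EFinM -EFin_Rintegral// [in RHS]integralE.
have := integrable_add_def measurableT fi.
move: (\int[_]_x _)%E (\int[_]_x _)%E => A B AB.
by rewrite muleBr.
Qed.

(** Integrability of all sections, not just of almost all, is asked for: [EFin_Rintegral] then
    identifies the real-valued inner integrals with the extended ones at every point. *)
Lemma RFubini d1 d2 (T1 : measurableType d1) (T2 : measurableType d2)
  (m1 : {sigma_finite_measure set T1 -> \bar R})
  (m2 : {sigma_finite_measure set T2 -> \bar R}) (F : T1 -> T2 -> R) :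
  measurable_fun setT (fun p : T1 * T2 => F p.1 p.2) ->
  (\int[m1]_x \int[m2]_y `|F x y|%:E < +oo)%E ->
  (forall x, m2.-integrable setT (fun y => (F x y)%:E)) ->
  (forall y, m1.-integrable setT (fun x => (F x y)%:E)) ->
  [/\ m1.-integrable setT (fun x => (\int[m2]_y F x y)%:E),
      m2.-integrable setT (fun y => (\int[m1]_x F x y)%:E) &
  \int[m1]_x \int[m2]_y F x y = \int[m2]_y \int[m1]_x F x y].
Proof.
move=> mF Foo i2 i1; pose f (p : T1 * T2) : \bar R := (F p.1 p.2)%:E.
have mf : measurable_fun setT f by exact/measurable_EFinP.
have fi : (m1 \x m2)%E.-integrable setT f by apply/(integrable12ltyP m1 m2 mf).
have j1 : m1.-integrable setT (fun x => (\int[m2]_y F x y)%:E).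
  apply: eq_integrable (integrable_fubini_F fi) => // x _.
  exact: (EFin_Rintegral (i2 x)).
have j2 : m2.-integrable setT (fun y => (\int[m1]_x F x y)%:E).
  have mf' : measurable_fun setT (fun p : T2 * T1 => (F p.2 p.1)%:E).
    exact: (measurableT_comp mf (@measurable_swap _ _ T2 T1)).
  have fi' : (m2 \x m1)%E.-integrable setT (fun p : T2 * T1 => (F p.2 p.1)%:E).
    apply/(integrable12ltyP m2 m1 mf').
    rewrite -(fubini_tonelli (fun p : T1 * T2 => `|F p.1 p.2|%:E))//.
    by apply/measurable_EFinP; exact: measurableT_comp.
  apply: eq_integrable (integrable_fubini_F fi') => // y _.
  exact: (EFin_Rintegral (i1 y)).
split=> //; apply: RintegralE; rewrite -EFin_Rintegral//.
transitivity (\int[m1]_x \int[m2]_y f (x, y))%E.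
  by apply: eq_integral => x _; rewrite -(EFin_Rintegral (i2 x)).
rewrite (Fubini fi).
by apply: eq_integral => y _; exact: (EFin_Rintegral (i1 y)).
Qed.

End Rintegral_tuples.

(** * Laplace and Cauchy product kernels on tuples *)

Section Laplace_tuple.
Context {R : realType}.
Local Notation leb := (@lebesgue_measure R).

Definition tprod (g : R -> R) d (t : d.-tuple R) : R := \prod_(k < d) g (tnth t k).

Lemma tprod_tcons g d x (t : d.-tuple R) : tprod g (tcons (x, t)) = g x * tprod g t.
Proof.
rewrite /tprod big_ord_recl; congr (_ * _).
by apply: eq_bigr => k _; rewrite tnthS.
Qed.

Lemma tprod_ge0 (g : R -> R) d (t : d.-tuple R) : (forall x, 0 <= g x) -> 0 <= tprod g t.
Proof. by move=> g0; apply: prodr_ge0. Qed.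

Lemma measurable_tprod (g : R -> R) d : measurable_fun setT g ->
  measurable_fun setT (@tprod g d).
Proof.
move=> mg; apply: measurable_prod => k _.
exact: (measurableT_comp mg (measurable_tnth k)).
Qed.

Lemma integral_tprod (g : R -> R) c d : measurable_fun setT g -> (forall x, 0 <= g x) ->
  (\int[leb]_x (g x)%:E = c%:E)%E ->
  (\int[lebesgueRd d]_t (tprod g t)%:E = (c ^+ d)%:E)%E.
Proof.
move=> mg g0 gc; have c0 : 0 <= c.
  by rewrite -lee_fin -gc; apply: integral_ge0 => x _; rewrite lee_fin.
elim: d => [|d IH].
  rewrite /= integral_dirac//; last by apply/measurable_EFinP; exact: measurable_tprod.
  by rewrite diracT mul1e /tprod big_ord0.
rewrite ge0_integral_lebesgueRdS//; last 2 first.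
- by apply/measurable_EFinP; exact: measurable_tprod.
- by move=> t; rewrite lee_fin tprod_ge0.
under eq_integral => x _.
  under eq_integral do rewrite tprod_tcons EFinM.
  rewrite ge0_integralZl//; last 3 first.
  - by apply/measurable_EFinP; exact: measurable_tprod.
  - by move=> t _; rewrite lee_fin tprod_ge0.
  - by rewrite lee_fin.
  rewrite IH muleC; over.
rewrite ge0_integralZl//; last 3 first.
- exact/measurable_EFinP.
- by move=> x _; rewrite lee_fin.
- by rewrite lee_fin exprn_ge0.
by rewrite gc -EFinM exprSr.
Qed.

Lemma integrable_tprod (g : R -> R) c d : measurable_fun setT g -> (forall x, 0 <= g x) ->
  (\int[leb]_x (g x)%:E = c%:E)%E ->
  (lebesgueRd d).-integrable setT (fun t => (tprod g t)%:E).
Proof.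
move=> mg g0 gc; apply: ge0_integrable.
- exact: measurable_tprod.
- by move=> t; exact: tprod_ge0.
- by rewrite (integral_tprod _ mg g0 gc) ltry.
Qed.

Lemma integrable_laplace_tprod d :
  (lebesgueRd d).-integrable setT (fun t => (tprod laplace t)%:E).
Proof.
apply: (@integrable_tprod _ 2); first exact: measurable_laplace.
- by move=> x; exact/ltW/laplace_gt0.
- exact: integral_laplace.
Qed.

Lemma integrable_cauchy_tprod d :
  (lebesgueRd d).-integrable setT (fun t => (tprod cauchy t)%:E).
Proof.
apply: (@integrable_tprod _ (2 * pi)); first exact: measurable_cauchy.
- by move=> x; exact/ltW/cauchy_gt0.
- exact: integral_cauchy.
Qed.

Lemma measurable_cos_dotv d' (T : measurableType d') d (f g : T -> d.-tuple R) :
  measurable_fun setT f -> measurable_fun setT g ->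
  measurable_fun setT (fun x => cos (dotv (f x) (g x))).
Proof.
move=> mf mg; apply: (measurableT_comp (f := @cos R)); last exact: dotv_measurable.
by apply: continuous_measurable_fun; exact: continuous_cos.
Qed.

Lemma measurable_sin_dotv d' (T : measurableType d') d (f g : T -> d.-tuple R) :
  measurable_fun setT f -> measurable_fun setT g ->
  measurable_fun setT (fun x => sin (dotv (f x) (g x))).
Proof.
move=> mf mg; apply: (measurableT_comp (f := @sin R)); last exact: dotv_measurable.
by apply: continuous_measurable_fun; exact: continuous_sin.
Qed.

Lemma dotv_tcons d (x : d.+1.-tuple R) s t :
  dotv x (tcons (s, t)) = tnth x ord0 * s + dotv [tuple of behead x] t.
Proof.
rewrite /dotv big_ord_recl; congr (_ + _); apply: eq_bigr => k _.
by rewrite tnthS [x in LHS]tuple_eta tnthS.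
Qed.

Lemma integrable_cos_mul d (x : d.-tuple R) (w : d.-tuple R -> R) :
  (lebesgueRd d).-integrable setT (EFin \o w) ->
  (lebesgueRd d).-integrable setT (fun t => (cos (dotv x t) * w t)%:E).
Proof.
apply: (bounded_integrable (M := 1)); last by move=> t; exact: cos_max.
exact: measurable_cos_dotv.
Qed.

Lemma integrable_sin_mul d (x : d.-tuple R) (w : d.-tuple R -> R) :
  (lebesgueRd d).-integrable setT (EFin \o w) ->
  (lebesgueRd d).-integrable setT (fun t => (sin (dotv x t) * w t)%:E).
Proof.
apply: (bounded_integrable (M := 1)); last by move=> t; exact: sin_max.
exact: measurable_sin_dotv.
Qed.

Lemma dotvC d (x y : d.-tuple R) : dotv x y = dotv y x.
Proof. by apply: eq_bigr => k _; rewrite mulrC. Qed.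

(** Induction on the dimension. The addition formulas couple cosine and sine, so both integrals are
    carried along; the vanishing sine integrals kill the mixed terms. *)
Lemma Rintegral_laplace_tprod d (x : d.-tuple R) :
  \int[lebesgueRd d]_t (cos (dotv x t) * tprod laplace t) = tprod cauchy x /\
  \int[lebesgueRd d]_t (sin (dotv x t) * tprod laplace t) = 0.
Proof.
elim: d x => [|d IH] x.
  have t0 (t : 0.-tuple R) : dotv x t = 0 by rewrite /dotv big_ord0.
  split; apply: RintegralE; rewrite /= integral_dirac//.
  - by rewrite diracT mul1e t0 cos0 /tprod !big_ord0 mulr1.
  - apply/measurable_EFinP; apply: measurable_funM; first exact: measurable_cos_dotv.
    by apply: measurable_tprod; exact: measurable_laplace.
  - by rewrite diracT mul1e t0 sin0 mul0r.
  - apply/measurable_EFinP; apply: measurable_funM; first exact: measurable_sin_dotv.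
    by apply: measurable_tprod; exact: measurable_laplace.
pose y : d.-tuple R := [tuple of behead x]; pose x0 := tnth x ord0.
have [IHc IHs] := IH y.
have iL := @integrable_laplace_tprod.
have ic := integrable_cos_mul y (iL d); have is_ := integrable_sin_mul y (iL d).
split.
- rewrite (@Rintegral_lebesgueRdS R d (fun t => cos (dotv x t) * tprod laplace t)).
  + under eq_Rintegral => s _.
      rewrite (_ : \int[_]_t _ = cos (x0 * s) * laplace s * tprod cauchy y); last first.
        under eq_Rintegral => t _.
          rewrite dotv_tcons tprod_tcons cosD -/x0 -/y.
          rewrite (_ : _ * _ = (cos (x0 * s) * laplace s) * (cos (dotv y t) * tprod laplace t) -
            (sin (x0 * s) * laplace s) * (sin (dotv y t) * tprod laplace t)); last by ring.
          over.
        rewrite RintegralB//; [|exact: integrableZR ic|exact: integrableZR is_].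
        by rewrite !RintegralZl// IHc IHs mulr0 subr0.
      over.
    rewrite RintegralZr//; last exact: integrable_cos_laplace.
    rewrite (RintegralE (integral_cos_laplace x0)).
    have xE : x = tcons (x0, y) by rewrite [LHS]tuple_eta.
    by rewrite [in RHS]xE tprod_tcons.
  + exact: integrable_cos_mul.
  + move=> s; under eq_fun do rewrite dotv_tcons tprod_tcons.
    have := integrableZR (laplace s) (iL d) => h.
    apply: (bounded_integrable (M := 1)) h; last by move=> t; exact: cos_max.
    apply: (measurableT_comp (f := @cos R)).
      by apply: continuous_measurable_fun; exact: continuous_cos.
    by apply: measurable_funD => //; exact: dotv_measurable.
- rewrite (@Rintegral_lebesgueRdS R d (fun t => sin (dotv x t) * tprod laplace t)).
  + under eq_Rintegral => s _.
      rewrite (_ : \int[_]_t _ = sin (x0 * s) * laplace s * tprod cauchy y); last first.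
        under eq_Rintegral => t _.
          rewrite dotv_tcons tprod_tcons sinD -/x0 -/y.
          rewrite (_ : _ * _ = (sin (x0 * s) * laplace s) * (cos (dotv y t) * tprod laplace t) +
            (cos (x0 * s) * laplace s) * (sin (dotv y t) * tprod laplace t)); last by ring.
          over.
        rewrite RintegralD//; [|exact: integrableZR ic|exact: integrableZR is_].
        by rewrite !RintegralZl// IHc IHs mulr0 addr0.
      over.
    rewrite RintegralZr//; last exact: integrable_sin_laplace.
    by rewrite (RintegralE (integral_sin_laplace x0)) mul0r.
  + exact: integrable_sin_mul.
  + move=> s; under eq_fun do rewrite dotv_tcons tprod_tcons.
    have := integrableZR (laplace s) (iL d) => h.
    apply: (bounded_integrable (M := 1)) h; last by move=> t; exact: sin_max.
    apply: (measurableT_comp (f := @sin R)).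
      by apply: continuous_measurable_fun; exact: continuous_sin.
    by apply: measurable_funD => //; exact: dotv_measurable.
Qed.

End Laplace_tuple.

Section vector_algebra.
Context {R : realType} {d : nat}.
Implicit Types (a b : R).

Definition zerov : d.-tuple R := [tuple 0 | k < d].

Lemma scalevE a (x : d.-tuple R) : scalev a x = affv a zerov x.
Proof. by apply/eq_from_tnth => k; rewrite tnth_affv !tnth_mktuple addr0. Qed.

Lemma affv1C (x z : d.-tuple R) : affv 1 z x = affv 1 x z.
Proof. by apply/eq_from_tnth => k; rewrite !tnth_affv !mul1r addrC. Qed.

Lemma dotv_scalel a (x t : d.-tuple R) : dotv (scalev a x) t = a * dotv x t.
Proof.
by rewrite /dotv mulr_sumr; apply: eq_bigr => k _; rewrite tnth_mktuple mulrA.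
Qed.

Lemma dotv_scaler a (x t : d.-tuple R) : dotv x (scalev a t) = a * dotv x t.
Proof. by rewrite dotvC dotv_scalel dotvC. Qed.

Lemma dotv_affv a (v x t : d.-tuple R) : dotv (affv a v x) t = a * dotv x t + dotv v t.
Proof.
rewrite /dotv mulr_sumr -big_split/=.
by apply: eq_bigr => k _; rewrite tnth_affv mulrDl mulrA.
Qed.

Lemma scalevA a b (x : d.-tuple R) : scalev a (scalev b x) = scalev (a * b) x.
Proof. by apply/eq_from_tnth => k; rewrite !tnth_mktuple mulrA. Qed.

Lemma scale1v (x : d.-tuple R) : scalev 1 x = x.
Proof. by apply/eq_from_tnth => k; rewrite !tnth_mktuple mul1r. Qed.

Lemma measurable_scalev d' (T : measurableType d') a (f : T -> d.-tuple R) :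
  measurable_fun setT f -> measurable_fun setT (fun x : T => scalev a (f x)).
Proof.
by move=> mf; under eq_fun do rewrite scalevE; exact: measurable_affv.
Qed.

Lemma Rintegral_scalev (f : d.-tuple R -> R) a : a != 0 ->
  (lebesgueRd d).-integrable setT (EFin \o f) ->
  (lebesgueRd d).-integrable setT (fun x => (f (scalev a x))%:E) /\
  \int[lebesgueRd d]_x f (scalev a x) = `|a| ^- d * \int[lebesgueRd d]_x f x.
Proof.
move=> a0 fi; have [h1 h2] := Rintegral_affv zerov a0 fi.
by under eq_fun do rewrite scalevE; under [\int[_]_x f _]eq_Rintegral do rewrite scalevE.
Qed.

Lemma normrXV_mulV (e : R) n : e != 0 -> `|e| ^- n * `|e^-1| ^- n = 1.
Proof.
move=> e0; have en : `|e| ^+ n != 0 by rewrite expf_neq0// normr_eq0.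
by rewrite normfV exprVn invrK mulVf.
Qed.

End vector_algebra.

(** * Autocorrelation and Plancherel's formula *)

Section Plancherel.
Context {R : realType} {d : nat}.
Local Notation mu := (lebesgueRd d).
Local Notation V := (d.-tuple R).
Local Notation integrable f := (mu.-integrable setT (EFin \o f)).

(** [fcos] and [fsin] are the real and imaginary parts of [fourierL1], and [fenergy] is its squared
    modulus; in this form only real integrals occur. *)
Definition fcos (w : V -> R) (t : V) : R := \int[mu]_x (cos (dotv x t) * w x).
Definition fsin (w : V -> R) (t : V) : R := \int[mu]_x (sin (dotv x t) * w x).
Definition fenergy w t : R := fcos w t ^+ 2 + fsin w t ^+ 2.

Lemma integrable_cos_mulr (w : V -> R) t : integrable w ->
  mu.-integrable setT (fun x => (cos (dotv x t) * w x)%:E).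
Proof.
move=> wi; apply: eq_integrable (integrable_cos_mul t wi) => // x _.
by rewrite dotvC.
Qed.

Lemma integrable_sin_mulr (w : V -> R) t : integrable w ->
  mu.-integrable setT (fun x => (sin (dotv x t) * w x)%:E).
Proof.
move=> wi; apply: eq_integrable (integrable_sin_mul t wi) => // x _.
by rewrite dotvC.
Qed.

Variable w : V -> R.
Hypothesis wi : integrable w.
Hypothesis w2 : (sqnorm mu w < +oo)%E.

Let mw : measurable_fun setT w. Proof. exact: integrable_measurable wi. Qed.

Let w2i : mu.-integrable setT (fun x => (w x ^+ 2)%:E).
Proof. by apply: ge0_integrable => //; [exact: measurable_funX|move=> x; exact: sqr_ge0]. Qed.

(** Autocorrelation of w: its cosine transform is [fenergy w] and its value at 0 is ||w||^2, so
    Plancherel's formula becomes Fourier inversion at the origin. *)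
Let acorr (z : V) : R := \int[mu]_x (w x * w (affv 1 z x)).

Let wt z : integrable (w \o affv 1 z).
Proof. by have [] := Rintegral_affv z (oner_neq0 R) wi. Qed.

Let w2t z : mu.-integrable setT (fun x => (w (affv 1 z x) ^+ 2)%:E) /\
  \int[mu]_x (w (affv 1 z x) ^+ 2) = \int[mu]_x (w x ^+ 2).
Proof.
have [h ->] := Rintegral_affv z (oner_neq0 R) w2i.
by rewrite normr1 expr1n invr1 mul1r.
Qed.

Let wwi z : mu.-integrable setT (fun x => (w x * w (affv 1 z x))%:E).
Proof.
have [h _] := w2t z.
apply: (dominated_integrableR (f := fun x => w x * w (affv 1 z x)) _ (integrableDR w2i h)).
  by apply: measurable_funM => //; exact: integrable_measurable (wt z).
move=> x; rewrite ler_norml; apply/andP; split; nra.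
Qed.

Let W : R := \int[mu]_x (w x ^+ 2).

Let acorr_le z : `|acorr z| <= W.
Proof.
have [h hE] := w2t z.
have j1 := integrableZR 2^-1 w2i; have j2 := integrableZR 2^-1 h.
rewrite ler_norml; apply/andP; split.
- rewrite -subr_ge0 opprK.
  have -> : acorr z + W = \int[mu]_x (2^-1 * ((w x + w (affv 1 z x)) ^+ 2)).
    transitivity (\int[mu]_x (2^-1 * w x ^+ 2 + 2^-1 * w (affv 1 z x) ^+ 2 + w x * w (affv 1 z x))).
      rewrite RintegralD; [|exact: measurableT|exact: integrableDR j1 j2|exact: wwi].
      rewrite RintegralD; [|exact: measurableT|exact: j1|exact: j2].
      rewrite !RintegralZl// hE -/W -/(acorr z); lra.
    by apply: eq_Rintegral => x _; field.
  by apply: Rintegral_ge0 => x _; rewrite mulr_ge0// sqr_ge0.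
- rewrite -subr_ge0.
  have -> : W - acorr z = \int[mu]_x (2^-1 * ((w x - w (affv 1 z x)) ^+ 2)).
    transitivity (\int[mu]_x (2^-1 * w x ^+ 2 + 2^-1 * w (affv 1 z x) ^+ 2 - w x * w (affv 1 z x))).
      rewrite RintegralB; [|exact: measurableT|exact: integrableDR j1 j2|exact: wwi].
      rewrite RintegralD; [|exact: measurableT|exact: j1|exact: j2].
      rewrite !RintegralZl// hE -/W -/(acorr z); lra.
    by apply: eq_Rintegral => x _; field.
  by apply: Rintegral_ge0 => x _; rewrite mulr_ge0// sqr_ge0.
Qed.

(** This identity turns the L2 continuity of translations into continuity of the autocorrelation at
    0. *)
Let acorr_sqnorm z :
  sqnorm mu (fun x => w (affv 1 z x) - w x) = (2 * (W - acorr z))%:E.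
Proof.
have [h hE] := w2t z.
have i1 := integrableDR w2i h.
have i2 := integrableZR 2 (wwi z).
have -> : 2 * (W - acorr z) = \int[mu]_x ((w (affv 1 z x) - w x) ^+ 2).
  transitivity (\int[mu]_x ((w x ^+ 2 + w (affv 1 z x) ^+ 2) - 2 * (w x * w (affv 1 z x)))).
    rewrite RintegralB; [|exact: measurableT|exact: i1|exact: i2].
    rewrite RintegralD; [|exact: measurableT|exact: w2i|exact: h].
    rewrite RintegralZl; [|exact: measurableT|exact: wwi].
    rewrite hE -/W -/(acorr z); lra.
  by apply: eq_Rintegral => x _; ring.
rewrite -EFin_Rintegral//.
apply: eq_integrable (integrableBR i1 i2) => // x _.
by rewrite /=; congr EFin; ring.
Qed.

Let acorr_cvg (z : V) : acorr (scalev n.+1%:R^-1 z) @[n --> \oo] --> W.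
Proof.
apply/cvgrPdist_le => e e0.
have z0 k : tnth (scalev n.+1%:R^-1 z) k @[n --> \oo] --> (0 : R).
  under eq_fun do rewrite tnth_mktuple.
  have := cvgM (@cvg_harmonic R) (@cvg_cst _ (tnth z k) nat \oo _).
  by rewrite mul0r; apply.
have e2 : 0 < 2 * e by rewrite mulr_gt0.
have := sqnorm_translation_cvg z0 mw w2 e2.
apply: filterS => n; rewrite acorr_sqnorm lee_fin ler_pM2l//.
by rewrite ger0_norm// subr_ge0 (le_trans _ (acorr_le (scalev n.+1%:R^-1 z)))// ler_norm.
Qed.

Let mww : measurable_fun setT (fun p : V * V => w p.1 * w (affv 1 p.2 p.1)).
Proof.
apply: measurable_funM; first exact: (measurableT_comp mw measurable_fst).
apply: (measurableT_comp mw); apply: measurable_affv.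
- exact: measurable_snd.
- exact: measurable_fst.
Qed.

(** The two squares become a double integral over (x, y); the formula for cos(a - b) and the
    substitution y = x + z leave the autocorrelation. Absolute convergence reduces to a product of
    two L1 norms in [bound], which also yields the integrability of [acorr]. *)
Let fenergyE t : mu.-integrable setT (fun z => (acorr z)%:E) /\
  fenergy w t = \int[mu]_z (cos (dotv z t) * acorr z).
Proof.
have bound (F : V -> V -> R) : measurable_fun setT (fun p : V * V => F p.1 p.2) ->
   (forall x z, `|F x z| <= `|w x * w (affv 1 z x)|) ->
   (\int[mu]_x \int[mu]_z `|F x z|%:E < +oo)%E.
  move=> mF Fw.
  apply: (@le_lt_trans _ _ (\int[mu]_x \int[mu]_z (`|w x * w (affv 1 z x)|%:E))%E).
    have m1 : measurable_fun setT (fun p : V * V => `|F p.1 p.2|%:E).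
      by apply/measurable_EFinP; exact: measurableT_comp.
    have m2 : measurable_fun setT (fun p : V * V => `|w p.1 * w (affv 1 p.2 p.1)|%:E).
      by apply/measurable_EFinP; exact: measurableT_comp.
    rewrite -(fubini_tonelli1 (fun p : V * V => `|F p.1 p.2|%:E))//.
    rewrite -(fubini_tonelli1 (fun p : V * V => `|w p.1 * w (affv 1 p.2 p.1)|%:E))//.
    by apply: ge0_le_integral => // p _; rewrite lee_fin; exact: Fw.
  under eq_integral => x _.
    under eq_integral do rewrite normrM EFinM affv1C.
    rewrite ge0_integralZl//; last first.
      by apply/measurable_EFinP; apply: measurableT_comp => //; exact: integrable_measurable (wt x).
    rewrite (ge0_integral_affv (f := fun z => `|w z|%:E) x (oner_neq0 R))//; last first.
      by apply/measurable_EFinP; exact: measurableT_comp.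
    rewrite normr1 expr1n invr1 mul1e muleC; over.
  rewrite ge0_integralZl//; last 2 first.
  - by apply/measurable_EFinP; exact: measurableT_comp.
  - exact: integral_ge0.
  have wf : (\int[mu]_z `|w z|%:E)%E \is a fin_num.
    by rewrite ge0_fin_numE ?integral_ge0//; exact: integrable_lty_abs.
  by rewrite lte_mul_pinfty ?integral_ge0//; exact: integrable_lty_abs.
have iz x : mu.-integrable setT (fun z => (w x * w (affv 1 z x))%:E).
  apply: eq_integrable (integrableZR (w x) (wt x)) => // z _.
  by rewrite /= affv1C.
have [_ ia _] := @RFubini _ _ _ _ _ mu mu (fun x z => w x * w (affv 1 z x)) mww
  (bound _ mww (fun x z => lexx _)) iz wwi.
split=> //.
pose F x z := cos (dotv z t) * (w x * w (affv 1 z x)).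
have mcos : measurable_fun setT (fun z : V => cos (dotv z t)) by exact: measurable_cos_dotv.
have mF : measurable_fun setT (fun p : V * V => F p.1 p.2).
  by apply: measurable_funM => //; exact: (measurableT_comp mcos measurable_snd).
have Fw x z : `|F x z| <= `|w x * w (affv 1 z x)|.
  by rewrite /F normrM ler_piMl// cos_max.
have iFz x : mu.-integrable setT (fun z => (F x z)%:E).
  apply: (bounded_integrable (M := 1)) (iz x) => //.
  by move=> z; exact: cos_max.
have iFx z : mu.-integrable setT (fun x => (F x z)%:E) by exact: integrableZR (wwi z).
have [_ _ E] := RFubini mF (bound _ mF Fw) iFz iFx.
transitivity (\int[mu]_x \int[mu]_z F x z); last first.
  rewrite E; apply: eq_Rintegral => z _.
  by rewrite RintegralZl; [|exact: measurableT|exact: wwi].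
have ic := integrable_cos_mulr t wi; have is_ := integrable_sin_mulr t wi.
transitivity (\int[mu]_x (w x * (cos (dotv x t) * fcos w t + sin (dotv x t) * fsin w t))).
  transitivity (\int[mu]_x (fcos w t * (cos (dotv x t) * w x) + fsin w t * (sin (dotv x t) * w x))).
    rewrite RintegralD; [|exact: measurableT|exact: integrableZR ic|exact: integrableZR is_].
    rewrite RintegralZl; [|exact: measurableT|exact: ic].
    by rewrite RintegralZl; [|exact: measurableT|exact: is_].
  by apply: eq_Rintegral => x _; ring.
apply: eq_Rintegral => x _; rewrite /F.
transitivity (w x * \int[mu]_z (cos (dotv z t) * w (affv 1 x z))); last first.
  rewrite -RintegralZl; [|exact: measurableT|exact: (integrable_cos_mulr t (wt x))].
  by apply: eq_Rintegral => z _; rewrite affv1C; ring.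
congr (_ * _).
pose G y := cos (dotv y t) * cos (dotv x t) * w y + sin (dotv y t) * sin (dotv x t) * w y.
have EG z : cos (dotv z t) * w (affv 1 x z) = G (affv 1 x z).
  rewrite /G dotv_affv mul1r -mulrDl -cosB addrK//.
under [RHS]eq_Rintegral do rewrite EG.
have iG1 := integrableZR (cos (dotv x t)) ic; have iG2 := integrableZR (sin (dotv x t)) is_.
have iG : integrable G.
  apply: eq_integrable (integrableDR iG1 iG2) => // y _.
  by rewrite /G /=; congr EFin; ring.
have [_ ->] := Rintegral_affv x (oner_neq0 R) iG.
rewrite normr1 expr1n invr1 mul1r /fcos /fsin.
rewrite -RintegralZl; [|exact: measurableT|exact: ic].
rewrite -RintegralZl; [|exact: measurableT|exact: is_].
rewrite -RintegralD; [|exact: measurableT|exact: iG1|exact: iG2].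
by apply: eq_Rintegral => y _; rewrite /G; ring.
Qed.

Let ia : mu.-integrable setT (fun z => (acorr z)%:E).
Proof. by have [] := fenergyE zerov. Qed.

Let ma : measurable_fun setT acorr. Proof. exact: integrable_measurable ia. Qed.

Lemma fenergy_ge0 t : 0 <= fenergy w t.
Proof. by rewrite addr_ge0 ?sqr_ge0. Qed.

(** The transform of an integrable function is bounded but need not be integrable in t; the Laplace
    weight restores absolute convergence on the product space. *)
Let laplace_fubini (g : V -> V -> R) (v : V -> R) (e : R) : e != 0 ->
  integrable v -> measurable_fun setT (fun p : V * V => g p.1 p.2) ->
  (forall t x, `|g t x| <= 1) ->
  let F t x := tprod laplace (scalev e t) * (g t x * v x) in
  [/\ mu.-integrable setT (fun t => (\int[mu]_x F t x)%:E),
      mu.-integrable setT (fun x => (\int[mu]_t F t x)%:E) &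
  \int[mu]_t \int[mu]_x F t x = \int[mu]_x \int[mu]_t F t x].
Proof.
move=> e0 vi mg g1 F.
have L0 (t : V) : 0 <= tprod laplace (scalev e t).
  by apply: tprod_ge0 => x; exact/ltW/laplace_gt0.
have [iL _] := Rintegral_scalev e0 (integrable_laplace_tprod d).
have mL := integrable_measurable iL.
have mv := integrable_measurable vi.
have mF : measurable_fun setT (fun p : V * V => F p.1 p.2).
  apply: measurable_funM; first exact: (measurableT_comp mL measurable_fst).
  by apply: measurable_funM => //; exact: (measurableT_comp mv measurable_snd).
have gv1 t : mu.-integrable setT (fun x => (g t x * v x)%:E).
  apply: (bounded_integrable (M := 1)) vi; last exact: g1.
  exact: (measurableT_comp mg (measurable_pair1 t)).
apply: RFubini => //.
- apply: (@le_lt_trans _ _ (\int[mu]_t \int[mu]_x (tprod laplace (scalev e t) * `|v x|)%:E)%E).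
    have m1 : measurable_fun setT (fun p : V * V => `|F p.1 p.2|%:E).
      by apply/measurable_EFinP; exact: measurableT_comp.
    have m2 : measurable_fun setT (fun p : V * V => (tprod laplace (scalev e p.1) * `|v p.2|)%:E).
      apply/measurable_EFinP; apply: measurable_funM.
        exact: (measurableT_comp mL measurable_fst).
      by apply: measurableT_comp => //; exact: (measurableT_comp mv measurable_snd).
    have p0 (p : V * V) : (0 <= (tprod laplace (scalev e p.1) * `|v p.2|)%:E)%E.
      by rewrite lee_fin mulr_ge0.
    rewrite -(fubini_tonelli1 (fun p : V * V => `|F p.1 p.2|%:E))//.
    rewrite -(fubini_tonelli1 (fun p : V * V => (tprod laplace (scalev e p.1) * `|v p.2|)%:E))//.
    apply: ge0_le_integral => // p _.
    rewrite lee_fin /F !normrM (ger0_norm (L0 _)) ler_wpM2l//.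
    by rewrite ler_piMl.
  under eq_integral => t _.
    under eq_integral do rewrite EFinM.
    rewrite ge0_integralZl//; last 2 first.
    - by apply/measurable_EFinP; exact: measurableT_comp.
    - by rewrite lee_fin.
    rewrite muleC; over.
  rewrite ge0_integralZl//; last 3 first.
  - by apply/measurable_EFinP.
  - by move=> t _; rewrite lee_fin.
  - exact: integral_ge0.
  have vf : (\int[mu]_z `|v z|%:E)%E \is a fin_num.
    by rewrite ge0_fin_numE ?integral_ge0//; exact: integrable_lty_abs.
  by rewrite lte_mul_pinfty ?integral_ge0// (EFin_Rintegral iL) ltry.
- by move=> t; exact: integrableZR (gv1 t).
- move=> x; have h : mu.-integrable setT (fun t => (g t x * tprod laplace (scalev e t))%:E).
    apply: (bounded_integrable (M := 1)) iL; last by move=> t; exact: g1.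
    exact: (measurableT_comp mg (measurable_pair2 x)).
  apply: eq_integrable (integrableZR (v x) h) => // t _.
  by rewrite /F /=; congr EFin; ring.
Qed.

(** Fubini makes the weighted transform integrable, hence measurable; the weight at scale 1 never
    vanishes and is divided out, its reciprocal being the product of the exp |t_k|. *)
Let measurable_transform (g : V -> V -> R) :
  measurable_fun setT (fun p : V * V => g p.1 p.2) ->
  (forall t x, `|g t x| <= 1) ->
  measurable_fun setT (fun t => \int[mu]_x (g t x * w x)).
Proof.
move=> mg g1; have [h _ _] := laplace_fubini (oner_neq0 R) wi mg g1.
have mh := integrable_measurable h.
have L0 (t : V) : tprod laplace t != 0.
  by apply/prodf_neq0 => k _; rewrite gt_eqF ?laplace_gt0.
rewrite (_ : (fun t => _) = (fun t : V => \prod_(k < d) expR `|tnth t k| *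
    \int[mu]_x (tprod laplace (scalev 1 t) * (g t x * w x)))).
  apply: measurable_funM => //; apply: measurable_prod => k _.
  apply: measurableT_comp => //; apply: measurableT_comp => //.
  exact: measurable_tnth.
apply/funext => t; rewrite scale1v RintegralZl; [|exact: measurableT|]; last first.
  apply: (bounded_integrable (M := 1)) wi; last exact: g1.
  exact: (measurableT_comp mg (measurable_pair1 t)).
rewrite mulrA -big_split/= big1 ?mul1r// => k _.
by rewrite /laplace -expRD addrN expR0.
Qed.

Lemma measurable_fcos : measurable_fun setT (fcos w).
Proof.
apply: (measurable_transform (g := fun t x => cos (dotv x t))).
- by apply: measurable_cos_dotv; [exact: measurable_snd|exact: measurable_fst].
- by move=> t x; exact: cos_max.
Qed.

Lemma measurable_fsin : measurable_fun setT (fsin w).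
Proof.
apply: (measurable_transform (g := fun t x => sin (dotv x t))).
- by apply: measurable_sin_dotv; [exact: measurable_snd|exact: measurable_fst].
- by move=> t x; exact: sin_max.
Qed.

Let menergy : measurable_fun setT (fenergy w).
Proof.
apply: measurable_funD; apply: measurable_funX;
  [exact: measurable_fcos|exact: measurable_fsin].
Qed.

(* The Fourier transform of the Laplace kernel is the Cauchy density; letting
   e tend to 0 on both sides gives Plancherel's formula. *)
Let weighted_energy (e : R) : 0 < e ->
  (\int[mu]_t (fenergy w t * tprod laplace (scalev e t))%:E =
   (\int[mu]_z (tprod cauchy z * acorr (scalev e z)))%:E)%E.
Proof.
move=> e0; have e0' : e != 0 by rewrite gt_eqF.
have ei0 : e^-1 != 0 by rewrite invr_eq0.
have mcos : measurable_fun setT (fun p : V * V => cos (dotv p.2 p.1)).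
  by apply: measurable_cos_dotv; [exact: measurable_snd|exact: measurable_fst].
have cos1 (t x : V) : `|cos (dotv x t)| <= 1 :> R by exact: cos_max.
have [h1 h2 E] := laplace_fubini (g := fun t x => cos (dotv x t)) e0' ia mcos cos1.
have E1 t : \int[mu]_x (tprod laplace (scalev e t) * (cos (dotv x t) * acorr x)) =
    fenergy w t * tprod laplace (scalev e t).
  have [_ ->] := fenergyE t.
  rewrite RintegralZl; [|exact: measurableT|exact: integrable_cos_mulr].
  by rewrite mulrC.
rewrite (_ : \int[mu]_t _ = \int[mu]_t (\int[mu]_x (tprod laplace (scalev e t) * (cos (dotv x t) * acorr x)))%:E)%E; last first.
  by apply: eq_integral => t _; rewrite E1.
rewrite (EFin_Rintegral h1) E; congr EFin.
transitivity (\int[mu]_x (`|e| ^- d * (tprod cauchy (scalev e^-1 x) * acorr x))).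
  apply: eq_Rintegral => x _.
  have iL := integrable_cos_mul (scalev e^-1 x) (integrable_laplace_tprod d).
  have [j1 j2] := Rintegral_scalev e0' iL.
  rewrite (_ : \int[mu]_t _ = acorr x * \int[mu]_t (cos (dotv (scalev e^-1 x) (scalev e t)) * tprod laplace (scalev e t))).
    rewrite j2; have [-> _] := Rintegral_laplace_tprod (scalev e^-1 x).
    by rewrite mulrC mulrA.
  rewrite -RintegralZl; [|exact: measurableT|exact: j1].
  apply: eq_Rintegral => t _.
  by rewrite dotv_scalel dotv_scaler (mulKf e0'); ring.
have iC : mu.-integrable setT (fun z => (acorr (scalev e z) * tprod cauchy z)%:E).
  apply: (bounded_integrable (M := W)) (integrable_cauchy_tprod d); last by [].
  apply: (measurableT_comp ma); exact: measurable_scalev.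
have [j1 j2] := Rintegral_scalev ei0 iC.
have k1 : mu.-integrable setT (fun x => (tprod cauchy (scalev e^-1 x) * acorr x)%:E).
  apply: (@eq_integrable _ _ _ mu setT measurableT (fun z : V => (acorr (scalev e (scalev e^-1 z)) *
    tprod cauchy (scalev e^-1 z))%:E) _ _ j1) => z _.
  by congr EFin; rewrite scalevA (mulfV e0') scale1v; exact: mulrC.
(* The substitution z = x / e removes the factor |e|^-d. *)
transitivity (`|e| ^- d * \int[mu]_x (tprod cauchy (scalev e^-1 x) * acorr x)).
  exact: (RintegralZl _ measurableT k1).
transitivity (`|e| ^- d * \int[mu]_x (acorr (scalev e (scalev e^-1 x)) * tprod cauchy (scalev e^-1 x))).
  congr (_ * _); apply: eq_Rintegral => x _.
  by rewrite scalevA (mulfV e0') scale1v; exact: mulrC.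
rewrite j2 mulrA (normrXV_mulV d e0') mul1r.
by apply: eq_Rintegral => x _; exact: mulrC.
Qed.

(** On the left the weights increase to 1 and monotone convergence needs no prior finiteness; on the
    right [acorr] is bounded by W and tends to W, against the fixed integrable kernel
    [tprod cauchy]. The constant is the mass of that kernel, 2 pi per coordinate. *)
Lemma plancherel :
  (\int[mu]_t (fenergy w t)%:E = ((2 * pi) ^+ d)%:E * sqnorm mu w)%E.
Proof.
pose u n t : \bar R := (fenergy w t * tprod laplace (scalev n.+1%:R^-1 t))%:E.
have n0 n : 0 < n.+1%:R^-1 :> R by rewrite invr_gt0 ltr0n.
have lim1 : (\int[mu]_t u n t @[n --> \oo] --> \int[mu]_t (fenergy w t)%:E)%E.
  have L1 (t : V) : tprod laplace (scalev n.+1%:R^-1 t) @[n --> \oo] --> (1 : R).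
    have k1 k : laplace (tnth (scalev n.+1%:R^-1 t) k) @[n --> \oo] --> (1 : R).
      have h : tnth (scalev n.+1%:R^-1 t) k @[n --> \oo] --> (0 : R).
        under eq_fun do rewrite tnth_mktuple.
        have := cvgM (@cvg_harmonic R) (@cvg_cst _ (tnth t k) nat \oo _).
        by rewrite mul0r; apply.
      have := continuous_cvg _ (@continuous_laplace R 0) h.
      have l0 : laplace 0 = 1 :> R by rewrite /laplace normr0 oppr0 expR0.
      by rewrite l0; apply.
    have := @cvg_big R 'I_d *%R 1 xpredT (@mul_continuous R) nat \oo (index_enum 'I_d)
      (fun k n => laplace (tnth (scalev n.+1%:R^-1 t) k)) (fun=> 1) _ (fun k _ => k1 k).
    have -> : \prod_(k < d | xpredT k) (1 : R) = 1 by exact: big1.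
    by apply.
  have -> : (\int[mu]_t (fenergy w t)%:E = \int[mu]_t limn (u ^~ t))%E.
    apply: eq_integral => t _; apply/esym/cvg_lim => //.
    apply: cvg_EFin; first exact: nearW.
    have := cvgM (@cvg_cst _ (fenergy w t) nat \oo _) (L1 t).
    by rewrite mulr1; apply.
  apply: cvg_monotone_convergence => //.
  - move=> n; apply/measurable_EFinP; apply: measurable_funM => //.
    apply: (measurableT_comp (measurable_tprod measurable_laplace)).
    exact: measurable_scalev.
  - move=> n t _; rewrite lee_fin mulr_ge0 ?fenergy_ge0// tprod_ge0// => x.
    exact/ltW/laplace_gt0.
  - move=> t _ m n mn; rewrite lee_fin ler_wpM2l ?fenergy_ge0//.
    apply: ler_prod => k _; rewrite !tnth_mktuple (ltW (laplace_gt0 _))/=.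
    rewrite /laplace ler_expR lerN2 !normrM ler_wpM2r//.
    rewrite !ger0_norm ?invr_ge0//.
    by rewrite lef_pV2 ?posrE ?ltr0n// ler_nat.
have lim2 : (\int[mu]_t u n t @[n --> \oo] --> \int[mu]_z (tprod cauchy z * W)%:E)%E.
  rewrite (_ : (fun n => _) = fun n => (\int[mu]_z (tprod cauchy z * acorr (scalev n.+1%:R^-1 z))%:E)%E); last first.
    apply/funext => n; rewrite /u weighted_energy//.
    suff h : mu.-integrable setT (fun z => (tprod cauchy z * acorr (scalev n.+1%:R^-1 z))%:E).
      exact: (esym (EFin_Rintegral h)).
    have : mu.-integrable setT (fun z => (acorr (scalev n.+1%:R^-1 z) * tprod cauchy z)%:E).
      apply: (bounded_integrable (M := W)) (integrable_cauchy_tprod d); last by [].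
      apply: (measurableT_comp ma); exact: measurable_scalev.
    by apply: eq_integrable => // z _; rewrite mulrC.
  apply: (@dominated_cvg _ _ _ mu setT measurableT _ _ (fun z => (W * tprod cauchy z)%:E)) => //.
  - move=> n; apply/measurable_EFinP; apply: measurable_funM.
      exact: measurable_tprod measurable_cauchy.
    by apply: (measurableT_comp ma); exact: measurable_scalev.
  - move=> z _; apply: cvg_EFin; first exact: nearW.
    have := cvgM (@cvg_cst _ (tprod cauchy z) nat \oo _) (acorr_cvg z).
    by apply.
  - exact: integrableZR (integrable_cauchy_tprod d).
  - move=> n z _; have C0 : 0 <= tprod cauchy z.
      by apply: tprod_ge0 => x; exact/ltW/cauchy_gt0.
    by rewrite lee_fin normrM (ger0_norm C0) mulrC ler_wpM2r.
have -> : (\int[mu]_t (fenergy w t)%:E = \int[mu]_z (tprod cauchy z * W)%:E)%E.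
  by rewrite -(cvg_lim _ lim1)// -(cvg_lim _ lim2).
have C0 x : 0 <= cauchy x :> R by exact/ltW/cauchy_gt0.
have W0 : 0 <= W by apply: Rintegral_ge0 => x _; exact: sqr_ge0.
under eq_integral do rewrite mulrC EFinM.
rewrite ge0_integralZl//; last 2 first.
- by apply/measurable_EFinP; exact: measurable_tprod measurable_cauchy.
- by move=> z _; rewrite lee_fin tprod_ge0.
rewrite (integral_tprod d measurable_cauchy C0 integral_cauchy) muleC; congr (_ * _)%E.
by rewrite /sqnorm (EFin_Rintegral w2i).
Qed.

End Plancherel.

(** * Bias of kernel smoothing *)

Section sqnorm_delta.
Context d (T : measurableType d) (R : realType) (mu : {measure set T -> \bar R}).
Local Open Scope ereal_scope.

Lemma ge0_integralD_le (f g h : T -> R) (a b : R) :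
  measurable_fun setT f -> measurable_fun setT g -> measurable_fun setT h ->
  (0 <= a)%R -> (0 <= b)%R ->
  (forall x, 0 <= f x)%R -> (forall x, 0 <= g x)%R -> (forall x, 0 <= h x)%R ->
  (forall x, h x <= a * f x + b * g x)%R ->
  \int[mu]_x (h x)%:E <= a%:E * \int[mu]_x (f x)%:E + b%:E * \int[mu]_x (g x)%:E.
Proof.
move=> mf mg mh a0 b0 f0 g0 h0 hfg.
rewrite -!ge0_integralZl//=; try (exact/measurable_EFinP);
  try (by move=> x _; rewrite lee_fin).
rewrite -ge0_integralD//=; try (by move=> x _; rewrite mule_ge0 ?lee_fin);
  try (by apply: measurable_funeM; exact/measurable_EFinP).
apply: ge0_le_integral => //=.
- by move=> x _; rewrite lee_fin.
- exact/measurable_EFinP.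
- by apply: emeasurable_funD; apply: measurable_funeM; exact/measurable_EFinP.
- by move=> x _; rewrite -!EFinM -EFinD lee_fin.
Qed.

(** The defect is e^-1 (e x - y)^2. A leading constant arbitrarily close to 1 is what [sqnormD_le],
    with its factor 2, cannot give. *)
Lemma sqrD_delta (R' : realFieldType) (e x y : R') : (0 < e)%R ->
  ((x + y) ^+ 2 <= (1 + e) * x ^+ 2 + (1 + e^-1) * y ^+ 2)%R.
Proof.
move=> e0; rewrite -subr_ge0.
have -> : ((1 + e) * x ^+ 2 + (1 + e^-1) * y ^+ 2 - (x + y) ^+ 2 =
          e^-1 * (e * x - y) ^+ 2)%R by field; rewrite gt_eqF.
by rewrite mulr_ge0 ?sqr_ge0// invr_ge0 ltW.
Qed.

Lemma sqnormD_delta (f g : T -> R) (e : R) : (0 < e)%R ->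
  measurable_fun setT f -> measurable_fun setT g ->
  sqnorm mu (fun x => f x + g x)%R <=
  (1 + e)%:E * sqnorm mu f + (1 + e^-1)%:E * sqnorm mu g.
Proof.
move=> e0 mf mg; apply: ge0_integralD_le; try (exact: measurable_funX).
- exact/measurable_funX/measurable_funD.
- by rewrite addr_ge0// ltW.
- by rewrite addr_ge0// invr_ge0 ltW.
- by move=> x; exact: sqr_ge0.
- by move=> x; exact: sqr_ge0.
- by move=> x; exact: sqr_ge0.
- by move=> x; exact: sqrD_delta.
Qed.

End sqnorm_delta.

Section probability_moments.
Context dT (T : measurableType dT) (R : realType) (P : probability T R).

Lemma integrable_cstP (a : R) : P.-integrable setT (fun=> a%:E).
Proof. exact: finite_measure_integrable_cst. Qed.

Lemma Rintegral_cstP (a : R) : \int[P]_w a = a.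
Proof.
apply: RintegralE; rewrite integral_cst//. rewrite -[RHS]mule1; congr (_ * _)%E; exact: probability_setT.
Qed.

Variable f : T -> R.
Hypothesis mf : measurable_fun setT f.
Hypothesis f2 : (\int[P]_w (f w ^+ 2)%:E < +oo)%E.

Lemma integrable_sqr : P.-integrable setT (fun w => (f w ^+ 2)%:E).
Proof.
by apply: ge0_integrable => //; [exact: measurable_funX|move=> w; exact: sqr_ge0].
Qed.

Lemma integrable_of_sqr : P.-integrable setT (EFin \o f).
Proof.
apply: (dominated_integrableR mf (integrableDR (integrable_cstP 1) integrable_sqr)) => w.
by rewrite ler_norml; apply/andP; split; nra.
Qed.

Lemma Rintegral_sqr_sub (a : R) :
  \int[P]_w ((f w - a) ^+ 2) = \int[P]_w (f w ^+ 2) - 2 * a * \int[P]_w f w + a ^+ 2.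
Proof.
have i1 := integrable_sqr; have i2 := integrableZR (2 * a) integrable_of_sqr.
have i3 := integrable_cstP (a ^+ 2).
transitivity (\int[P]_w (f w ^+ 2 - 2 * a * f w + a ^+ 2)).
  by apply: eq_Rintegral => w _; ring.
rewrite RintegralD; [|exact: measurableT|exact: integrableBR i1 i2|exact: i3].
rewrite RintegralB; [|exact: measurableT|exact: i1|exact: i2].
by rewrite RintegralZl; [rewrite Rintegral_cstP|exact: measurableT|exact: integrable_of_sqr].
Qed.

Lemma sqr_Rintegral_le : (\int[P]_w f w) ^+ 2 <= \int[P]_w (f w ^+ 2).
Proof.
have : 0 <= \int[P]_w ((f w - \int[P]_w f w) ^+ 2).
  by apply: Rintegral_ge0 => w _; exact: sqr_ge0.
by rewrite Rintegral_sqr_sub; nra.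
Qed.

End probability_moments.

(** * Random vectors with bounded density *)

Section law_density.
Context {R : realType} {d : nat} dT (T : measurableType dT) (P : probability T R).
Local Notation mu := (lebesgueRd d).
Local Notation V := (d.-tuple R).
Variables (Y : T -> V) (p : V -> R) (L : R).
Hypothesis mY : measurable_fun setT Y.
Hypothesis mp : measurable_fun setT p.
Hypothesis p0 : forall x, 0 <= p x.
Hypothesis law : forall A, measurable A ->
  P (Y @^-1` A) = (\int[mu]_(x in A) (p x)%:E)%E.
Local Open Scope ereal_scope.

Let law_nnsfun (h : {nnsfun V >-> R}) :
  \int[P]_w (h (Y w))%:E = \int[mu]_x (h x * p x)%:E.
Proof.
pose s := fset_set (range h).
have s0 (i : 'I_(size s)) : (0 <= s`_i)%R.
  have : s`_i \in s by rewrite mem_nth.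
  rewrite in_fset_set// inE => -[x _ <-]; exact: fun_ge0.
have mA (i : 'I_(size s)) : measurable (h @^-1` [set s`_i]) by exact: measurable_sfunP.
transitivity (\int[P]_w \sum_(i < size s) ((s`_i)%:E * (\1_(h @^-1` [set s`_i]) (Y w))%:E)).
  apply: eq_integral => w _; rewrite fimfunEord -sumEFin.
  by apply: eq_bigr => i _; rewrite EFinM.
transitivity (\int[mu]_x \sum_(i < size s) ((s`_i)%:E * (\1_(h @^-1` [set s`_i]) x * p x)%:E)); last first.
  apply: eq_integral => x _; rewrite fimfunEord mulr_suml -sumEFin.
  by apply: eq_bigr => i _; rewrite -EFinM mulrA.
have m1 (i : 'I_(size s)) : measurable_fun setT (fun w => (\1_(h @^-1` [set s`_i]) (Y w) : R)).
  by apply: (measurableT_comp _ mY); exact: measurable_indic.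
have m2 (i : 'I_(size s)) : measurable_fun setT (fun x => (\1_(h @^-1` [set s`_i]) x * p x)%R).
  by apply: measurable_funM => //; exact: measurable_indic.
rewrite !ge0_integral_sum//; first last.
- by move=> i x _; rewrite mule_ge0 ?lee_fin ?indicE ?mulr_ge0//.
- by move=> i; apply: measurable_funeM; exact/measurable_EFinP.
- by move=> i x _; rewrite mule_ge0 ?lee_fin ?indicE ?mulr_ge0//.
- by move=> i; apply: measurable_funeM; exact/measurable_EFinP.
apply: eq_bigr => i _.
transitivity ((s`_i)%:E * \int[P]_w (\1_(h @^-1` [set s`_i]) (Y w))%:E).
  by apply: ge0_integralZl; rewrite ?lee_fin//; exact/measurable_EFinP.
transitivity ((s`_i)%:E * \int[mu]_x (\1_(h @^-1` [set s`_i]) x * p x)%:E); last first.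
  apply/esym/ge0_integralZl; rewrite ?lee_fin//; first exact/measurable_EFinP.
  by move=> x _; rewrite lee_fin mulr_ge0.
congr (_ * _).
transitivity (P (Y @^-1` (h @^-1` [set s`_i]))).
  have mYA : measurable (Y @^-1` (h @^-1` [set s`_i])).
    by rewrite -[X in measurable X]setTI; exact: mY.
  by have := integral_indic P measurableT mYA; rewrite setIT => <-.
rewrite law// integral_mkcond; apply: eq_integral => x _.
by rewrite epatch_indic/= EFinM muleC.
Qed.

Lemma law_ge0 (f : V -> \bar R) : measurable_fun setT f -> (forall x, 0 <= f x) ->
  \int[P]_w f (Y w) = \int[mu]_x (f x * (p x)%:E).
Proof.
move=> mf f0; pose g := nnsfun_approx measurableT mf.
have gf x : (g n x)%:E @[n --> \oo] --> f x.
  exact: (cvg_nnsfun_approx measurableT mf (fun x _ => f0 x) (x := x) Logic.I).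
have gnd x : {homo (fun n => g n x) : m n / (m <= n)%N >-> (m <= n)%R}.
  by move=> m n mn; have /lefP := nd_nnsfun_approx measurableT mf mn; exact.
have l1 : \int[P]_w (g n (Y w))%:E @[n --> \oo] --> \int[P]_w f (Y w).
  have -> : \int[P]_w f (Y w) = \int[P]_w limn (fun n => (g n (Y w))%:E).
    by apply: eq_integral => w _; apply/esym/cvg_lim => //; exact: gf.
  apply: cvg_monotone_convergence => //.
  - by move=> n; apply/measurable_EFinP; exact: measurableT_comp.
  - by move=> n w _; rewrite lee_fin.
  - by move=> w _ m n mn; rewrite lee_fin; exact: gnd.
have l2 : \int[mu]_x (g n x * p x)%:E @[n --> \oo] --> \int[mu]_x (f x * (p x)%:E).
  have -> : \int[mu]_x (f x * (p x)%:E) = \int[mu]_x limn (fun n => (g n x * p x)%:E).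
    apply: eq_integral => x _; apply/esym/cvg_lim => //.
    under eq_fun do rewrite EFinM.
    by apply: cvgeZr => //; exact: gf.
  apply: cvg_monotone_convergence => //.
  - by move=> n; apply/measurable_EFinP; exact: measurable_funM.
  - by move=> n x _; rewrite lee_fin mulr_ge0.
  - by move=> x _ m n mn; rewrite lee_fin ler_wpM2r//; exact: gnd.
rewrite -(cvg_lim _ l1)// -(cvg_lim _ l2)//; congr (limn _).
by apply/funext => n; rewrite law_nnsfun.
Qed.

Lemma integral_density : \int[mu]_x (p x)%:E = 1.
Proof. by rewrite -law// preimage_setT probability_setT. Qed.

Lemma integrable_density : mu.-integrable setT (EFin \o p).
Proof. by apply: ge0_integrable => //; rewrite integral_density ltry. Qed.

(** Adding M makes the integrand nonnegative, and the shift contributes M on both sides because P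
    and p have total mass 1. *)
Lemma law_bounded (f : V -> R) M : measurable_fun setT f -> (forall x, `|f x| <= M)%R ->
  (\int[P]_w f (Y w) = \int[mu]_x (f x * p x))%R.
Proof.
move=> mf fM.
have i1 : P.-integrable setT (fun w => (f (Y w))%:E).
  apply: (dominated_integrableR (f := f \o Y) _ (integrable_cstP P M)).
    exact: measurableT_comp.
  by move=> w; exact: fM.
have i2 : mu.-integrable setT (fun x => (f x * p x)%:E).
  by apply: (bounded_integrable (M := M)) integrable_density.
have i3 := integrableZR M integrable_density.
have fM0 x : (0 <= f x + M)%R by have := fM x; rewrite ler_norml => /andP[]; lra.
have := @law_ge0 (fun x => (f x + M)%:E).
rewrite (_ : \int[P]_w _ = (\int[P]_w f (Y w))%R%:E + M%:E); last first.
  rewrite -EFin_Rintegral// -{2}(Rintegral_cstP P M) -EFin_Rintegral; last exact: integrable_cstP.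
  by rewrite -integralD//; exact: integrable_cstP.
rewrite (_ : \int[mu]_x _ = (\int[mu]_x (f x * p x))%R%:E + M%:E); last first.
  transitivity (\int[mu]_x ((f x * p x)%:E + (M * p x)%:E)).
    by apply: eq_integral => x _; rewrite -EFinM -EFinD mulrDl.
  rewrite integralD// (EFin_Rintegral i2); congr (_ + _).
  under eq_integral do rewrite EFinM.
  by rewrite integralZl//; [rewrite integral_density mule1|exact: integrable_density].
rewrite -!EFinD => H; apply/(@addIr _ M)/EFin_inj/H.
- by apply/measurable_EFinP; exact: measurable_funD.
- by move=> x; rewrite lee_fin.
Qed.

Hypothesis L0 : (0 < L)%R.
Hypothesis pL : ('N[mu]_+oo[EFin \o p] <= L%:E)%E.

(** The norm ['N[mu]_+oo] is an essential supremum only when the space has positive measure; this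
    holds because p has integral 1. *)
Let muT : 0%:E < mu [set: V].
Proof.
rewrite lt_neqAle measure_ge0 andbT eq_sym; apply/eqP => mu0.
have := null_set_integral measurableT (measurable_int _ integrable_density) mu0.
by rewrite integral_density => /eqP; rewrite onee_eq0.
Qed.

Lemma density_ae_le : {ae mu, forall x, (p x <= L)%R}.
Proof.
move: pL; rewrite unlock muT => /ess_supP; apply: filterS => x /=.
by rewrite lee_fin; apply: le_trans; exact: ler_norm.
Qed.

(** Replaces the law of an observation by L times Lebesgue measure. It makes second moments finite
    at every point and yields the factor L of the aggregation cost. *)
Lemma law_le (f : V -> \bar R) : measurable_fun setT f -> (forall x, 0 <= f x) ->
  \int[P]_w f (Y w) <= L%:E * \int[mu]_x f x.
Proof.
move=> mf f0; rewrite law_ge0// -ge0_integralZl//; last by rewrite lee_fin ltW.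
apply: ae_ge0_le_integral => //.
- by move=> x _; rewrite mule_ge0// lee_fin.
- by apply: emeasurable_funM => //; exact/measurable_EFinP.
- by move=> x _; rewrite mule_ge0// lee_fin ltW.
- exact: measurable_funeM.
- have := density_ae_le; apply: filterS => x pLx _.
  by rewrite muleC lee_wpmul2r// lee_fin.
Qed.

Lemma sqnorm_density : sqnorm mu p <= L%:E.
Proof.
rewrite /sqnorm -[leRHS]mule1 -integral_density -ge0_integralZl//; last 3 first.
- exact/measurable_EFinP.
- by move=> x _; rewrite lee_fin.
- by rewrite lee_fin ltW.
apply: ae_ge0_le_integral => //.
- by move=> x _; rewrite lee_fin sqr_ge0.
- exact: measurable_sqE.
- by move=> x _; rewrite -EFinM lee_fin mulr_ge0// ltW.
- by apply: measurable_funeM; exact/measurable_EFinP.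
- have := density_ae_le; apply: filterS => x pLx _.
  by rewrite -EFinM lee_fin expr2 ler_wpM2r.
Qed.

End law_density.

Section parametric_measurability.
Context d1 d2 (T1 : measurableType d1) (T2 : measurableType d2) (R : realType).
Variable m1 : {sigma_finite_measure set T1 -> \bar R}.

Lemma measurable_Rintegral_param (F : T1 -> T2 -> R) :
  measurable_fun setT (fun q : T1 * T2 => F q.1 q.2) ->
  measurable_fun setT (fun y => \int[m1]_x F x y).
Proof.
move=> mF; apply: (measurableT_comp (f := @fine R)); first exact: fine_measurable.
have mE : measurable_fun setT (fun q : T1 * T2 => (F q.1 q.2)%:E) by exact/measurable_EFinP.
rewrite (_ : (fun y => _) = (fun y => \int[m1]_x (fun q : T1 * T2 => (F q.1 q.2)%:E)^\+ (x, y) -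
   \int[m1]_x (fun q : T1 * T2 => (F q.1 q.2)%:E)^\- (x, y))%E); last first.
  apply/funext => y; rewrite integralE.
  by congr (_ - _)%E; apply: eq_integral => x _; rewrite ?funeposE ?funenegE.
apply: emeasurable_funB.
- apply: (measurable_fun_fubini_tonelli_G (m1 := m1) (fun q : T1 * T2 => (F q.1 q.2)%:E)^\+%E).
    exact: measurable_funepos.
  by move=> q; exact: funepos_ge0.
- apply: (measurable_fun_fubini_tonelli_G (m1 := m1) (fun q : T1 * T2 => (F q.1 q.2)%:E)^\-%E).
    exact: measurable_funeneg.
  by move=> q; exact: funeneg_ge0.
Qed.

End parametric_measurability.

Section L2norm_sqnorm.
Context {R : realType} {d : nat}.
Local Notation V := (d.-tuple R).

Lemma poweR2 (x : \bar R) : (0 <= x)%E -> (x `^ 2 = x ^+ 2)%E.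
Proof.
case: x => [r|_|//]; last by rewrite poweRyr ?pnatr_eq0// expe2 mulyy.
by rewrite lee_fin => r0; rewrite poweR_EFin powR_mulrn// EFin_expe.
Qed.

Lemma L2norm_sqr (f : V -> R) : (L2norm f ^+ 2 = sqnorm (lebesgueRd d) f)%E.
Proof.
rewrite /L2norm -poweR2 ?Lnorm_ge0// poweR_Lnorm ?pnatr_eq0//.
apply: eq_integral => x _ /=.
by rewrite powR_mulrn// real_normK ?num_real.
Qed.

End L2norm_sqnorm.

(** * Smoothed densities and their Fourier transforms *)

Section smoothing.
Context {R : realType} {d : nat}.
Local Notation mu := (lebesgueRd d).
Local Notation V := (d.-tuple R).

Definition kern_arg (h : R) (y x : V) : V := [tuple (tnth y k - tnth x k) / h | k < d].

Lemma kern_argE h (y x : V) : kern_arg h y x = affv (- h^-1) (scalev h^-1 y) x.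
Proof.
by apply/eq_from_tnth => k; rewrite tnth_affv !tnth_mktuple; ring.
Qed.

Lemma kern_argEl h (y x : V) : kern_arg h y x = affv h^-1 (scalev (- h^-1) x) y.
Proof.
by apply/eq_from_tnth => k; rewrite tnth_affv !tnth_mktuple; ring.
Qed.

Lemma dotv_kern_arg h (y x t : V) : h != 0 ->
  dotv x t = dotv y t - dotv (kern_arg h y x) (scalev h t).
Proof.
move=> h0; rewrite dotv_scaler kern_argE dotv_affv dotv_scalel.
by field.
Qed.

Lemma measurable_kern_arg d' (S : measurableType d') h (f g : S -> V) :
  measurable_fun setT f -> measurable_fun setT g ->
  measurable_fun setT (fun x => kern_arg h (f x) (g x)).
Proof.
move=> mf mg; under eq_fun do rewrite kern_argE.
by apply: measurable_affv => //; exact: measurable_scalev.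
Qed.

Context dT (T : measurableType dT) (P : probability T R).
Variables (Y : T -> V) (p : V -> R) (L : R).
Hypothesis mY : measurable_fun setT Y.
Hypothesis mp : measurable_fun setT p.
Hypothesis p0 : forall x, 0 <= p x.
Hypothesis law : forall A, measurable A ->
  P (Y @^-1` A) = (\int[mu]_(x in A) (p x)%:E)%E.
Hypothesis L0 : 0 < L.
Hypothesis pL : ('N[mu]_+oo[EFin \o p] <= L%:E)%E.

(** The mean of a kernel estimator, that is, the density smoothed by the reflected kernel. Writing
    it as an expectation instead of a convolution with p lets Jensen's inequality and Fubini's
    theorem act on P directly. *)
Definition smooth (h : R) (v : V -> R) (x : V) : R :=
  h ^- d * \int[P]_w v (kern_arg h (Y w) x).

Section fixed_bandwidth.
Variable h : R.
Hypothesis h0 : 0 < h.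

Let hd0 : 0 < h ^+ d. Proof. by rewrite exprn_gt0. Qed.
Let hn0 : h != 0. Proof. by rewrite gt_eqF. Qed.
Let hi0 : h^-1 != 0. Proof. by rewrite invr_eq0. Qed.
Let hNi0 : - h^-1 != 0. Proof. by rewrite oppr_eq0. Qed.
Let hNE : `|- h^-1| ^- d = h ^+ d.
Proof. by rewrite normrN normfV exprVn invrK gtr0_norm. Qed.
Let hE : `|h^-1| ^- d = h ^+ d.
Proof. by rewrite normfV exprVn invrK gtr0_norm. Qed.

Let mkern : measurable_fun setT (fun q : T * V => kern_arg h (Y q.1) q.2).
Proof.
by apply: measurable_kern_arg; [exact: (measurableT_comp mY measurable_fst)|exact: measurable_snd].
Qed.

Let mkernx x : measurable_fun setT (fun w => kern_arg h (Y w) x).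
Proof. exact: measurable_kern_arg. Qed.

(** Integrated over x first, the kernel has the same integral whatever the value of Y, so only the
    total mass of P matters. *)
Lemma kern_tonelli (g : V -> \bar R) : measurable_fun setT g -> (forall x, 0 <= g x)%E ->
  (\int[mu]_x \int[P]_w g (kern_arg h (Y w) x) = (h ^+ d)%:E * \int[mu]_x g x)%E.
Proof.
move=> mg g0.
rewrite -(fubini_tonelli (fun q : T * V => g (kern_arg h (Y q.1) q.2)))//; last first.
  exact: (measurableT_comp mg mkern).
under eq_integral => w _.
  under eq_integral do rewrite /= kern_argE.
  rewrite (ge0_integral_affv _ hNi0 mg g0) hNE; over.
by rewrite integral_cst//= -[RHS]mule1; congr (_ * _)%E; exact: probability_setT.
Qed.

(** Here x is fixed and the substitution is made in the observation, so the bound on the density is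
    needed; second moments become finite at every x, not only at almost every x. *)
Lemma kern_law_le (g : V -> \bar R) x : measurable_fun setT g -> (forall x, 0 <= g x)%E ->
  (\int[P]_w g (kern_arg h (Y w) x) <= L%:E * ((h ^+ d)%:E * \int[mu]_x g x))%E.
Proof.
move=> mg g0; rewrite -hE -(ge0_integral_affv (scalev (- h^-1) x) hi0 mg g0).
under eq_integral do rewrite kern_argEl.
apply: (law_le mY mp p0 law L0 pL (f := fun y => g (affv h^-1 (scalev (- h^-1) x) y))) => //.
by apply: (measurableT_comp mg); exact: measurable_affv1.
Qed.

Variable v : V -> R.
Hypothesis mv : measurable_fun setT v.
Hypothesis v2 : (sqnorm mu v < +oo)%E.

Lemma measurable_kern x : measurable_fun setT (fun w => v (kern_arg h (Y w) x)).
Proof. exact: (measurableT_comp mv (mkernx x)). Qed.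

Lemma kern_sqr_lty x : (\int[P]_w (v (kern_arg h (Y w) x) ^+ 2)%:E < +oo)%E.
Proof.
apply: (le_lt_trans (kern_law_le x (measurable_sqE mv) _)).
  by move=> z; rewrite lee_fin sqr_ge0.
by rewrite muleA -EFinM lte_mul_pinfty// ?lee_fin ?mulr_ge0 ?ltW.
Qed.

Lemma integrable_kern x : P.-integrable setT (fun w => (v (kern_arg h (Y w) x))%:E).
Proof. exact: (integrable_of_sqr (measurable_kern x) (kern_sqr_lty x)). Qed.

Lemma measurable_smooth : measurable_fun setT (smooth h v).
Proof.
apply: measurable_funM => //.
apply: (measurable_Rintegral_param P (F := fun w x => v (kern_arg h (Y w) x))).
exact: (measurableT_comp mv mkern).
Qed.

(** Jensen's inequality under P at each x, then [kern_tonelli]: h^-2d from the square against h^d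
    from the substitution. The bound degrades as h decreases but involves no L1 norm, so it allows
    the passage from approximants to [K] at fixed h. *)
Lemma sqnorm_smooth_le : (sqnorm mu (smooth h v) <= (h ^- d)%:E * sqnorm mu v)%E.
Proof.
have key x : ((smooth h v x ^+ 2)%:E <= (h ^- d ^+ 2)%:E *
    \int[P]_w (v (kern_arg h (Y w) x) ^+ 2)%:E)%E.
  rewrite (EFin_Rintegral (integrable_sqr (measurable_kern x) (kern_sqr_lty x))) -EFinM lee_fin.
  rewrite /smooth exprMn ler_wpM2l ?sqr_ge0//.
  exact: (sqr_Rintegral_le (measurable_kern x) (kern_sqr_lty x)).
have m2 : measurable_fun setT (fun x => \int[P]_w (v (kern_arg h (Y w) x) ^+ 2)%:E)%E.
  apply: (measurable_fun_fubini_tonelli_G (m1 := P)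
    (fun q : T * V => (v (kern_arg h (Y q.1) q.2) ^+ 2)%:E)).
    exact: (measurableT_comp (measurable_sqE mv) mkern).
  by move=> q; rewrite lee_fin sqr_ge0.
apply: (@le_trans _ _ (\int[mu]_x ((h ^- d ^+ 2)%:E *
    \int[P]_w (v (kern_arg h (Y w) x) ^+ 2)%:E))%E).
  apply: ge0_le_integralT => //.
  - by apply: measurable_sqE; exact: measurable_smooth.
  - exact: measurable_funeM.
  - by move=> x; rewrite lee_fin sqr_ge0.
rewrite ge0_integralZl//; last 2 first.
- by move=> x _; apply: integral_ge0 => w _; rewrite lee_fin sqr_ge0.
- by rewrite lee_fin sqr_ge0.
rewrite (kern_tonelli (measurable_sqE mv)); last by move=> x; rewrite lee_fin sqr_ge0.
rewrite muleA -EFinM /sqnorm expr2 -mulrA mulVf ?mulr1//.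
by rewrite gt_eqF.
Qed.

Hypothesis v1 : mu.-integrable setT (EFin \o v).

Let kern_fubini (g : V -> R) : measurable_fun setT g -> (forall x, `|g x| <= 1) ->
  [/\ P.-integrable setT (fun w => (\int[mu]_x (g x * v (kern_arg h (Y w) x)))%:E),
      mu.-integrable setT (fun x => (\int[P]_w (g x * v (kern_arg h (Y w) x)))%:E) &
  \int[P]_w \int[mu]_x (g x * v (kern_arg h (Y w) x)) =
  \int[mu]_x \int[P]_w (g x * v (kern_arg h (Y w) x))].
Proof.
move=> mg g1.
have mF : measurable_fun setT (fun q : T * V => g q.2 * v (kern_arg h (Y q.1) q.2)).
  apply: measurable_funM; first exact: (measurableT_comp mg measurable_snd).
  exact: (measurableT_comp mv mkern).
have mvn : measurable_fun setT (fun x => `|v x|%:E).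
  by apply/measurable_EFinP; exact: measurableT_comp.
have vk w : mu.-integrable setT (fun x => (v (kern_arg h (Y w) x))%:E).
  by under eq_fun do rewrite kern_argE; have [] := Rintegral_affv (scalev h^-1 (Y w)) hNi0 v1.
apply: (RFubini (F := fun w x => g x * v (kern_arg h (Y w) x)) mF).
- apply: (@le_lt_trans _ _ (\int[P]_w \int[mu]_x `|v (kern_arg h (Y w) x)|%:E)%E).
    have mF' : measurable_fun setT (fun q : T * V => `|g q.2 * v (kern_arg h (Y q.1) q.2)|%:E).
      by apply/measurable_EFinP; exact: measurableT_comp.
    have mv' : measurable_fun setT (fun q : T * V => `|v (kern_arg h (Y q.1) q.2)|%:E).
      exact: (measurableT_comp mvn mkern).
    rewrite -(fubini_tonelli1 (fun q : T * V => `|g q.2 * v (kern_arg h (Y q.1) q.2)|%:E))//.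
    rewrite -(fubini_tonelli1 (fun q : T * V => `|v (kern_arg h (Y q.1) q.2)|%:E))//.
    apply: ge0_le_integral => // q _.
    by rewrite lee_fin normrM ler_piMl.
  rewrite (fubini_tonelli (fun q : T * V => `|v (kern_arg h (Y q.1) q.2)|%:E))//; last first.
    exact: (measurableT_comp mvn mkern).
  rewrite (kern_tonelli mvn); last by move=> x; rewrite lee_fin.
  by rewrite lte_mul_pinfty ?lee_fin ?ltW//; exact: integrable_lty_abs.
- move=> w; apply: (bounded_integrable (M := 1) mg g1 (vk w)).
- move=> x; exact: integrableZR (integrable_kern x).
Qed.

Lemma integrable_smooth : mu.-integrable setT (EFin \o smooth h v).
Proof.
have [_ i _] := kern_fubini (measurable_cst (1 : R)) (fun=> ltac:(by rewrite normr1)).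
apply: (@eq_integrable _ _ _ mu setT measurableT
  (fun x => (h ^- d * \int[P]_w (1 * v (kern_arg h (Y w) x)))%:E) _ _ (integrableZR _ i)) => x _.
by rewrite /smooth; under eq_Rintegral do rewrite mul1r.
Qed.

Definition char_cos (t : V) : R := \int[P]_w cos (dotv (Y w) t).
Definition char_sin (t : V) : R := \int[P]_w sin (dotv (Y w) t).

Let mcosY t : measurable_fun setT (fun w => cos (dotv (Y w) t)).
Proof. exact: measurable_cos_dotv. Qed.
Let msinY t : measurable_fun setT (fun w => sin (dotv (Y w) t)).
Proof. exact: measurable_sin_dotv. Qed.

Let icosY t : P.-integrable setT (fun w => (cos (dotv (Y w) t))%:E).
Proof.
apply: (dominated_integrableR (mcosY t) (integrable_cstP P 1)) => w; exact: cos_max.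
Qed.
Let isinY t : P.-integrable setT (fun w => (sin (dotv (Y w) t))%:E).
Proof.
apply: (dominated_integrableR (msinY t) (integrable_cstP P 1)) => w; exact: sin_max.
Qed.

Let affine_transform (G : V -> R) w : mu.-integrable setT (EFin \o G) ->
  \int[mu]_x G (kern_arg h (Y w) x) = h ^+ d * \int[mu]_x G x.
Proof.
move=> Gi; have [_] := Rintegral_affv (scalev h^-1 (Y w)) hNi0 Gi.
by rewrite hNE => <-; apply: eq_Rintegral => x _; rewrite kern_argE.
Qed.

Let smooth_transform (g : V -> R) : measurable_fun setT g -> (forall x, `|g x| <= 1) ->
  \int[mu]_x (g x * smooth h v x) =
  h ^- d * \int[P]_w \int[mu]_x (g x * v (kern_arg h (Y w) x)).
Proof.
move=> mg g1; have [_ i2 E] := kern_fubini mg g1.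
rewrite E -(RintegralZl _ measurableT i2); apply: eq_Rintegral => x _.
rewrite (RintegralZl _ measurableT (integrable_kern x)) /smooth.
exact: mulrCA.
Qed.

Let two_term (a b : R) t : mu.-integrable setT (fun z =>
    (a * (cos (dotv z t) * v z) + b * (sin (dotv z t) * v z))%:E) /\
  \int[mu]_z (a * (cos (dotv z t) * v z) + b * (sin (dotv z t) * v z)) =
  a * fcos v t + b * fsin v t.
Proof.
have ic := integrable_cos_mulr t v1; have is_ := integrable_sin_mulr t v1.
have ia := integrableZR a ic; have ib := integrableZR b is_.
split; first exact: integrableDR ia ib.
rewrite RintegralD; [|exact: measurableT|exact: ia|exact: ib].
rewrite RintegralZl; [|exact: measurableT|exact: ic].
by rewrite RintegralZl; [|exact: measurableT|exact: is_].
Qed.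

Let two_termP (a b : R) t :
  \int[P]_w (a * cos (dotv (Y w) t) + b * sin (dotv (Y w) t)) =
  a * char_cos t + b * char_sin t.
Proof.
have ia := integrableZR a (icosY t); have ib := integrableZR b (isinY t).
rewrite RintegralD; [|exact: measurableT|exact: ia|exact: ib].
rewrite RintegralZl; [|exact: measurableT|exact: icosY].
by rewrite RintegralZl; [|exact: measurableT|exact: isinY].
Qed.

(** Together with [fsin_smooth]: the transform of the smoothed density at t is the characteristic
    function of Y times the conjugate of F[v](h t). The conjugate appears because x enters
    [kern_arg] with a minus sign. *)
Lemma fcos_smooth t : fcos (smooth h v) t =
  char_cos t * fcos v (scalev h t) + char_sin t * fsin v (scalev h t).
Proof.
rewrite {1}/fcos smooth_transform; last 2 first.
- exact: measurable_cos_dotv.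
- by move=> x; exact: cos_max.
set c := fcos v _; set s := fsin v _.
transitivity (h ^- d * \int[P]_w (h ^+ d * c * cos (dotv (Y w) t) + h ^+ d * s * sin (dotv (Y w) t))).
  congr (_ * _); apply: eq_Rintegral => w _.
  have [iG EG] := two_term (cos (dotv (Y w) t)) (sin (dotv (Y w) t)) (scalev h t).
  transitivity (h ^+ d * (cos (dotv (Y w) t) * c + sin (dotv (Y w) t) * s)); last by ring.
  rewrite -EG -(affine_transform w iG); apply: eq_Rintegral => x _.
  by rewrite (dotv_kern_arg (Y w) x t hn0) cosB; ring.
rewrite two_termP -/c -/s; field.
by rewrite gt_eqF.
Qed.

Lemma fsin_smooth t : fsin (smooth h v) t =
  char_sin t * fcos v (scalev h t) - char_cos t * fsin v (scalev h t).
Proof.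
rewrite {1}/fsin smooth_transform; last 2 first.
- exact: measurable_sin_dotv.
- by move=> x; exact: sin_max.
set c := fcos v _; set s := fsin v _.
transitivity (h ^- d * \int[P]_w (- (h ^+ d * s) * cos (dotv (Y w) t) + h ^+ d * c * sin (dotv (Y w) t))).
  congr (_ * _); apply: eq_Rintegral => w _.
  have [iG EG] := two_term (sin (dotv (Y w) t)) (- cos (dotv (Y w) t)) (scalev h t).
  transitivity (h ^+ d * (sin (dotv (Y w) t) * c + - cos (dotv (Y w) t) * s)); last by ring.
  rewrite -EG -(affine_transform w iG); apply: eq_Rintegral => x _.
  by rewrite (dotv_kern_arg (Y w) x t hn0) sinB; ring.
rewrite two_termP -/c -/s; field.
by rewrite gt_eqF.
Qed.

Let pi1 := integrable_density mp p0 law.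

Let char_cosE t : char_cos t = fcos p t.
Proof.
rewrite /char_cos (law_bounded mY mp p0 law (f := fun y => cos (dotv y t)) (M := 1))//.
- exact: measurable_cos_dotv.
- by move=> y; exact: cos_max.
Qed.

Let char_sinE t : char_sin t = fsin p t.
Proof.
rewrite /char_sin (law_bounded mY mp p0 law (f := fun y => sin (dotv y t)) (M := 1))//.
- exact: measurable_sin_dotv.
- by move=> y; exact: sin_max.
Qed.

Definition char_sqr (t : V) : R := char_cos t ^+ 2 + char_sin t ^+ 2.

Lemma char_sqr_ge0 t : 0 <= char_sqr t.
Proof. by rewrite addr_ge0 ?sqr_ge0. Qed.

Lemma char_sqr_le1 t : char_sqr t <= 1.
Proof.
have c2 : (\int[P]_w (cos (dotv (Y w) t) ^+ 2)%:E < +oo)%E.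
  apply: (@le_lt_trans _ _ (\int[P]_w (1 : R)%:E)%E); last first.
    by rewrite (EFin_Rintegral (integrable_cstP P 1)) ltry.
  apply: ge0_le_integralT => //.
  - exact: measurable_sqE (mcosY t).
  - by move=> w; rewrite lee_fin sqr_ge0.
  - by move=> w; rewrite lee_fin -(cos2Dsin2 (dotv (Y w) t)) lerDl sqr_ge0.
have s2 : (\int[P]_w (sin (dotv (Y w) t) ^+ 2)%:E < +oo)%E.
  apply: (@le_lt_trans _ _ (\int[P]_w (1 : R)%:E)%E); last first.
    by rewrite (EFin_Rintegral (integrable_cstP P 1)) ltry.
  apply: ge0_le_integralT => //.
  - exact: measurable_sqE (msinY t).
  - by move=> w; rewrite lee_fin sqr_ge0.
  - by move=> w; rewrite lee_fin -(cos2Dsin2 (dotv (Y w) t)) lerDr sqr_ge0.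
have := lerD (sqr_Rintegral_le (mcosY t) c2) (sqr_Rintegral_le (msinY t) s2).
move/le_trans; apply.
have i1 := integrable_sqr (mcosY t) c2; have i2 := integrable_sqr (msinY t) s2.
rewrite -RintegralD; [|exact: measurableT|exact: i1|exact: i2].
under eq_Rintegral do rewrite cos2Dsin2.
by rewrite Rintegral_cstP.
Qed.

Lemma measurable_char_sqr : measurable_fun setT char_sqr.
Proof.
have p2 : (sqnorm mu p < +oo)%E.
  by apply: (le_lt_trans (sqnorm_density mp p0 law L0 pL)); rewrite ltry.
apply: measurable_funD; apply: measurable_funX.
  by rewrite (funext char_cosE); exact: measurable_fcos.
by rewrite (funext char_sinE); exact: measurable_fsin.
Qed.

(** Squared distance to 1 of a transform with real part c and imaginary part s: the factor by which
    smoothing misses the identity. *)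
Definition dev1 (c s : V -> R) (t : V) : R := (c t - 1) ^+ 2 + s t ^+ 2.

Lemma fenergy_smooth t : fenergy (fun x => smooth h v x - p x) t =
  char_sqr t * dev1 (fcos v) (fsin v) (scalev h t).
Proof.
have is_ := integrable_smooth.
have -> : fenergy (fun x => smooth h v x - p x) t =
    (fcos (smooth h v) t - fcos p t) ^+ 2 + (fsin (smooth h v) t - fsin p t) ^+ 2.
  rewrite /fenergy; congr (_ ^+ 2 + _ ^+ 2).
  - rewrite /fcos -RintegralB; [|exact: measurableT| |]; last 2 first.
    + exact: integrable_cos_mulr is_.
    + exact: integrable_cos_mulr pi1.
    by apply: eq_Rintegral => x _; rewrite mulrBr.
  - rewrite /fsin -RintegralB; [|exact: measurableT| |]; last 2 first.
    + exact: integrable_sin_mulr is_.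
    + exact: integrable_sin_mulr pi1.
    by apply: eq_Rintegral => x _; rewrite mulrBr.
rewrite fcos_smooth fsin_smooth -char_cosE -char_sinE /char_sqr /dev1.
ring.
Qed.

Lemma plancherel_smooth :
  (\int[mu]_t (char_sqr t * dev1 (fcos v) (fsin v) (scalev h t))%:E =
   ((2 * pi) ^+ d)%:E * sqnorm mu (fun x => smooth h v x - p x)%R)%E.
Proof.
have iw := integrableBR integrable_smooth pi1.
rewrite -(plancherel iw); first by apply: eq_integral => t _; rewrite fenergy_smooth.
have p2 : (sqnorm mu p < +oo)%E.
  by apply: (le_lt_trans (sqnorm_density mp p0 law L0 pL)); rewrite ltry.
apply: (le_lt_trans (sqnormD_le (f := smooth h v) (g := fun x => - p x) mu _ _)).
- exact: measurable_smooth.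
- exact: measurableT_comp.
rewrite sqnormN lte_add_pinfty// lte_mul_pinfty// ?sqnorm_ge0 ?lee_fin//.
apply: (le_lt_trans sqnorm_smooth_le).
by rewrite lte_mul_pinfty// lee_fin invr_ge0 ltW.
Qed.

End fixed_bandwidth.

End smoothing.

(** The error constant C may depend on e but not on n, so n can be chosen after it. The exponent 4
    counts the lossy passages in [bias_mono]; 15 = 4 + 6 + 4 + 1 comes from (1 + D)^4 <= 1 + 15 D on
    [0, 1], and D and n are chosen to make each error at most e/2. *)
Lemma ler_of_approx (R : realFieldType) (x y : R) : 0 <= y ->
  (forall e, 0 < e <= 1 -> exists C, forall n, 0 < n -> x <= (1 + e) ^+ 4 * y + C * n) ->
  x <= y.
Proof.
move=> y0 H; apply/ler_addgt0Pr => e e0.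
pose D := e / (30 * (y + 1) + e).
have y1 : 0 < 30 * (y + 1) + e by lra.
have D0 : 0 < D by rewrite divr_gt0.
have D1 : D <= 1 by rewrite ler_pdivrMr//; lra.
have [|C HC] := H D; first by rewrite D0.
pose n := e / (2 * (`|C| + 1)).
have C1 : 0 < 2 * (`|C| + 1) by rewrite mulr_gt0// ltr_wpDl.
have n0 : 0 < n by rewrite divr_gt0.
have Cn : C * n <= e / 2.
  apply: (@le_trans _ _ (`|C| * n)); first by rewrite ler_wpM2r ?ler_norm// ltW.
  rewrite /n mulrA ler_pdivrMr//.
  have := normr_ge0 C; nra.
have Dy : 15 * D * y <= e / 2.
  have -> : 15 * D * y = 15 * e * y / (30 * (y + 1) + e) by rewrite /D; ring.
  rewrite ler_pdivrMr//; nra.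
have D4 : (1 + D) ^+ 4 <= 1 + 15 * D.
  have D2 : D ^+ 2 <= D by rewrite expr2; nra.
  have D3 : D ^+ 3 <= D by rewrite exprS; nra.
  have D4 : D ^+ 4 <= D by rewrite exprS; nra.
  have -> : (1 + D) ^+ 4 = 1 + 4 * D + 6 * D ^+ 2 + 4 * D ^+ 3 + D ^+ 4 by ring.
  lra.
have := HC n n0.
have : (1 + D) ^+ 4 * y <= (1 + 15 * D) * y by rewrite ler_wpM2r.
lra.
Qed.

Lemma ge0_lty_real (R : realType) (x : \bar R) : (0 <= x)%E -> (x < +oo)%E ->
  exists2 r : R, 0 <= r & x = r%:E.
Proof. by case: x => // r; rewrite lee_fin => r0 _; exists r. Qed.

Section L2norm_limits.
Context {R : realType} {d : nat}.
Local Notation mu := (lebesgueRd d).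
Local Notation V := (d.-tuple R).

Lemma L2norm_cvg0_sqnorm (g : nat -> V -> R) :
  L2norm (g k) @[k --> \oo] --> 0%E ->
  forall e : R, 0 < e -> \forall k \near \oo, (sqnorm mu (g k) <= e%:E)%E.
Proof.
move=> /fine_cvgP[fin /cvgrPdist_le H] e e0.
pose r := Num.min 1 e.
have r0 : 0 < r by rewrite lt_min ltr01.
have r1 : r <= 1 by rewrite ge_min lexx.
have re : r <= e by rewrite ge_min lexx orbT.
apply: filterS2 fin (H r r0) => k fin /=.
rewrite sub0r normrN => hr; rewrite -L2norm_sqr -(fineK fin) -EFin_expe lee_fin.
rewrite -(real_normK (num_real _)); apply: le_trans re.
have := normr_ge0 (fine (L2norm (g k))); rewrite expr2; nra.
Qed.

Lemma Lfun2_sqnorm (f : V -> R) : f \in Lfun mu 2%:E ->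
  measurable_fun setT f /\ (sqnorm mu f < +oo)%E.
Proof.
rewrite inE => /andP[]; rewrite !inE/= /finite_norm/= => mf foo; split => //.
have [r _ Er] := ge0_lty_real (Lnorm_ge0 mu 2%:E (EFin \o f)) foo.
by rewrite -L2norm_sqr /L2norm Er -EFin_expe ltry.
Qed.

Lemma Lfun1_measurable_integrable (f : V -> R) : f \in Lfun mu 1%E ->
  mu.-integrable setT (EFin \o f).
Proof. by move=> /Lfun1_integrable. Qed.

Lemma ge0_integral_scalev (f : V -> \bar R) (a : R) : 0 < a ->
  measurable_fun setT f -> (forall x, 0 <= f x)%E ->
  (\int[mu]_x f (scalev a x) = (a ^- d)%:E * \int[mu]_x f x)%E.
Proof.
move=> a0 mf f0; have an0 : a != 0 by rewrite gt_eqF.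
rewrite -{2}(gtr0_norm a0) -(ge0_integral_affv zerov an0 mf f0).
by apply: eq_integral => x _; rewrite scalevE.
Qed.

End L2norm_limits.

(** * Monotonicity of the bias in the bandwidth *)

Section bias_monotone.
Context {R : realType} {d : nat}.
Local Notation mu := (lebesgueRd d).
Local Notation V := (d.-tuple R).
Context dT (T : measurableType dT) (P : probability T R).
Variables (Y : T -> V) (p : V -> R) (L : R).
Hypothesis mY : measurable_fun setT Y.
Hypothesis mp : measurable_fun setT p.
Hypothesis p0 : forall x, 0 <= p x.
Hypothesis law : forall A, measurable A ->
  P (Y @^-1` A) = (\int[mu]_(x in A) (p x)%:E)%E.
Hypothesis L0 : 0 < L.
Hypothesis pL : ('N[mu]_+oo[EFin \o p] <= L%:E)%E.

Definition bias (h : R) (v : V -> R) : \bar R :=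
  sqnorm mu (fun x => smooth P Y h v x - p x).

Lemma bias_lty h v : 0 < h -> measurable_fun setT v -> (sqnorm mu v < +oo)%E ->
  (bias h v < +oo)%E.
Proof.
move=> h0 mv v2.
have ms := measurable_smooth P mY h mv.
have p2 : (sqnorm mu p < +oo)%E.
  by apply: (le_lt_trans (sqnorm_density mp p0 law L0 pL)); rewrite ltry.
apply: (le_lt_trans (sqnormD_le (f := smooth P Y h v) (g := fun x => - p x) mu _ _)) => //.
  exact: measurableT_comp.
rewrite sqnormN lte_add_pinfty// lte_mul_pinfty// ?sqnorm_ge0 ?lee_fin//.
apply: (le_lt_trans (sqnorm_smooth_le mY mp p0 law L0 pL h0 mv v2)).
by rewrite lte_mul_pinfty ?sqnorm_ge0// lee_fin invr_ge0 exprn_ge0 ?ltW.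
Qed.

Lemma bias_delta (h : R) (u v : V -> R) (e : R) : 0 < h -> 0 < e ->
  measurable_fun setT u -> (sqnorm mu u < +oo)%E ->
  measurable_fun setT v -> (sqnorm mu v < +oo)%E ->
  (bias h u <= (1 + e)%:E * bias h v +
    (1 + e^-1)%:E * ((h ^- d)%:E * sqnorm mu (fun x => u x - v x)%R))%E.
Proof.
move=> h0 e0 mu_ u2 mv v2.
have muv : measurable_fun setT (fun x => u x - v x) by exact: measurable_funB.
have uv2 : (sqnorm mu (fun x => u x - v x)%R < +oo)%E.
  apply: (le_lt_trans (sqnormD_le (f := u) (g := fun x => - v x) mu _ _)) => //.
    exact: measurableT_comp.
  by rewrite sqnormN lte_add_pinfty// lte_mul_pinfty// ?sqnorm_ge0 ?lee_fin.
have -> : bias h u = sqnorm mu (fun x => (smooth P Y h v x - p x) + smooth P Y h (fun z => u z - v z) x).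
  rewrite /bias; congr (sqnorm mu _); apply/funext => x; rewrite {3}/smooth.
  rewrite RintegralB; [|exact: measurableT| |]; last 2 first.
  - exact: (integrable_kern mY mp p0 law L0 pL h0 mu_ u2 x).
  - exact: (integrable_kern mY mp p0 law L0 pL h0 mv v2 x).
  by rewrite /smooth; ring.
apply: (le_trans (sqnormD_delta mu e0 _ _)).
- by apply: measurable_funB => //; exact: measurable_smooth.
- exact: measurable_smooth.
apply: leeD => //; apply: lee_wpmul2l.
  by rewrite lee_fin addr_ge0// invr_ge0 ltW.
exact: (sqnorm_smooth_le mY mp p0 law L0 pL h0 muv uv2).
Qed.

Variables (K : V -> R) (FK : V -> R[i]).
Hypothesis K2 : K \in Lfun mu 2%:E.
Hypothesis KF : is_fourierL2 K FK.
Hypothesis F01 : forall t, 0 <= FK t <= 1.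
Hypothesis Fmono : forall t (h h' : R), 0 < h' -> h' < h ->
  FK (scalev h t) <= FK (scalev h' t).

Let f (t : V) : R := complex.Re (FK t).

(** The order of [R[i]] compares only numbers with equal imaginary parts, so 0 <= FK t forces FK t
    to be real. *)
Let fE t : FK t = Complex (f t) 0.
Proof.
have := F01 t; rewrite /f; case: (FK t) => a b; rewrite !lecE/=.
by move=> /andP[/andP[/eqP -> _] _].
Qed.

Let f_le1 t : f t <= 1.
Proof. by have := F01 t; rewrite fE !lecE/= => /andP[_ /andP[_ ->]]. Qed.

Let f_mono t h h' : 0 < h' -> h' < h -> f (scalev h t) <= f (scalev h' t).
Proof. by move=> h0 hh; have := Fmono t h0 hh; rewrite !fE lecE/= => /andP[_ ->]. Qed.

Let mf : measurable_fun setT f. Proof. by have [] := KF. Qed.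

(** [E] is the bias energy of an approximant with transform c + i s, [M] its analogue with FK in
    place of that transform, [D] the squared distance of the two. Each of [E] and [M] controls the
    other: the squared characteristic function is at most 1, so the error term can drop this weight,
    and rescaling t by h turns it into h^-d D. *)
Let bound (h e : R) (c s : V -> R) : 0 < h -> 0 < e ->
  measurable_fun setT c -> measurable_fun setT s ->
  let E := (\int[mu]_t (char_sqr P Y t * dev1 c s (scalev h t))%:E)%E in
  let M := (\int[mu]_t (char_sqr P Y t * (1 - f (scalev h t)) ^+ 2)%:E)%E in
  let D := (\int[mu]_t ((c t - f t) ^+ 2 + s t ^+ 2)%:E)%E in
  (E <= (1 + e)%:E * M + (1 + e^-1)%:E * ((h ^- d)%:E * D))%E /\
  (M <= (1 + e)%:E * E + (1 + e^-1)%:E * ((h ^- d)%:E * D))%E.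
Proof.
move=> h0 e0 mc ms E M D.
have msc : measurable_fun setT (scalev h : V -> V) by exact: measurable_scalev.
have mD : measurable_fun setT (fun t => (c t - f t) ^+ 2 + s t ^+ 2).
  by apply: measurable_funD; apply: measurable_funX => //; exact: measurable_funB.
have D0 t : 0 <= (c t - f t) ^+ 2 + s t ^+ 2 by rewrite addr_ge0 ?sqr_ge0.
have mdev : measurable_fun setT (dev1 c s).
  by apply: measurable_funD; apply: measurable_funX => //; exact: measurable_funB.
have dev0 t : 0 <= dev1 c s t by rewrite addr_ge0 ?sqr_ge0.
have mchi := measurable_char_sqr mY mp p0 law L0 pL.
have chi0 := char_sqr_ge0 P Y.
have chi1 := char_sqr_le1 P mY.
have mf1 : measurable_fun setT (fun t => (1 - f t) ^+ 2).
  by apply: measurable_funX; exact: measurable_funB.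
have DE : ((h ^- d)%:E * D = \int[mu]_t ((c (scalev h t) - f (scalev h t)) ^+ 2 + s (scalev h t) ^+ 2)%:E)%E.
  rewrite -(ge0_integral_scalev h0 (f := fun t => ((c t - f t) ^+ 2 + s t ^+ 2)%:E))//.
  exact/measurable_EFinP.
have e1 : 0 <= 1 + e by rewrite addr_ge0 ?ltW.
have e2 : 0 <= 1 + e^-1 by rewrite addr_ge0// invr_ge0 ltW.
have mE : measurable_fun setT (fun t => char_sqr P Y t * dev1 c s (scalev h t)).
  by apply: measurable_funM => //; exact: (measurableT_comp mdev msc).
have mM : measurable_fun setT (fun t => char_sqr P Y t * (1 - f (scalev h t)) ^+ 2).
  by apply: measurable_funM => //; exact: (measurableT_comp mf1 msc).
have mDs : measurable_fun setT (fun t => (c (scalev h t) - f (scalev h t)) ^+ 2 + s (scalev h t) ^+ 2).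
  exact: (measurableT_comp mD msc).
have chi_le A B C t : 0 <= C -> A <= (1 + e) * B + (1 + e^-1) * C ->
    char_sqr P Y t * A <= (1 + e) * (char_sqr P Y t * B) + (1 + e^-1) * C.
  move=> C0 AB; apply: (le_trans (ler_wpM2l (chi0 t) AB)).
  rewrite mulrDr mulrCA lerD2l ler_piMl//; exact: mulr_ge0.
have q1 a b c' : (c' - 1) ^+ 2 + b ^+ 2 <= (1 + e) * (1 - a) ^+ 2 +
    (1 + e^-1) * ((c' - a) ^+ 2 + b ^+ 2).
  have := sqrD_delta (a - 1) (c' - a) e0.
  rewrite addrC subrKA -(opprB 1 a) sqrrN.
  have : 0 <= e^-1 * b ^+ 2 by rewrite mulr_ge0 ?sqr_ge0 ?invr_ge0 ?ltW.
  lra.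
have q2 a b c' : (1 - a) ^+ 2 <= (1 + e) * ((c' - 1) ^+ 2 + b ^+ 2) +
    (1 + e^-1) * ((c' - a) ^+ 2 + b ^+ 2).
  have := sqrD_delta (1 - c') (c' - a) e0.
  rewrite subrKA -(opprB c' 1) sqrrN.
  have : 0 <= (1 + e) * b ^+ 2 by rewrite mulr_ge0 ?sqr_ge0.
  have : 0 <= (1 + e^-1) * b ^+ 2 by rewrite mulr_ge0 ?sqr_ge0.
  lra.
rewrite DE; split; apply: ge0_integralD_le => // t.
- by rewrite mulr_ge0// sqr_ge0.
- by rewrite mulr_ge0.
- by apply: chi_le => //; exact: q1.
- by rewrite mulr_ge0.
- by rewrite mulr_ge0// sqr_ge0.
- by apply: chi_le => //; exact: q2.
Qed.

(** Pointwise in t: 1 - f is nonnegative as f <= 1, so monotonicity of f along rays survives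
    squaring. *)
Let M_le h h' : 0 < h' -> h' < h ->
  (\int[mu]_t (char_sqr P Y t * (1 - f (scalev h' t)) ^+ 2)%:E <=
   \int[mu]_t (char_sqr P Y t * (1 - f (scalev h t)) ^+ 2)%:E)%E.
Proof.
move=> h'0 hh.
have m x : measurable_fun setT (fun t => char_sqr P Y t * (1 - f (scalev x t)) ^+ 2).
  apply: measurable_funM; first exact: (measurable_char_sqr mY mp p0 law L0 pL).
  apply: measurable_funX; apply: measurable_funB => //.
  by apply: (measurableT_comp mf); exact: measurable_scalev.
apply: ge0_le_integralT.
- by apply/measurable_EFinP; exact: m.
- by apply/measurable_EFinP; exact: m.
- by move=> t; rewrite lee_fin mulr_ge0 ?sqr_ge0// char_sqr_ge0.
move=> t; rewrite lee_fin ler_wpM2l ?char_sqr_ge0//.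
have := f_mono t h'0 hh; have := f_le1 (scalev h' t); have := f_le1 (scalev h t).
by move=> a b c; rewrite ler_sqr ?nnegrE ?subr_ge0// lerB.
Qed.

(** [K] need not be integrable, so the comparison travels from the bias of K at h' to that of an
    approximant w, on to the integral [M'], to [M] by [M_le], and back through w to K at h. The four
    inexact passages each cost a factor 1 + e and an error proportional to the accuracy n. *)
Lemma bias_mono (h h' : R) : 0 < h' -> h' < h -> (bias h' K <= bias h K)%E.
Proof.
move=> h'0 hh; have h0 : 0 < h by exact: lt_trans hh.
have [mK K2'] := Lfun2_sqnorm K2.
have [b b0 Eb] : exists2 r : R, 0 <= r & bias h K = r%:E.
  by apply: ge0_lty_real; [exact: sqnorm_ge0|exact: bias_lty].
have [b' b'0 Eb'] : exists2 r : R, 0 <= r & bias h' K = r%:E.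
  by apply: ge0_lty_real; [exact: sqnorm_ge0|exact: bias_lty].
rewrite Eb Eb' lee_fin.
have k0 : 0 < (2 * pi : R) ^+ d by rewrite exprn_gt0// mulr_gt0// pi_gt0.
set k := (2 * pi) ^+ d in k0.
rewrite -(ler_pM2l k0); apply: ler_of_approx; first by rewrite mulr_ge0// ltW.
move=> e /andP[e0 e1].
pose c := h ^- d; pose c' := h' ^- d.
have c0 : 0 < c by rewrite invr_gt0 exprn_gt0.
have c'0 : 0 < c' by rewrite invr_gt0 exprn_gt0.
pose g := 1 + e^-1; have g0 : 0 < g by rewrite addr_gt0// invr_gt0.
(* The errors of [s1] to [s4] below, each multiplied by the factors 1 + e of the passages before
   it. *)
exists (g * k * c' + (1 + e) * g * c' + (1 + e) ^+ 2 * g * c + (1 + e) ^+ 3 * k * g * c).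
move=> n n0; have [_ _ [u [u1 u2 uK uF]]] := KF.
(* Here n is a real accuracy; one approximant serves both K and its transform, at both
   bandwidths. *)
have near_n := filterI (L2norm_cvg0_sqnorm uK n0) (L2norm_cvg0_sqnorm uF n0).
have [N _ /(_ N (leqnn N)) [/= uKn uFn]] := near_n.
have ui := Lfun1_measurable_integrable (u1 N).
have [mu_ u2'] := Lfun2_sqnorm (u2 N).
set w := u N in uKn uFn ui mu_ u2'.
have [E1 E2] := bound h0 e0 (measurable_fcos ui) (measurable_fsin ui).
have [E1' E2'] := bound h'0 e0 (measurable_fcos ui) (measurable_fsin ui).
have Dn : (\int[mu]_t ((fcos w t - f t) ^+ 2 + fsin w t ^+ 2)%:E <= n%:E)%E.
  apply: le_trans uFn; rewrite le_eqVlt; apply/orP; left; apply/eqP.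
  apply: eq_integral => t _; rewrite fE /fourierL1/= subr0 sqr_sqrtr//.
  by rewrite addr_ge0 ?sqr_ge0.
have P1 := plancherel_smooth mY mp p0 law L0 pL h0 mu_ u2' ui.
have P2 := plancherel_smooth mY mp p0 law L0 pL h'0 mu_ u2' ui.
rewrite P1 in E1 E2; rewrite P2 in E1' E2'.
have [bu bu0 Ebu] : exists2 r : R, 0 <= r & bias h w = r%:E.
  by apply: ge0_lty_real; [exact: sqnorm_ge0|exact: bias_lty].
have [bu' bu'0 Ebu'] : exists2 r : R, 0 <= r & bias h' w = r%:E.
  by apply: ge0_lty_real; [exact: sqnorm_ge0|exact: bias_lty].
rewrite -/(bias h w) Ebu in E1 E2; rewrite -/(bias h' w) Ebu' in E1' E2'.
have B1 := bias_delta h'0 e0 mK K2' mu_ u2'.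
have B2 := bias_delta h0 e0 mu_ u2' mK K2'.
have [eps eps0 Eeps] := ge0_lty_real (sqnorm_ge0 mu (fun x => w x - K x)) (le_lt_trans uKn (ltry _)).
have [D D0 ED] : exists2 D : R, 0 <= D &
    (\int[mu]_t ((fcos w t - f t) ^+ 2 + fsin w t ^+ 2)%:E)%E = D%:E.
  apply: ge0_lty_real; last exact: le_lt_trans Dn (ltry _).
  by apply: integral_ge0 => t _; rewrite lee_fin addr_ge0 ?sqr_ge0.
rewrite ED in E1 E2 E1' E2' Dn.
rewrite [sqnorm mu (fun x => K x - w x)]sqnormB Eeps in B1; rewrite Eeps in B2 uKn.
rewrite Eb' Ebu' -!EFinM -!EFinD lee_fin in B1.
rewrite Eb Ebu -!EFinM -!EFinD lee_fin in B2.
have Mle := M_le h'0 hh.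
have M0 x : (0 <= \int[mu]_t (char_sqr P Y t * (1 - f (scalev x t)) ^+ 2)%:E)%E.
  by apply: integral_ge0 => t _; rewrite lee_fin mulr_ge0 ?sqr_ge0// char_sqr_ge0.
have [M _ EM] := ge0_lty_real (M0 h) (le_lt_trans E2 (ltry _)).
have [M' _ EM'] := ge0_lty_real (M0 h') (le_lt_trans E2' (ltry _)).
rewrite EM in E2 Mle; rewrite EM' in E1' Mle.
rewrite -!EFinM -!EFinD lee_fin in E2; rewrite -!EFinM -!EFinD lee_fin in E1'.
rewrite !lee_fin in Mle Dn uKn.
rewrite -/k -/c -/c' -/g in E1' E2 B1 B2.
have e10 : 0 <= 1 + e by rewrite addr_ge0 ?ltW.
have s1 : k * b' <= (1 + e) * (k * bu') + g * k * c' * n.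
  apply: (le_trans (ler_wpM2l (ltW k0) B1)).
  rewrite mulrDr [k * (_ * bu')]mulrCA lerD2l.
  rewrite (_ : k * (g * (c' * eps)) = g * k * c' * eps); last by ring.
  by rewrite ler_wpM2l// !mulr_ge0// ltW.
have s2 : k * bu' <= (1 + e) * M + g * c' * n.
  apply: (le_trans E1'); apply: lerD; first exact: ler_wpM2l.
  by rewrite mulrA ler_wpM2l// mulr_ge0// ltW.
have s3 : M <= (1 + e) * (k * bu) + g * c * n.
  apply: (le_trans E2); rewrite lerD2l.
  by rewrite mulrA ler_wpM2l// mulr_ge0// ltW.
have s4 : k * bu <= (1 + e) * (k * b) + k * g * c * n.
  apply: (le_trans (ler_wpM2l (ltW k0) B2)).
  rewrite mulrDr [k * (_ * b)]mulrCA lerD2l.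
  rewrite (_ : k * (g * (c * eps)) = k * g * c * eps); last by ring.
  by rewrite ler_wpM2l// !mulr_ge0// ltW.
have t3 := ler_wpM2l e10 (le_trans s3 (lerD (ler_wpM2l e10 s4) (lexx _))).
have t2 := ler_wpM2l e10 (le_trans s2 (lerD t3 (lexx _))).
apply: (le_trans (le_trans s1 (lerD t2 (lexx _)))).
rewrite le_eqVlt; apply/orP; left; apply/eqP; ring.
Qed.

End bias_monotone.

(** * Exact risk of kernel estimators *)

Section Rintegral_sums.
Context d (T : measurableType d) (R : realType) (mu : {measure set T -> \bar R}).
Variables (I : Type) (f : I -> T -> R).
Hypothesis fi : forall i, mu.-integrable setT (EFin \o f i).

Lemma integrable_sumR (s : seq I) (Q : pred I) :
  mu.-integrable setT (fun x => (\sum_(i <- s | Q i) f i x)%:E).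
Proof.
under eq_fun do rewrite -sumEFin.
by apply: (@integrable_sum _ _ _ mu setT measurableT _ s Q (fun i x => (f i x)%:E)) => i _; exact: fi.
Qed.

Lemma Rintegral_sumR (s : seq I) (Q : pred I) :
  \int[mu]_x \sum_(i <- s | Q i) f i x = \sum_(i <- s | Q i) \int[mu]_x f i x.
Proof.
elim: s => [|i s IH].
  under eq_Rintegral do rewrite big_nil.
  by rewrite big_nil; apply: RintegralE; rewrite integral0.
under eq_Rintegral do rewrite big_cons.
rewrite big_cons; case: ifP => Qi; last exact: IH.
by rewrite RintegralD ?IH; [|exact: measurableT|exact: fi|exact: integrable_sumR].
Qed.

End Rintegral_sums.

Lemma fin_sube_eq0 (R : realDomainType) (x y : \bar R) :
  x \is a fin_num -> y \is a fin_num -> (x - y = 0)%E -> x = y.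
Proof. by case: x y => [a| |] [b| |]// _ _ [] /eqP; rewrite subr_eq0 => /eqP ->. Qed.

(** * Independence through resampling of one observation *)

Section resampling.
Context {R : realType} {d : nat} dT (T : measurableType dT) (P : probability T R).
Local Notation V := (d.-tuple R).
Variable X : nat -> {RV P >-> V}.
Hypothesis indepX : mutually_independent X.
Variable n : nat.

Definition sample (w : T) : n.-tuple V := [tuple X i w | i < n].
Definition upd (i : 'I_n) (y : V) (xs : n.-tuple V) : n.-tuple V :=
  [tuple if k == i then y else tnth xs k | k < n].

Lemma measurable_X i : measurable_fun setT (X i).
Proof. by []. Qed.

Lemma measurable_sample : measurable_fun setT sample.
Proof.
apply/measurable_fun_tnthP => i.
rewrite (_ : _ \o _ = X i); first exact: measurable_X.
by apply/funext => w /=; rewrite tnth_mktuple.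
Qed.

Lemma measurable_upd d' (S : measurableType d') i (f : S -> V) (g : S -> n.-tuple V) :
  measurable_fun setT f -> measurable_fun setT g ->
  measurable_fun setT (fun x => upd i (f x) (g x)).
Proof.
move=> mf mg; apply/measurable_fun_tnthP => k.
have [ki|ki] := boolP (k == i).
  by rewrite (_ : _ \o _ = f)//; apply/funext => x /=; rewrite tnth_mktuple ki.
rewrite (_ : _ \o _ = fun x => tnth (g x) k); last first.
  by apply/funext => x /=; rewrite tnth_mktuple (negbTE ki).
exact: (measurableT_comp (measurable_tnth k) mg).
Qed.

Let indep_box (B : 'I_n -> set V) : (forall k, measurable (B k)) ->
  P [set w | forall k : 'I_n, B k (X k w)] = (\prod_(k < n) P (X k @^-1` B k))%E.
Proof.
move=> mB; pose A j : set V := if insub j is Some k then B k else setT.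
have mA j : measurable (A j) by rewrite /A; case: insubP.
have AE (k : 'I_n) : A k = B k by rewrite /A valK.
pose J : {fset nat} := [fset x in iota 0 n]%fset.
have JE j : (j \in J) = (j < n)%N by rewrite !inE mem_iota add0n.
have := indepX J mA.
rewrite (_ : \bigcap_(_ in _) _ = [set w | forall k : 'I_n, B k (X k w)]); last first.
  apply/seteqP; split => w /=.
    by move=> H k; rewrite -AE; apply: (H k); rewrite /= JE.
  by move=> H j /=; rewrite JE => jn; have := H (Ordinal jn); rewrite -AE.
move=> ->; transitivity (\prod_(j <- iota 0 n) P (X j @^-1` A j))%E.
  apply: perm_big; apply: uniq_perm; [exact: fset_uniq|exact: iota_uniq|].
  by move=> j; rewrite JE mem_iota add0n.
rewrite -{1}[n]subn0 -/(index_iota 0 n) big_mkord.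
by apply: eq_bigr => k _; rewrite AE.
Qed.

Local Notation PP := (P \x P)%E.
Let mix i (q : T * T) := upd i (X i q.2) (sample q.1).

Let mmix i : measurable_fun setT (mix i).
Proof.
apply: measurable_upd.
- exact: (measurableT_comp (measurable_X i) measurable_snd).
- exact: (measurableT_comp measurable_sample measurable_fst).
Qed.

Let mPX i (A : set V) : measurable A -> measurable (X i @^-1` A).
Proof. by move=> mA; rewrite -[X in measurable X]setTI; exact: measurable_X. Qed.

(** On boxes both sides are the product of the marginal probabilities: on the right the i-th side is
    left free for the first copy of P and tested on the second. Boxes form a generating pi-system,
    so the laws agree. *)
Lemma sample_resample i (A : set (n.-tuple V)) : measurable A ->
  pushforward P sample A = pushforward PP (mix i) A.
Proof.
pose m1 : {measure set (n.-tuple V) -> \bar R} :=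
  @measure_function_pushforward__canonical__measure_function_Measure _ _ _ _ _ P _ measurable_sample.
pose m2 : {measure set (n.-tuple V) -> \bar R} :=
  @measure_function_pushforward__canonical__measure_function_Measure _ _ _ _ _ PP _ (mmix i).
have mV := @measurable_tuple_boxes _ V n measurable
  (esym (sigma_algebra_id (sigma_algebra_measurable V))) measurableT.
apply: (measure_unique (boxes measurable) (fun=> setT) mV _ _ _ m1 m2).
- by apply: boxes_setI => C D; exact: measurableI.
- move=> _; exists (fun=> setT) => //.
  by apply/seteqP; split.
- by rewrite bigcup_const//; exists 0%N.
- move=> _ [C mC ->]; rewrite /m1 /m2 /= /pushforward.
  transitivity (\prod_(k < n) P (X k @^-1` C k))%E.
    rewrite -indep_box//; congr (P _); apply/seteqP; split => w /= H k.
      by have := H k; rewrite tnth_mktuple.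
    by rewrite tnth_mktuple.
  rewrite [X in _ = _ X](_ : _ =
      [set w | forall k : 'I_n, (if k == i then setT else C k) (X k w)] `*` (X i @^-1` C i)); last first.
    apply/seteqP; split => -[w w'] /=.
      move=> H; split; last by have := H i; rewrite /mix/= tnth_mktuple eqxx.
      by move=> k; have := H k; rewrite /mix/= tnth_mktuple; case: ifP => // _; rewrite tnth_mktuple.
    move=> [H Hi] k; rewrite /mix/= tnth_mktuple; case: ifP => [/eqP ->//|ki].
    by have := H k; rewrite ki tnth_mktuple.
  have mD k : measurable (if k == i then setT else C k) by case: ifP.
  rewrite product_measure1E; last 2 first.
  - rewrite (_ : mkset _ = sample @^-1` [set t | forall k, (if k == i then setT else C k) (tnth t k)]).
      rewrite -[X in measurable X]setTI; apply: measurable_sample => //.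
      exact: (@measurable_box _ _ _ (fun k => if k == i then setT else C k)).
    by apply/seteqP; split => w /= H k; have := H k; rewrite tnth_mktuple.
  - exact: mPX.
  transitivity ((\prod_(k < n) P (X k @^-1` (if k == i then setT else C k))) * P (X i @^-1` C i))%E.
    rewrite [LHS](bigD1 i)//= [in RHS](bigD1 i)//= eqxx.
    rewrite preimage_setT probability_setT mul1e muleC; congr (_ * _)%E.
    by apply: eq_bigr => k /negbTE ->.
  by congr (_ * _)%E; exact: (esym (indep_box mD)).
- by move=> k; rewrite /m1/= /pushforward; apply: (le_lt_trans (probability_le1 _ _)); rewrite ?ltry// preimage_setT.
Qed.

(** Takes the place of conditioning on all observations but the i-th: the inner integral averages
    over that one with the others frozen. *)
Lemma resample i (F : n.-tuple V -> \bar R) :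
  measurable_fun setT F -> (forall xs, 0 <= F xs)%E ->
  (\int[P]_w F (sample w) = \int[P]_w \int[P]_w' F (upd i (X i w') (sample w)))%E.
Proof.
move=> mF F0.
transitivity (\int[pushforward P sample]_xs F xs)%E.
  by rewrite (ge0_integral_pushforward measurable_sample).
pose m1 : {measure set (n.-tuple V) -> \bar R} :=
  @measure_function_pushforward__canonical__measure_function_Measure _ _ _ _ _ P _ measurable_sample.
pose m2 : {measure set (n.-tuple V) -> \bar R} :=
  @measure_function_pushforward__canonical__measure_function_Measure _ _ _ _ _ PP _ (mmix i).
transitivity (\int[m2]_xs F xs)%E.
  apply: (@eq_measure_integral _ _ _ setT m2 m1 F) => A mA _.
  exact: (sample_resample i mA).
rewrite /m2.
rewrite (ge0_integral_pushforward (mmix i))//= preimage_setT.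
by rewrite fubini_tonelli1//; exact: (measurableT_comp mF (mmix i)).
Qed.

(** [resample] is about nonnegative functions, so it is applied to both parts of G; a zero inner
    integral says that the two parts have equal inner averages for every w. *)
Lemma resample0 i (G : n.-tuple V -> R) : measurable_fun setT G ->
  P.-integrable setT (fun w => (G (sample w))%:E) ->
  (forall w, P.-integrable setT (fun w' => (G (upd i (X i w') (sample w)))%:E)) ->
  (forall w, \int[P]_w' G (upd i (X i w') (sample w)) = 0) ->
  \int[P]_w G (sample w) = 0.
Proof.
move=> mG Gi Gw G0; apply: RintegralE.
have mE : measurable_fun setT (EFin \o G) by exact/measurable_EFinP.
have -> : (\int[P]_w (G (sample w))%:E =
   \int[P]_w (EFin \o G)^\+ (sample w) - \int[P]_w (EFin \o G)^\- (sample w))%E.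
  rewrite integralE; congr (_ - _)%E; apply: eq_integral => w _;
  by rewrite ?funeposE ?funenegE.
rewrite (resample i (measurable_funepos mE))//.
rewrite (resample i (measurable_funeneg mE))//.
have E w : (\int[P]_w' (EFin \o G)^\+ (upd i (X i w') (sample w)) =
            \int[P]_w' (EFin \o G)^\- (upd i (X i w') (sample w)))%E.
  have pE : (\int[P]_w' ((fun w' => (G (upd i (X i w') (sample w)))%:E)^\+ w') =
      \int[P]_w' (EFin \o G)^\+ (upd i (X i w') (sample w)))%E.
    by apply: eq_integral => w' _; rewrite !funeposE.
  have nE : (\int[P]_w' ((fun w' => (G (upd i (X i w') (sample w)))%:E)^\- w') =
      \int[P]_w' (EFin \o G)^\- (upd i (X i w') (sample w)))%E.
    by apply: eq_integral => w' _; rewrite !funenegE.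
  have := EFin_Rintegral (Gw w); rewrite G0 integralE => H.
  rewrite -pE -nE; apply: fin_sube_eq0 H.
    exact: integrable_pos_fin_num.
  exact: integrable_neg_fin_num.
under [X in (_ - X)%E]eq_integral do rewrite -E.
rewrite subee//.
rewrite -(resample i (measurable_funepos mE))//.
have -> : (\int[P]_w (EFin \o G)^\+ (sample w) =
    \int[P]_w ((fun w => (G (sample w))%:E)^\+ w))%E.
  by apply: eq_integral => w _; rewrite !funeposE.
exact: integrable_pos_fin_num.
Qed.

End resampling.

Lemma measurable_sum_in d (T : measurableType d) (R : realType) (I : finType)
    (S : {set I}) (f : I -> T -> R) : (forall i, measurable_fun setT (f i)) ->
  measurable_fun setT (fun x => \sum_(i in S) f i x).
Proof.
move=> mf; under eq_fun do rewrite big_mkcond/=.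
by apply: measurable_sum => i; case: (i \in S).
Qed.

Section mise.
Context {R : realType} {d : nat} dT (T : measurableType dT) (P : probability T R).
Local Notation V := (d.-tuple R).
Local Notation mu := (lebesgueRd d).
Variables (X : nat -> {RV P >-> V}) (p : V -> R) (L : R).
Hypothesis iidX : iid_with_density X p.
Hypothesis L0 : 0 < L.
Hypothesis pL : ('N[mu]_+oo[EFin \o p] <= L%:E)%E.

Let indepX : mutually_independent X. Proof. by have [] := iidX. Qed.
Let mp : measurable_fun setT p. Proof. by have [] := iidX. Qed.
Let p0 x : 0 <= p x. Proof. by have [] := iidX. Qed.
Let law i A : measurable A -> P (X i @^-1` A) = (\int[mu]_(x in A) (p x)%:E)%E.
Proof. by have [_ _ _ h] := iidX; exact: h. Qed.
Let mX i : measurable_fun setT (X i). Proof. exact: measurable_X. Qed.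

Lemma same_law_ge0 (f : V -> \bar R) i j : measurable_fun setT f -> (forall x, 0 <= f x)%E ->
  (\int[P]_w f (X i w) = \int[P]_w f (X j w))%E.
Proof.
move=> mf f0; rewrite (law_ge0 (mX i) mp p0 (@law i) mf f0).
by rewrite (law_ge0 (mX j) mp p0 (@law j) mf f0).
Qed.

Lemma same_law_Rintegral (f : V -> R) i j : measurable_fun setT f ->
  \int[P]_w f (X i w) = \int[P]_w f (X j w).
Proof.
move=> mf; have mE : measurable_fun setT (EFin \o f) by exact/measurable_EFinP.
have E k : (\int[P]_w (f (X k w))%:E = \int[P]_w (EFin \o f)^\+ (X k w) -
    \int[P]_w (EFin \o f)^\- (X k w))%E.
  by rewrite integralE; congr (_ - _)%E; apply: eq_integral => w _; rewrite ?funeposE ?funenegE.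
rewrite /Rintegral !E (same_law_ge0 i j (measurable_funepos mE))//.
by rewrite (same_law_ge0 i j (measurable_funeneg mE)).
Qed.

Section centered.
Variables (n : nat) (g : V -> R).
Hypothesis mg : measurable_fun setT g.
Hypothesis g2 : (\int[P]_w (g (X 0%N w) ^+ 2)%:E < +oo)%E.
Hypothesis g0 : \int[P]_w g (X 0%N w) = 0.

Let mgX i : measurable_fun setT (fun w => g (X i w)).
Proof. exact: (measurableT_comp mg (mX i)). Qed.

Let gX2 i : (\int[P]_w (g (X i w) ^+ 2)%:E < +oo)%E.
Proof.
rewrite (same_law_ge0 (f := fun y => (g y ^+ 2)%:E) i 0)//.
  exact: measurable_sqE.
by move=> x; rewrite lee_fin sqr_ge0.
Qed.

Let gXi i : P.-integrable setT (fun w => (g (X i w))%:E).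
Proof. exact: (integrable_of_sqr (mgX i) (gX2 i)). Qed.

Let ggXi i j : P.-integrable setT (fun w => (g (X i w) * g (X j w))%:E).
Proof.
apply: (dominated_integrableR (f := fun w => g (X i w) * g (X j w)) _
  (integrableDR (integrable_sqr (mgX i) (gX2 i)) (integrable_sqr (mgX j) (gX2 j)))).
  exact: measurable_funM.
by move=> w; rewrite ler_norml; apply/andP; split; nra.
Qed.

Let gX0 i : \int[P]_w g (X i w) = 0.
Proof. by rewrite (same_law_Rintegral i 0 mg). Qed.

Let ggX (i j : 'I_n) :
  \int[P]_w (g (X i w) * g (X j w)) = (i == j)%:R * \int[P]_w (g (X 0%N w) ^+ 2).
Proof.
have [->|ij] := eqVneq i j.
  rewrite mul1r -(same_law_Rintegral j 0 (f := fun y => g y ^+ 2)); last exact: measurable_funX.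
  by apply: eq_Rintegral => w _; rewrite expr2.
rewrite mul0r.
pose G (xs : n.-tuple V) := g (tnth xs i) * g (tnth xs j).
have GE w : G (sample X n w) = g (X i w) * g (X j w) by rewrite /G !tnth_mktuple.
have GU w y : G (upd i y (sample X n w)) = g (X j w) * g y.
  by rewrite /G !tnth_mktuple eqxx eq_sym (negbTE ij) mulrC.
under eq_Rintegral do rewrite -GE.
apply: (resample0 indepX (i := i)).
- apply: measurable_funM; exact: (measurableT_comp mg (measurable_tnth _)).
- under eq_fun do rewrite GE; exact: ggXi.
- by move=> w; under eq_fun do rewrite GU; exact: integrableZR (gXi i).
- move=> w; under eq_Rintegral do rewrite GU.
  by rewrite (RintegralZl _ measurableT (gXi i)) gX0 mulr0.
Qed.

(** With g centred and c the pointwise bias, this is squared bias plus variance for a mean of #|S|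
    observations; the cross terms vanish by resampling one of the two indices. *)
Lemma sample_mean_sqr (S : {set 'I_n}) (c : R) : (0 < #|S|)%N ->
  P.-integrable setT (fun w => ((#|S|%:R^-1 * (\sum_(i in S) g (X i w)) + c) ^+ 2)%:E) /\
  \int[P]_w ((#|S|%:R^-1 * (\sum_(i in S) g (X i w)) + c) ^+ 2) =
  c ^+ 2 + #|S|%:R^-1 * \int[P]_w (g (X 0%N w) ^+ 2).
Proof.
move=> S0; set s := #|S|%:R^-1.
have sum2i : P.-integrable setT (fun w => (\sum_(i in S) \sum_(j in S) g (X i w) * g (X j w))%:E).
  apply: (integrable_sumR (f := fun (i : 'I_n) w => \sum_(j in S) g (X i w) * g (X j w))) => i.
  exact: (integrable_sumR (f := fun (j : 'I_n) w => g (X i w) * g (X j w)) (fun j => ggXi i j)).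
have sum1i : P.-integrable setT (fun w => (\sum_(i in S) g (X i w))%:E).
  exact: (integrable_sumR (f := fun (i : 'I_n) w => g (X i w)) (fun i => gXi i)).
have i1 := integrableZR (s ^+ 2) sum2i.
have i2 := integrableZR (2 * s * c) sum1i.
have i3 := integrable_cstP P (c ^+ 2).
have i12 := integrableDR i1 i2; have i123 := integrableDR i12 i3.
have E w : (s * (\sum_(i in S) g (X i w)) + c) ^+ 2 =
   s ^+ 2 * (\sum_(i in S) \sum_(j in S) g (X i w) * g (X j w)) +
   2 * s * c * (\sum_(i in S) g (X i w)) + c ^+ 2.
  by rewrite -big_distrlr/=; ring.
split; first by under eq_fun do rewrite E; exact: i123.
under eq_Rintegral do rewrite E.
rewrite RintegralD; [|exact: measurableT|exact: i12|exact: i3].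
rewrite RintegralD; [|exact: measurableT|exact: i1|exact: i2].
rewrite (RintegralZl _ measurableT sum2i) (RintegralZl _ measurableT sum1i) Rintegral_cstP.
rewrite (Rintegral_sumR (f := fun (i : 'I_n) w => g (X i w)) (fun i => gXi i)).
rewrite [X in _ * _ + _ * X]big1 ?mulr0 ?addr0; last by move=> i _; exact: gX0.
rewrite addrC; congr (_ + _).
rewrite (Rintegral_sumR (f := fun (i : 'I_n) w => \sum_(j in S) g (X i w) * g (X j w))); last first.
  by move=> i; exact: (integrable_sumR (f := fun (j : 'I_n) w => g (X i w) * g (X j w)) (fun j => ggXi i j)).
transitivity (s ^+ 2 * \sum_(i in S) \int[P]_w (g (X 0%N w) ^+ 2)).
  congr (_ * _); apply: eq_bigr => i iS.
  rewrite (Rintegral_sumR (f := fun (j : 'I_n) w => g (X i w) * g (X j w)) (fun j => ggXi i j)).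
  rewrite (bigD1 i)//= ggX eqxx mul1r big1 ?addr0// => j /andP[_ ji].
  by rewrite ggX eq_sym (negbTE ji) mul0r.
move: (\int[P]_w (g (X 0%N w) ^+ 2)) => v.
rewrite sumr_const -mulr_natl expr2 -mulrA; congr (_ * _).
by rewrite mulrA mulVf ?mul1r// pnatr_eq0 -lt0n.
Qed.

End centered.

Variable K : V -> R.
Hypothesis mK : measurable_fun setT K.
Hypothesis K2 : (sqnorm mu K < +oo)%E.

Lemma kernel_estimatorE n (S : {set 'I_n}) h w x : h != 0 -> (0 < #|S|)%N ->
  kernel_estimator K S h (sample X n w) x - p x =
  #|S|%:R^-1 * (\sum_(i in S) (h ^- d * K (kern_arg h (X i w) x) - smooth P (X 0%N) h K x)) +
  (smooth P (X 0%N) h K x - p x).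
Proof.
move=> h0 S0; have s0 : #|S|%:R != 0 :> R by rewrite pnatr_eq0 -lt0n.
rewrite big_split/= sumr_const -mulr_sumr /kernel_estimator.
have -> : \sum_(i in S) K [tuple (tnth (tnth (sample X n w) i) k - tnth x k) / h | k < d] =
   \sum_(i in S) K (kern_arg h (X i w) x).
  by apply: eq_bigr => i _; rewrite tnth_mktuple.
rewrite -mulr_natl; field.
by rewrite s0 expf_neq0.
Qed.

(** Pointwise squared bias plus variance, then Tonelli in x. The negative term is moved to the left
    so that nothing is subtracted in [\bar R]. Training subsamples and the full sample are covered
    alike, since S enters only through its size. *)
Lemma risk_kernel n (S : {set 'I_n}) h : 0 < h -> (0 < #|S|)%N ->
  (risk X p (kernel_estimator K S h) + (#|S|%:R^-1)%:E * sqnorm mu (smooth P (X 0%N) h K) =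
   bias P (X 0%N) p h K + (#|S|%:R^-1 * h ^- d)%:E * sqnorm mu K)%E.
Proof.
move=> h0 S0; set s := #|S|%:R^-1; set Y := X 0%N.
have hn0 : h != 0 by rewrite gt_eqF.
have s0 : 0 <= s by rewrite invr_ge0.
have hd0 : 0 < h ^+ d by rewrite exprn_gt0.
pose b := smooth P Y h K.
have mb : measurable_fun setT b by exact: measurable_smooth.
pose D (w : T) x := s * (\sum_(i in S) (h ^- d * K (kern_arg h (X i w) x) - b x)) + (b x - p x).
have DE w x : kernel_estimator K S h (sample X n w) x - p x = D w x.
  by rewrite kernel_estimatorE.
have mD : measurable_fun setT (fun q : T * V => D q.1 q.2).
  apply: measurable_funD; last first.
    by apply: measurable_funB; [exact: (measurableT_comp mb measurable_snd)|exact: (measurableT_comp mp measurable_snd)].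
  apply: measurable_funM => //; apply: measurable_sum_in => i.
  apply: measurable_funB; last exact: (measurableT_comp mb measurable_snd).
  apply: measurable_funM => //; apply: (measurableT_comp mK).
  by apply: measurable_kern_arg; [exact: (measurableT_comp (mX i) measurable_fst)|exact: measurable_snd].
(* Second moment of one summand; by [kern_tonelli] its integral in x is h^-d ||K||^2. *)
pose k2 x := h ^- d ^+ 2 * \int[P]_w (K (kern_arg h (Y w) x) ^+ 2).
have Kk x := measurable_kern (mX 0) h mK x.
have K2k x := kern_sqr_lty (mX 0) mp p0 (@law 0%N) L0 pL h0 mK K2 x.
have inner x : (\int[P]_w (D w x ^+ 2)%:E =
    ((b x - p x) ^+ 2 + s * (k2 x - b x ^+ 2))%:E)%E.
  pose f w := h ^- d * K (kern_arg h (Y w) x).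
  have mf : measurable_fun setT f by exact: measurable_funM.
  have iKk2 := integrable_sqr (Kk x) (K2k x).
  have f2E : \int[P]_w (f w ^+ 2) = k2 x.
    rewrite /k2 -(RintegralZl _ measurableT iKk2).
    by apply: eq_Rintegral => w _; rewrite exprMn.
  have f2 : (\int[P]_w (f w ^+ 2)%:E < +oo)%E.
    have -> : (\int[P]_w (f w ^+ 2)%:E = \int[P]_w (h ^- d ^+ 2 * K (kern_arg h (Y w) x) ^+ 2)%:E)%E.
      by apply: eq_integral => w _; rewrite exprMn.
    by rewrite (EFin_Rintegral (integrableZR _ iKk2)) ltry.
  have fb : \int[P]_w f w = b x.
    by rewrite (RintegralZl _ measurableT (integrable_of_sqr (Kk x) (K2k x))).
  pose g y := h ^- d * K (kern_arg h y x) - b x.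
  have mg : measurable_fun setT g.
    apply: measurable_funB => //; apply: measurable_funM => //.
    by apply: (measurableT_comp mK); exact: measurable_kern_arg.
  have g2E := Rintegral_sqr_sub mf f2 (b x).
  have g2i : P.-integrable setT (fun w => (g (X 0%N w) ^+ 2)%:E).
    have i1 := integrable_sqr mf f2.
    have i2 := integrableZR (- 2 * b x) (integrable_of_sqr mf f2).
    have i3 := integrable_cstP P (b x ^+ 2).
    apply: (@eq_integrable _ _ _ P setT measurableT
      (fun w => (f w ^+ 2 + - 2 * b x * f w + b x ^+ 2)%:E) _ _
      (integrableDR (integrableDR i1 i2) i3)) => w _.
    by congr EFin; rewrite /g -/(f w); ring.
  have g2 : (\int[P]_w (g (X 0%N w) ^+ 2)%:E < +oo)%E by rewrite (EFin_Rintegral g2i) ltry.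
  have g0 : \int[P]_w g (X 0%N w) = 0.
    have if_ := integrable_of_sqr mf f2.
    have -> : \int[P]_w g (X 0%N w) = \int[P]_w f w - \int[P]_w (b x).
      by rewrite -RintegralB; [|exact: measurableT|exact: if_|exact: integrable_cstP].
    by rewrite Rintegral_cstP fb subrr.
  have [i E] := sample_mean_sqr mg g2 g0 (b x - p x) S0.
  rewrite (EFin_Rintegral i) E; congr (_ + s * _)%:E.
  by rewrite g2E f2E fb; ring.
have riskE : (risk X p (kernel_estimator K S h) =
   \int[mu]_x ((b x - p x) ^+ 2 + s * (k2 x - b x ^+ 2))%:E)%E.
  transitivity (\int[P]_w \int[mu]_x (D w x ^+ 2)%:E)%E.
    apply: eq_integral => w _; rewrite L2norm_sqr; apply: eq_integral => x _.
    by rewrite -DE.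
  rewrite (fubini_tonelli (fun q : T * V => (D q.1 q.2 ^+ 2)%:E)).
  - by apply: eq_integral => x _; exact: inner.
  - exact: measurable_sqE.
  - by move=> q; rewrite lee_fin sqr_ge0.
have mk2 : measurable_fun setT k2.
  apply: measurable_funM => //.
  apply: (measurable_Rintegral_param P (F := fun w x => K (kern_arg h (Y w) x) ^+ 2)).
  apply: measurable_funX; apply: (measurableT_comp mK).
  by apply: measurable_kern_arg; [exact: (measurableT_comp (mX 0) measurable_fst)|exact: measurable_snd].
have k2b x : b x ^+ 2 <= k2 x.
  rewrite /b /smooth exprMn /k2 ler_wpM2l ?sqr_ge0//.
  exact: (sqr_Rintegral_le (Kk x) (K2k x)).
have mbp : measurable_fun setT (fun x => (b x - p x) ^+ 2).
  by apply: measurable_funX; exact: measurable_funB.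
have mb2 : measurable_fun setT (fun x => b x ^+ 2) by exact: measurable_funX.
have -> : (s%:E * sqnorm mu b = \int[mu]_x (s * b x ^+ 2)%:E)%E.
  rewrite /sqnorm -ge0_integralZl//.
  - exact/measurable_EFinP.
  - by move=> x _; rewrite lee_fin sqr_ge0.
have -> : ((s * h ^- d)%:E * sqnorm mu K = \int[mu]_x (s * k2 x)%:E)%E.
  have := kern_tonelli P (mX 0) h0 (measurable_sqE mK) (fun x => sqr_ge0 _).
  rewrite -/Y => kt.
  transitivity (\int[mu]_x ((s * h ^- d ^+ 2)%:E * \int[P]_w (K (kern_arg h (Y w) x) ^+ 2)%:E))%E.
    rewrite ge0_integralZl//; last 3 first.
    - apply: (measurable_fun_fubini_tonelli_G (m1 := P) (fun q : T * V => (K (kern_arg h (Y q.1) q.2) ^+ 2)%:E)).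
        apply: measurable_sqE; apply: (measurableT_comp mK).
        by apply: measurable_kern_arg; [exact: (measurableT_comp (mX 0) measurable_fst)|exact: measurable_snd].
      by move=> q; rewrite lee_fin sqr_ge0.
    - by move=> x _; apply: integral_ge0 => w _; rewrite lee_fin sqr_ge0.
    - by rewrite lee_fin mulr_ge0 ?sqr_ge0.
    rewrite kt muleA -EFinM; congr (_%:E * _)%E.
    by field; rewrite gt_eqF.
  apply: eq_integral => x _.
  rewrite (EFin_Rintegral (integrable_sqr (Kk x) (K2k x))) -EFinM; congr EFin.
  by rewrite /k2; ring.
rewrite riskE /bias /sqnorm -/b -!ge0_integralD//=.
- by apply: eq_integral => x _; rewrite -!EFinD; congr EFin; ring.
- by move=> x _; rewrite lee_fin sqr_ge0.
- exact/measurable_EFinP.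
- by move=> x _; rewrite lee_fin mulr_ge0// (le_trans _ (k2b x))// sqr_ge0.
- by apply/measurable_EFinP; exact: measurable_funM.
- by move=> x _; rewrite lee_fin addr_ge0 ?sqr_ge0// mulr_ge0// subr_ge0.
- apply/measurable_EFinP; apply: measurable_funD => //.
  by apply: measurable_funM => //; exact: measurable_funB.
- by move=> x _; rewrite lee_fin mulr_ge0// sqr_ge0.
- by apply/measurable_EFinP; exact: measurable_funM.
Qed.

End mise.

(** * Excess risk of aggregates *)

Section regularized_gram.
Context {R : realFieldType} {M : nat}.
Implicit Types (G : 'M[R]_M) (x z c : 'cV[R]_M).

Definition qform G x : R := (x^T *m G *m x) ord0 ord0.

Lemma qformE G x : qform G x = \sum_i \sum_j G i j * (x i ord0 * x j ord0).
Proof.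
rewrite /qform -mulmxA mxE; apply: eq_bigr => i _; rewrite !mxE mulr_sumr.
by apply: eq_bigr => j _; ring.
Qed.

Lemma mx11_tr (A : 'M[R]_1) : A^T = A.
Proof. by apply/matrixP => i j; rewrite mxE !ord1. Qed.

Variables (G : 'M[R]_M) (e : R).
Hypothesis Gsym : G^T = G.
Hypothesis Gpos : forall x, 0 <= qform G x.
Hypothesis e0 : 0 < e.

Definition rgram : 'M[R]_M := G + e%:M.

Lemma qform_rgram x : qform rgram x = qform G x + e * (x^T *m x) ord0 ord0.
Proof.
rewrite /qform /rgram mulmxDr mulmxDl mxE; congr (_ + _).
by rewrite mul_mx_scalar -scalemxAl mxE.
Qed.

Lemma sqr_col_ge0 x : 0 <= (x^T *m x) ord0 ord0.
Proof. by rewrite mxE; apply: sumr_ge0 => i _; rewrite mxE -expr2 sqr_ge0. Qed.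

Lemma sqr_col_eq0 x : (x^T *m x) ord0 ord0 = 0 -> x = 0.
Proof.
rewrite mxE => /psumr_eq0P H; apply/matrixP => i j; rewrite ord1 mxE.
have /eqP : x^T ord0 i * x i ord0 = 0.
  by apply: H => // k _; rewrite mxE -expr2 sqr_ge0.
by rewrite mxE -expr2 sqrf_eq0 => /eqP.
Qed.

Lemma qform_rgram_ge0 x : 0 <= qform rgram x.
Proof. by rewrite qform_rgram addr_ge0// mulr_ge0 ?sqr_col_ge0// ltW. Qed.

Lemma rgram_sym : rgram^T = rgram.
Proof. by rewrite /rgram linearD/= Gsym tr_scalar_mx. Qed.

Lemma rgram_unit : rgram \in unitmx.
Proof.
rewrite -row_free_unit -kermx_eq0; apply/negPn/negP => /rowV0Pn[v /sub_kermxP vA v0].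
have : qform rgram v^T = 0 by rewrite /qform trmxK vA mul0mx mxE.
rewrite qform_rgram => /eqP; rewrite paddr_eq0 ?Gpos//; last first.
  by rewrite mulr_ge0 ?sqr_col_ge0// ltW.
move=> /andP[_]; rewrite mulf_eq0 gt_eqF//= => /eqP /sqr_col_eq0 /(congr1 trmx).
by rewrite trmxK trmx0 => v00; rewrite v00 eqxx in v0.
Qed.

Local Notation B := (invmx rgram).

Lemma invmx_rgram_sym : B^T = B.
Proof. by rewrite trmx_inv rgram_sym. Qed.

Lemma qform_inv_ge0 x : 0 <= qform B x.
Proof.
have -> : qform B x = qform rgram (B *m x).
  rewrite /qform trmx_mul invmx_rgram_sym -!mulmxA (mulmxA rgram) mulmxV ?rgram_unit//.
  by rewrite mul1mx.
exact: qform_rgram_ge0.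
Qed.

(** Complete the square: [qform rgram] is nonnegative at c - B z. Equality holds at c = B z, so the
    right side is the exact supremum of the ridge problem. *)
Lemma regularized_sup z c :
  2 * (z^T *m c) ord0 ord0 - qform G c - e * (c^T *m c) ord0 ord0 <= qform B z.
Proof.
have := qform_rgram_ge0 (c - B *m z).
have BA : B *m rgram = 1%:M by rewrite mulVmx// rgram_unit.
have AB : rgram *m B = 1%:M by rewrite mulmxV// rgram_unit.
have zc : (c^T *m z) ord0 ord0 = (z^T *m c) ord0 ord0.
  by rewrite -(mx11_tr (c^T *m z)) trmx_mul trmxK.
have -> : qform rgram (c - B *m z) = qform rgram c - 2 * (z^T *m c) ord0 ord0 + qform B z.
  rewrite {1}/qform [(c - _)^T]linearB/= trmx_mul invmx_rgram_sym.
  rewrite mulmxBr !mulmxBl -[z^T *m B *m rgram]mulmxA BA mulmx1.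
  rewrite -[c^T *m rgram *m (B *m z)]mulmxA (mulmxA rgram) AB mul1mx mulmxA.
  have x4 (a b c' d' : 'M[R]_1) : (a - b - (c' - d')) ord0 ord0 =
    a ord0 ord0 - b ord0 ord0 - (c' ord0 ord0 - d' ord0 ord0) by rewrite !mxE.
  rewrite x4 zc -/(qform rgram c) -/(qform B z); ring.
rewrite qform_rgram; lra.
Qed.

(** B G = 1 - e B, and B has a nonnegative diagonal because it is positive semidefinite. The trace
    is the effective dimension of the family, at most M even when G is singular. *)
Lemma trace_inv_gram : \sum_i \sum_j B i j * G i j <= M%:R.
Proof.
have -> : \sum_i \sum_j B i j * G i j = \tr (B *m G).
  rewrite /mxtrace; apply: eq_bigr => i _; rewrite mxE; apply: eq_bigr => j _.
  by rewrite -{1}Gsym mxE.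
have -> : B *m G = 1%:M - e *: B.
  have -> : G = rgram - e%:M by rewrite /rgram addrK.
  by rewrite mulmxBr mulVmx ?rgram_unit// mul_mx_scalar.
rewrite linearB/= mxtrace1 linearZ/= gerBl; apply: mulr_ge0; first exact: ltW.
rewrite /mxtrace; apply: sumr_ge0 => i _.
have := qform_inv_ge0 (delta_mx i ord0).
by rewrite /qform trmx_delta -rowE -colE !mxE.
Qed.

(** Expand the nonnegative form at x + z and x - z. The bound lets diagonal terms dominate
    off-diagonal ones where integrability is needed. *)
Lemma bilinear_bound x z : `|(x^T *m B *m z) ord0 ord0| <= (qform B x + qform B z) / 2.
Proof.
have zx : (z^T *m B *m x) ord0 ord0 = (x^T *m B *m z) ord0 ord0.
  by rewrite -(mx11_tr (z^T *m B *m x)) !trmx_mul trmxK invmx_rgram_sym mulmxA.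
have E s : qform B (x + s *: z) = qform B x + 2 * s * (x^T *m B *m z) ord0 ord0 + s ^+ 2 * qform B z.
  rewrite {1}/qform [(x + _)^T]linearD/= [(s *: z)^T]linearZ/=.
  rewrite !mulmxDl !mulmxDr -!scalemxAl -!scalemxAr.
  have x4 (a b c' d' : 'M[R]_1) : (a + s *: b + (s *: c' + s *: (s *: d'))) ord0 ord0 =
    a ord0 ord0 + s * b ord0 ord0 + (s * c' ord0 ord0 + s * (s * d' ord0 ord0)) by rewrite !mxE.
  rewrite x4 zx -/(qform B x) -/(qform B z); ring.
have := qform_inv_ge0 (x + 1 *: z); have := qform_inv_ge0 (x + (-1) *: z).
rewrite !E ler_norml => h1 h2; apply/andP; split; lra.
Qed.

End regularized_gram.

Section measurable_matrix.
Context dS (S : measurableType dS) {R : realType}.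

Lemma measurable_det m (A : S -> 'M[R]_m) :
  (forall i j, measurable_fun setT (fun s => A s i j)) ->
  measurable_fun setT (fun s => \det (A s)).
Proof.
move=> mA; rewrite /determinant; apply: measurable_sum => s.
by apply: measurable_funM => //; apply: measurable_prod => i _.
Qed.

(** Written as f times (f^2)^-1, so that the real power has a nonnegative base; at f = 0 both sides
    are 0. *)
Lemma measurable_funVr (f : S -> R) : measurable_fun setT f ->
  measurable_fun setT (fun s => (f s)^-1).
Proof.
move=> mf; rewrite (_ : (fun s => _) = (fun s => f s * ((f s ^+ 2) `^ (-1)))).
  apply: measurable_funM => //.
  apply: (measurableT_comp (measurable_powR _)); exact: measurable_funX.
apply/funext => s; rewrite powR_inv1 ?sqr_ge0//.
by have [->|f0] := eqVneq (f s) 0; [rewrite invr0 mul0r|field].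
Qed.

Lemma measurable_invmx m (A : S -> 'M[R]_m) :
  (forall s, A s \in unitmx) ->
  (forall i j, measurable_fun setT (fun s => A s i j)) ->
  forall i j, measurable_fun setT (fun s => invmx (A s) i j).
Proof.
move=> uA mA i j.
rewrite (_ : (fun s => _) = (fun s => (\det (A s))^-1 * ((-1) ^+ (j + i) * \det (row' j (col' i (A s)))))).
  apply: measurable_funM; first by apply: measurable_funVr; exact: measurable_det.
  apply: measurable_funM => //; apply: measurable_det => k l.
  by under eq_fun do rewrite mxE mxE; exact: mA.
by apply/funext => s; rewrite /invmx uA !mxE.
Qed.

End measurable_matrix.

Section L2_inner_product.
Context {R : realType} {d : nat}.
Local Notation V := (d.-tuple R).
Local Notation mu := (lebesgueRd d).
Implicit Types (f g : V -> R).

Definition L2f (f : V -> R) : Prop :=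
  measurable_fun setT f /\ (sqnorm mu f < +oo)%E.

Lemma L2f_sqi f : L2f f -> mu.-integrable setT (fun x => (f x ^+ 2)%:E).
Proof.
move=> [mf f2]; apply: ge0_integrable => //; first exact: measurable_funX.
by move=> x; exact: sqr_ge0.
Qed.

Lemma L2dot_integrable f g : L2f f -> L2f g ->
  mu.-integrable setT (fun x => (f x * g x)%:E).
Proof.
move=> Lf Lg; have [mf _] := Lf; have [mg _] := Lg.
apply: (dominated_integrableR (f := fun x => f x * g x) _
  (integrableDR (L2f_sqi Lf) (L2f_sqi Lg))); first exact: measurable_funM.
by move=> x; rewrite ler_norml; apply/andP; split; nra.
Qed.

Lemma L2dotC f g : L2dot f g = L2dot g f.
Proof. by apply: eq_Rintegral => x _; rewrite mulrC. Qed.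

Lemma L2dotBl f g h : L2f f -> L2f g -> L2f h ->
  L2dot (fun x => f x - g x) h = L2dot f h - L2dot g h.
Proof.
move=> Lf Lg Lh; rewrite /L2dot -RintegralB; [|exact: measurableT| |]; last 2 first.
- exact: L2dot_integrable Lf Lh.
- exact: L2dot_integrable Lg Lh.
by apply: eq_Rintegral => x _; rewrite mulrBl.
Qed.

Lemma L2dotBr f g h : L2f f -> L2f g -> L2f h ->
  L2dot h (fun x => f x - g x) = L2dot h f - L2dot h g.
Proof. by move=> Lf Lg Lh; rewrite L2dotC L2dotBl// !(L2dotC h). Qed.

Lemma L2f_B f g : L2f f -> L2f g -> L2f (fun x => f x - g x).
Proof.
move=> [mf f2] [mg g2]; split; first exact: measurable_funB.
apply: (le_lt_trans (sqnormD_le (f := f) (g := fun x => - g x) mu _ _)) => //.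
  exact: measurableT_comp.
by rewrite sqnormN lte_add_pinfty// lte_mul_pinfty// ?sqnorm_ge0 ?lee_fin.
Qed.

Lemma L2f_Z f a : L2f f -> L2f (fun x => a * f x).
Proof.
move=> [mf f2]; split; first exact: measurable_funM.
by rewrite sqnormZ// lte_mul_pinfty ?sqnorm_ge0 ?lee_fin ?sqr_ge0.
Qed.

Lemma L2f_0 : L2f (fun=> 0).
Proof.
split=> //; rewrite /sqnorm.
under eq_integral do rewrite expr0n/=.
by rewrite integral0.
Qed.

Lemma L2f_sum (I : Type) (s : seq I) (f : I -> V -> R) :
  (forall i, L2f (f i)) -> L2f (fun x => \sum_(i <- s) f i x).
Proof.
move=> Lf; elim: s => [|i s IH].
  by under [X in L2f X]funext do rewrite big_nil; exact: L2f_0.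
under [X in L2f X]funext do rewrite big_cons.
have := L2f_B (Lf i) (L2f_Z (-1) IH).
by congr L2f; apply/funext => x; rewrite mulN1r opprK.
Qed.

Lemma L2f_lincomb M (f : 'I_M -> V -> R) c : (forall j, L2f (f j)) -> L2f (lincomb f c).
Proof. by move=> Lf; apply: L2f_sum => j; exact: L2f_Z. Qed.

Lemma L2dot_lincombl M (f : 'I_M -> V -> R) c g : (forall j, L2f (f j)) -> L2f g ->
  L2dot (lincomb f c) g = \sum_j c j * L2dot (f j) g.
Proof.
move=> Lf Lg; have ij j := L2dot_integrable (Lf j) Lg.
transitivity (\int[mu]_x \sum_j c j * (f j x * g x)).
  by apply: eq_Rintegral => x _; rewrite /lincomb mulr_suml; apply: eq_bigr => j _; rewrite mulrA.
rewrite (Rintegral_sumR (f := fun j x => c j * (f j x * g x)) (fun j => integrableZR (c j) (ij j))).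
by apply: eq_bigr => j _; rewrite (RintegralZl _ measurableT (ij j)).
Qed.

Lemma L2dot_lincombr M (f : 'I_M -> V -> R) c g : (forall j, L2f (f j)) -> L2f g ->
  L2dot g (lincomb f c) = \sum_j c j * L2dot g (f j).
Proof.
move=> Lf Lg; rewrite L2dotC L2dot_lincombl//.
by apply: eq_bigr => j _; rewrite L2dotC.
Qed.

Lemma sqnorm_L2dot f : L2f f -> sqnorm mu f = (L2dot f f)%:E.
Proof.
move=> Lf; rewrite /sqnorm (EFin_Rintegral (L2f_sqi Lf)); congr EFin.
Qed.

Lemma L2dot_ge0 f : 0 <= L2dot f f.
Proof. by apply: Rintegral_ge0 => x _; rewrite -expr2 sqr_ge0. Qed.

Lemma fine_L2norm_sqr f : L2f f -> fine (L2norm f) ^+ 2 = L2dot f f.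
Proof.
move=> Lf; have : (L2norm f ^+ 2 = (L2dot f f)%:E)%E by rewrite L2norm_sqr sqnorm_L2dot.
have : (0 <= L2norm f)%E by exact: Lnorm_ge0.
by case: (L2norm f) => [r| |]//; rewrite -EFin_expe => _ [].
Qed.

Lemma ae_sqnorm f g : f = g %[ae mu] -> L2f f -> L2f g -> sqnorm mu f = sqnorm mu g.
Proof.
move=> fg [mf _] [mg _]; apply: ae_eq_integral => //; try exact: measurable_sqE.
by apply: filterS fg => x fgx _; rewrite fgx.
Qed.

(** Here u is the aggregate, v the competitor and m the validation mean of q = u - v. The identity
    ||u - p||^2 = ||v - p||^2 + 2 <u, q> - 2 <q, p> - ||q||^2 turns the first-order inequality into
    an excess with a negative quadratic term, which makes a supremum over all q usable. *)
Lemma excess_of_gradient u v p m : L2f u -> L2f v -> L2f p ->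
  let q := fun x => u x - v x in L2dot u q <= m ->
  (sqnorm mu (fun x => u x - p x)%R <=
   sqnorm mu (fun x => v x - p x)%R + (2 * (m - L2dot q p) - L2dot q q)%:E)%E.
Proof.
move=> Lu Lv Lp q; have Lq : L2f q by exact: L2f_B.
rewrite !sqnorm_L2dot; try exact: L2f_B.
rewrite -EFinD lee_fin /q !L2dotBl ?L2dotBr//; try exact: L2f_B.
rewrite (L2dotC p u) (L2dotC p v) (L2dotC v u); lra.
Qed.

End L2_inner_product.

(** * Deterministic excess loss of both aggregates *)

Section aggregates.
Context {R : realType} {d M n : nat}.
Local Notation V := (d.-tuple R).
Local Notation mu := (lebesgueRd d).
Variables (f : 'I_M -> V -> R) (p : V -> R) (ys : n.-tuple V) (W : {set 'I_n}).
Hypothesis Lf : forall j, L2f (f j).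
Hypothesis Lp : L2f p.

Lemma sample_mean_lincomb k (h : 'I_k -> V -> R) c :
  sample_mean ys W (lincomb h c) = \sum_j c j * sample_mean ys W (h j).
Proof.
rewrite /sample_mean /lincomb exchange_big/= mulr_sumr; apply: eq_bigr => j _.
by rewrite -mulr_sumr mulrCA.
Qed.

Lemma lincombB k (h : 'I_k -> V -> R) c c' :
  (fun x => lincomb h c x - lincomb h c' x) = lincomb h (fun j => c j - c' j).
Proof.
by apply/funext => x; rewrite /lincomb -sumrB; apply: eq_bigr => j _; rewrite mulrBl.
Qed.

Lemma lincomb_delta k (h : 'I_k -> V -> R) j0 : lincomb h (fun j => (j == j0)%:R) = h j0.
Proof.
apply/funext => x; rewrite /lincomb (bigD1 j0)//= eqxx mul1r big1 ?addr0// => j /negbTE ->.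
by rewrite mul0r.
Qed.

Lemma lincomb_comp k (h : 'I_k -> V -> R) (C : 'I_k -> 'I_M -> R) (a : 'I_k -> R) :
  (forall j, h j = lincomb f (C j)) ->
  lincomb h a = lincomb f (fun i => \sum_j a j * C j i).
Proof.
move=> hC; apply/funext => x; rewrite /lincomb.
under eq_bigr do rewrite hC /lincomb mulr_sumr.
rewrite exchange_big/=; apply: eq_bigr => i _.
by rewrite mulr_suml; apply: eq_bigr => j _; rewrite mulrA.
Qed.

(** The coefficients c are left unspecified and may depend on the data in any way, since the
    stochastic bound that follows holds for all c at once. *)
Let excess_bound g j0 := exists c : 'I_M -> R, let q := lincomb f c in
  (sqnorm mu (fun x => g x - p x)%R <= sqnorm mu (fun x => f j0 x - p x)%R +
   (2 * (sample_mean ys W q - L2dot q p) - L2dot q q)%:E)%E.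

(** Moving from the minimiser l a fraction t towards the vertex j0 stays in Lambda^M; comparing the
    criteria, dividing by t and letting t tend to 0 gives the first-order inequality required by
    [excess_of_gradient]. *)
Let convex_excess g j0 : is_convex_aggregate f ys W g -> L2f g /\ excess_bound g j0.
Proof.
move=> [l [[l0 l1] lmin ->]]; split; first exact: L2f_lincomb.
pose c := fun j => l j - (j == j0)%:R.
pose u := lincomb f l; pose q := lincomb f c.
have Lu : L2f u by exact: L2f_lincomb.
have Lq : L2f q by exact: L2f_lincomb.
have qE : q = (fun x => u x - f j0 x).
  by rewrite /q /c -lincombB lincomb_delta.
exists c => /=; rewrite -/q qE; apply: excess_of_gradient => //; rewrite -qE.
have key (t : R) : 0 < t <= 1 -> L2dot u q - t / 2 * L2dot q q <= sample_mean ys W q.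
  move=> /andP[t0 t1]; pose lt_ j := l j - t * c j.
  have ltL : in_Lambda lt_.
    split.
      move=> j; rewrite /lt_ /c (_ : _ - _ = (1 - t) * l j + t * (j == j0)%:R); last by ring.
      by rewrite addr_ge0// mulr_ge0// ?subr_ge0// ltW.
    rewrite /lt_ sumrB -mulr_sumr /c sumrB.
    have -> : \sum_j ((j == j0)%:R : R) = 1.
      by rewrite (bigD1 j0)//= eqxx big1 ?addr0// => j /negbTE ->.
    nra.
  have := lmin _ ltL; rewrite /convex_criterion.
  rewrite !fine_L2norm_sqr; [|exact: L2f_lincomb|exact: L2f_lincomb].
  have -> : lincomb f lt_ = (fun x => u x - lincomb f (fun j => t * c j) x).
    by rewrite lincombB.
  have tqE : lincomb f (fun j => t * c j) = (fun x => t * q x).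
    apply/funext => x; rewrite /q /lincomb mulr_sumr.
    by apply: eq_bigr => j _; rewrite mulrA.
  rewrite tqE -/u.
  have Ltq : L2f (fun x => t * q x) by exact: L2f_Z.
  have Zl h : L2f h -> L2dot (fun x => t * q x) h = t * L2dot q h.
    move=> Lh; rewrite -(RintegralZl _ measurableT (L2dot_integrable Lq Lh)).
    by apply: eq_Rintegral => x _; rewrite mulrA.
  have mB : sample_mean ys W (fun x => u x - t * q x) = sample_mean ys W u - t * sample_mean ys W q.
    rewrite /sample_mean sumrB -mulr_sumr; ring.
  rewrite mB L2dotBl ?L2dotBr//; try exact: L2f_B.
  rewrite (L2dotC u) !Zl// (L2dotC q (fun x => t * q x)) !Zl// (L2dotC q u) => H.
  have {}H : 0 <= t * (2 * sample_mean ys W q - 2 * L2dot u q + t * L2dot q q) by nra.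
  rewrite pmulr_rge0// in H; lra.
rewrite leNgt; apply/negP => lt_mq.
pose D := L2dot u q - sample_mean ys W q; have D0 : 0 < D by rewrite subr_gt0.
have q0 := L2dot_ge0 q.
(* The limit t -> 0 is replaced by one t small enough to contradict a gap D. *)
pose t := Num.min 1 (D / (L2dot q q + 1)).
have q1 : 0 < L2dot q q + 1 by rewrite ltr_wpDl.
have t0 : 0 < t by rewrite lt_min ltr01 divr_gt0.
have t1 : t <= 1 by rewrite ge_min lexx.
have tD : t <= D / (L2dot q q + 1) by rewrite ge_min lexx orbT.
have := key t; rewrite t0 t1 => /(_ isT).
have : t * (L2dot q q + 1) <= D by rewrite -ler_pdivlMr.
rewrite /D; nra.
Qed.

(** The first-order relation is an equality: by orthonormality <u, phi_j> is the validation mean of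
    phi_j. The competitor is expanded in the basis only almost everywhere, which suffices for norms,
    while q is rewritten in terms of f so that the bound no longer sees the basis or its size. *)
Let linear_excess g j0 : is_linear_aggregate f ys W g -> L2f g /\ excess_bound g j0.
Proof.
move=> [r [phi [[phif orth fphi] ->]]].
have /choice[C hC] := phif.
have Lphi j : L2f (phi j) by rewrite hC; exact: L2f_lincomb.
pose m j := sample_mean ys W (phi j).
have [b fb] := fphi j0.
pose u := lincomb phi m; pose v := lincomb phi b.
have Lu : L2f u by exact: L2f_lincomb.
have Lv : L2f v by exact: L2f_lincomb.
split=> //.
pose q := lincomb phi (fun j => m j - b j).
have qE : q = (fun x => u x - v x) by rewrite /q -lincombB.
exists (fun i => \sum_j (m j - b j) * C j i) => /=.
rewrite -(lincomb_comp _ hC) -/q.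
have -> : sqnorm mu (fun x => f j0 x - p x) = sqnorm mu (fun x => v x - p x).
  apply: ae_sqnorm; [|exact: L2f_B|exact: L2f_B].
  by apply: filterS fb => x h _; rewrite /v h.
rewrite qE; apply: excess_of_gradient => //; rewrite -qE.
rewrite sample_mean_lincomb /q L2dot_lincombr// le_eqVlt; apply/orP; left; apply/eqP.
apply: eq_bigr => j _; congr (_ * _); rewrite /u L2dot_lincombl//.
by rewrite (bigD1 j)//= orth eqxx mulr1 big1 ?addr0// => k /negbTE kj; rewrite orth kj mulr0.
Qed.

Lemma aggregate_excess kind g j0 : is_aggregate kind f ys W g -> L2f g /\ excess_bound g j0.
Proof. by case: kind => /=; [exact: linear_excess|exact: convex_excess]. Qed.

End aggregates.

Section law_L2.
Context {R : realType} {d : nat} dT (T : measurableType dT) (P : probability T R).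
Local Notation V := (d.-tuple R).
Local Notation mu := (lebesgueRd d).
Variables (Y : T -> V) (p : V -> R) (L : R).
Hypothesis mY : measurable_fun setT Y.
Hypothesis mp : measurable_fun setT p.
Hypothesis p0 : forall x, 0 <= p x.
Hypothesis law : forall A, measurable A ->
  P (Y @^-1` A) = (\int[mu]_(x in A) (p x)%:E)%E.
Hypothesis L0 : 0 < L.
Hypothesis pL : ('N[mu]_+oo[EFin \o p] <= L%:E)%E.

Lemma L2f_law_sqr g : L2f g -> (\int[P]_w (g (Y w) ^+ 2)%:E < +oo)%E.
Proof.
move=> [mg g2].
apply: le_lt_trans (law_le mY mp p0 law L0 pL (f := fun x => (g x ^+ 2)%:E) _ _) _.
- exact: measurable_sqE.
- by move=> x; rewrite lee_fin sqr_ge0.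
- by rewrite lte_mul_pinfty// lee_fin ltW.
Qed.

Lemma L2f_law_integrable g : L2f g -> P.-integrable setT (fun w => (g (Y w))%:E).
Proof.
move=> Lg; have [mg _] := Lg.
exact: (integrable_of_sqr (measurableT_comp mg mY) (L2f_law_sqr Lg)).
Qed.

Lemma L2f_law_integral g : L2f g -> \int[P]_w g (Y w) = L2dot g p.
Proof.
move=> [mg g2]; have mE : measurable_fun setT (EFin \o g) by exact/measurable_EFinP.
congr fine; rewrite [LHS]integralE [RHS]integralE; congr (_ - _)%E.
  transitivity (\int[P]_w (EFin \o g)^\+ (Y w))%E.
    by apply: eq_integral => w _; rewrite !funeposE.
  rewrite (law_ge0 mY mp p0 law)//; last exact: measurable_funepos.
  apply: eq_integral => x _; rewrite !funeposE/= -!EFin_max -EFinM; congr EFin.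
  by rewrite maxr_pMl// mul0r.
transitivity (\int[P]_w (EFin \o g)^\- (Y w))%E.
  by apply: eq_integral => w _; rewrite !funenegE.
rewrite (law_ge0 mY mp p0 law)//; last exact: measurable_funeneg.
apply: eq_integral => x _; rewrite !funenegE/= -!EFin_max -EFinM; congr EFin.
by rewrite maxr_pMl// mul0r mulNr.
Qed.

Lemma L2f_density : L2f p.
Proof. by split=> //; exact: (le_lt_trans (sqnorm_density mp p0 law L0 pL) (ltry _)). Qed.

End law_L2.

Section limn_einf_bounds.
Context {R : realType}.
Implicit Types (u : nat -> \bar R).

Lemma limn_einf_ge u (b : nat -> R) (l : R) : (forall k, (b k)%:E <= u k)%E ->
  b k @[k --> \oo] --> l -> (l%:E <= limn_einf u)%E.
Proof.
move=> bu bl; have blE : (b k)%:E @[k --> \oo] --> l%:E by apply: cvg_EFin bl; exact: nearW.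
rewrite -(cvg_limn_einf_sup blE).1 !limn_einf_lim; apply: lee_lim.
- exact: is_cvg_einfs.
- exact: is_cvg_einfs.
- apply: nearW => k; apply: le_ereal_inf_tmp => _ [j /= kj <-].
  by apply: le_trans (bu j); apply: ereal_inf_lbound; exists j.
Qed.

Lemma limn_einf_le u (l : \bar R) : (forall k, u k <= l)%E -> (limn_einf u <= l)%E.
Proof.
move=> ul; rewrite limn_einf_lim; apply: lime_le; first exact: is_cvg_einfs.
by apply: nearW => k; apply: le_trans (ul k); apply: ereal_inf_lbound; exists k => /=.
Qed.

End limn_einf_bounds.

(** * Expected excess over independent validation data *)

Section oracle_expectation.
Context {R : realType} {d : nat} dT (T : measurableType dT) (P : probability T R).
Local Notation V := (d.-tuple R).
Local Notation mu := (lebesgueRd d).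
Variables (X : nat -> {RV P >-> V}) (p : V -> R) (L : R).
Hypothesis iidX : iid_with_density X p.
Hypothesis L0 : 0 < L.
Hypothesis pL : ('N[mu]_+oo[EFin \o p] <= L%:E)%E.

Let indepX : mutually_independent X. Proof. by have [] := iidX. Qed.
Let mp : measurable_fun setT p. Proof. by have [] := iidX. Qed.
Let p0 x : 0 <= p x. Proof. by have [] := iidX. Qed.
Let law i A : measurable A -> P (X i @^-1` A) = (\int[mu]_(x in A) (p x)%:E)%E.
Proof. by have [_ _ _ h] := iidX; exact: h. Qed.
Let mX i : measurable_fun setT (X i). Proof. exact: measurable_X. Qed.
Let Lp : L2f p. Proof. exact: (L2f_density mp p0 (@law 0%N) L0 pL). Qed.

Variables (n M : nat) (W : {set 'I_n}) (f : 'I_M -> n.-tuple V -> V -> R).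
Local Notation XS := (n.-tuple V).
Hypothesis W0 : (0 < #|W|)%N.
Hypothesis mf : forall j, measurable_fun setT (fun q : XS * V => f j q.1 q.2).
Hypothesis Lf : forall xs j, L2f (f j xs).
(** The family is built from the training subsample: changing a validation observation leaves it
    unchanged. Resampling such an observation therefore freezes the Gram matrix. *)
Hypothesis fu : forall i y xs j, i \in W -> f j (upd i y xs) = f j xs.

Let psi j xs y := f j xs y - L2dot (f j xs) p.
Let Psi xs y : 'cV[R]_M := \col_j psi j xs y.
Let gram xs : 'M[R]_M := \matrix_(j, k) L2dot (f j xs) (f k xs).
Let z xs : 'cV[R]_M := \col_j (sample_mean xs W (f j xs) - L2dot (f j xs) p).
Let B (e : R) xs := invmx (rgram (gram xs) e).
Let U e xs := qform (B e xs) (z xs).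
(* U is a V-statistic in the validation sample with kernel H, whose off-diagonal
   terms are centred. *)
Let H e xs y y' := ((Psi xs y)^T *m B e xs *m Psi xs y') ord0 ord0.

Let gramC xs : (gram xs)^T = gram xs.
Proof. by apply/matrixP => i j; rewrite !mxE L2dotC. Qed.

Let qform_gram xs (c : 'cV[R]_M) : let q := lincomb (f^~ xs) (fun j => c j ord0) in
  qform (gram xs) c = L2dot q q.
Proof.
move=> q; rewrite qformE /q L2dot_lincombl//; last exact: L2f_lincomb.
apply: eq_bigr => i _; rewrite L2dot_lincombr// mulr_sumr; apply: eq_bigr => j _.
by rewrite !mxE; ring.
Qed.

Let gram_ge0 xs c : 0 <= qform (gram xs) c.
Proof. by rewrite qform_gram L2dot_ge0. Qed.

Let U_ge0 e xs : 0 < e -> 0 <= U e xs.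
Proof. by move=> e0; apply: qform_inv_ge0 (gram_ge0 xs) e0 _; exact: gramC. Qed.

(** The penalty e times the sum of the c_j^2 is the price of the ridge; it vanishes for each fixed c
    as e tends to 0. *)
Lemma U_excess e xs (c : 'I_M -> R) : 0 < e -> let q := lincomb (f^~ xs) c in
  2 * (sample_mean xs W q - L2dot q p) - L2dot q q - e * \sum_j c j ^+ 2 <= U e xs.
Proof.
move=> e0; cbv zeta; set q := lincomb _ c; pose cc : 'cV[R]_M := \col_j c j.
have := regularized_sup (gramC xs) (gram_ge0 xs) e0 (z xs) cc.
rewrite qform_gram (_ : lincomb _ (fun j => cc j ord0) = q); last first.
  by rewrite /q; congr lincomb; apply/funext => j; rewrite mxE.
rewrite (_ : ((z xs)^T *m cc) ord0 ord0 = sample_mean xs W q - L2dot q p); last first.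
  rewrite sample_mean_lincomb /q L2dot_lincombl// -sumrB mxE.
  by apply: eq_bigr => j _; rewrite !mxE; ring.
rewrite (_ : (cc^T *m cc) ord0 ord0 = \sum_j c j ^+ 2)//.
by rewrite mxE; apply: eq_bigr => j _; rewrite !mxE expr2.
Qed.

Let mL2dot d' (S : measurableType d') (g h : S -> V -> R) :
  measurable_fun setT (fun q : S * V => g q.1 q.2) ->
  measurable_fun setT (fun q : S * V => h q.1 q.2) ->
  measurable_fun setT (fun s => L2dot (g s) (h s)).
Proof.
move=> mg mh; apply: (measurable_Rintegral_param mu (F := fun x s => g s x * h s x)).
have ms : measurable_fun setT (fun q : V * S => (q.2, q.1)).
  by apply: measurable_fun_pair; [exact: measurable_snd|exact: measurable_fst].
apply: measurable_funM.
  exact: (measurableT_comp (f := fun q : S * V => g q.1 q.2) mg ms).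
exact: (measurableT_comp (f := fun q : S * V => h q.1 q.2) mh ms).
Qed.

Let mfp j : measurable_fun setT (fun xs => L2dot (f j xs) p).
Proof. by apply: mL2dot => //; exact: (measurableT_comp mp measurable_snd). Qed.

Let mfi j i : measurable_fun setT (fun xs : XS => f j xs (tnth xs i)).
Proof.
have mt : measurable_fun setT (fun xs : XS => (xs, tnth xs i)).
  by apply: measurable_fun_pair => //; exact: measurable_tnth.
exact: (measurableT_comp (f := fun q : XS * V => f j q.1 q.2) (mf j) mt).
Qed.

Let mB e i j : 0 < e -> measurable_fun setT (fun xs => B e xs i j).
Proof.
move=> e0; apply: measurable_invmx => [xs|k l].
  exact: rgram_unit (gram_ge0 xs) e0.
under eq_fun do rewrite !mxE.
by apply: measurable_funD => //; exact: mL2dot.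
Qed.

Let mU e : 0 < e -> measurable_fun setT (U e).
Proof.
move=> e0; under [X in measurable_fun _ X]funext do rewrite /U qformE.
apply: measurable_sum => i; apply: measurable_sum => j.
apply: measurable_funM; first exact: mB.
have mz k : measurable_fun setT (fun xs => z xs k ord0).
  under eq_fun do rewrite mxE.
  apply: measurable_funB => //; apply: measurable_funM => //.
  by apply: measurable_sum_in => l; exact: mfi.
by apply: measurable_funM.
Qed.

Let mH e i i' : 0 < e -> measurable_fun setT (fun xs : XS => H e xs (tnth xs i) (tnth xs i')).
Proof.
move=> e0.
have -> : (fun xs : XS => H e xs (tnth xs i) (tnth xs i')) =
    (fun xs => \sum_k (\sum_l psi l xs (tnth xs i) * B e xs l k) * psi k xs (tnth xs i')).
  apply/funext => xs; rewrite /H mxE; apply: eq_bigr => k _; rewrite !mxE; congr (_ * _).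
  by apply: eq_bigr => l _; rewrite !mxE.
have mpsi k l : measurable_fun setT (fun xs : XS => psi k xs (tnth xs l)).
  by apply: measurable_funB.
apply: measurable_sum => k; apply: measurable_funM => //.
by apply: measurable_sum => l; apply: measurable_funM => //; exact: mB.
Qed.

Let psiU i y j xs y' : i \in W -> psi j (upd i y xs) y' = psi j xs y'.
Proof. by move=> iW; rewrite /psi fu. Qed.

Let HU e i y xs y1 y2 : i \in W -> H e (upd i y xs) y1 y2 = H e xs y1 y2.
Proof.
move=> iW; have PU y' : Psi (upd i y xs) y' = Psi xs y'.
  by apply/matrixP => j k; rewrite !mxE psiU.
rewrite /H !PU /B (_ : gram (upd i y xs) = gram xs)//.
by apply/matrixP => j k; rewrite !mxE !fu.
Qed.

(** As a function of its first argument [H] is a centred combination of the f_j, hence integrable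
    with mean 0 under the law of an observation. *)
Let HE e xs y y' : let c := B e xs *m Psi xs y' in
  H e xs y y' = lincomb (f^~ xs) (fun j => c j ord0) y -
    L2dot (lincomb (f^~ xs) (fun j => c j ord0)) p.
Proof.
move=> c; rewrite /H -mulmxA -/c mxE /lincomb L2dot_lincombl// -sumrB.
by apply: eq_bigr => j _; rewrite !mxE /psi; ring.
Qed.

Let H_integrable e xs y' i :
  P.-integrable setT (fun w => (H e xs (X i w) y')%:E).
Proof.
under eq_fun do rewrite HE.
apply: integrableBR; last exact: integrable_cstP.
apply: (L2f_law_integrable (mX i) mp p0 (@law i) L0 pL).
exact: L2f_lincomb.
Qed.

Let H_centered e xs y' i : \int[P]_w H e xs (X i w) y' = 0.
Proof.
under eq_Rintegral do rewrite HE.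
set q := lincomb _ _; have Lq : L2f q by exact: L2f_lincomb.
have i1 := L2f_law_integrable (mX i) mp p0 (@law i) L0 pL Lq.
rewrite RintegralB; [|exact: measurableT|exact: i1|exact: integrable_cstP].
by rewrite Rintegral_cstP (L2f_law_integral (mX i) mp p0 (@law i) Lq) subrr.
Qed.

Let H_ge0 e xs y : 0 < e -> 0 <= H e xs y y.
Proof. by move=> e0; exact: (qform_inv_ge0 (gramC xs) (gram_ge0 xs) e0). Qed.

Let mfx j xs : measurable_fun setT (f j xs).
Proof. by have [] := Lf xs j. Qed.

(** Uncentred version of the diagonal of [H]. It is nonnegative, so its mean is at most L times its
    integral, and that integral is the trace of (G + e)^-1 G; centring lowers the mean by <q, p> >=
    0, with q as in [HQ]. *)
Let Q e xs y : R := \sum_i \sum_j B e xs i j * (f i xs y * f j xs y).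

Let HQ e xs y : 0 < e -> let q := lincomb (f^~ xs) (fun k => (B e xs *m \col_j L2dot (f j xs) p) k ord0) in
  Q e xs y = H e xs y y + 2 * q y - L2dot q p.
Proof.
move=> e0 q; pose m : 'cV[R]_M := \col_j L2dot (f j xs) p; pose F : 'cV[R]_M := \col_j f j xs y.
have PE : Psi xs y = F - m by apply/matrixP => j k; rewrite !mxE.
have Bsym : (B e xs)^T = B e xs := invmx_rgram_sym e (gramC xs).
have -> : Q e xs y = qform (B e xs) F.
  by rewrite qformE; apply: eq_bigr => i _; apply: eq_bigr => j _; rewrite !mxE.
have qy : q y = (F^T *m (B e xs *m m)) ord0 ord0.
  by rewrite mxE; apply: eq_bigr => j _; rewrite !mxE mulrC.
have qp : L2dot q p = (m^T *m (B e xs *m m)) ord0 ord0.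
  by rewrite L2dot_lincombl// mxE; apply: eq_bigr => j _; rewrite !mxE mulrC.
have mF : (m^T *m B e xs *m F) ord0 ord0 = q y.
  by rewrite qy -(mx11_tr (m^T *m _ *m F)) !trmx_mul trmxK Bsym.
rewrite /H PE [(F - m)^T]linearB/= mulmxBr !mulmxBl.
have x4 (a b c d' : 'M[R]_1) : (a - b - (c - d')) ord0 ord0 =
    a ord0 ord0 - b ord0 ord0 - (c ord0 ord0 - d' ord0 ord0) by rewrite !mxE.
rewrite x4 mF -[m^T *m _ *m m]mulmxA -[F^T *m _ *m m]mulmxA -qy -qp /qform; ring.
Qed.

Let H_diag_le e xs i : 0 < e ->
  (\int[P]_w (H e xs (X i w) (X i w))%:E <= (L * M%:R)%:E)%E.
Proof.
move=> e0; set q := lincomb (f^~ xs) (fun k => (B e xs *m \col_j L2dot (f j xs) p) k ord0).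
have HQ' y : Q e xs y = H e xs y y + 2 * q y - L2dot q p := HQ xs y e0.
have Lq : L2f q by exact: L2f_lincomb.
have ffi k l : mu.-integrable setT (fun x => (B e xs k l * (f k xs x * f l xs x))%:E).
  by apply: integrableZR; exact: L2dot_integrable.
have Qi : mu.-integrable setT (fun x => (Q e xs x)%:E).
  apply: (integrable_sumR (f := fun k x => \sum_l B e xs k l * (f k xs x * f l xs x))) => k.
  exact: (integrable_sumR (f := fun l x => B e xs k l * (f k xs x * f l xs x)) (ffi k)).
have QE : \int[mu]_x Q e xs x <= M%:R.
  rewrite (Rintegral_sumR (f := fun k x => \sum_l B e xs k l * (f k xs x * f l xs x))); last first.
    by move=> k; exact: (integrable_sumR (f := fun l x => B e xs k l * (f k xs x * f l xs x)) (ffi k)).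
  apply: le_trans (trace_inv_gram (gramC xs) (gram_ge0 xs) e0).
  apply: ler_sum => k _.
  rewrite (Rintegral_sumR (f := fun l x => B e xs k l * (f k xs x * f l xs x)) (ffi k)).
  apply: ler_sum => l _.
  by rewrite (RintegralZl _ measurableT (L2dot_integrable (Lf xs k) (Lf xs l))) mxE.
have mQ : measurable_fun setT (Q e xs) := integrable_measurable Qi.
have Q0 y : 0 <= Q e xs y.
  have -> : Q e xs y = qform (B e xs) (\col_j f j xs y).
    by rewrite qformE; apply: eq_bigr => k _; apply: eq_bigr => l _; rewrite !mxE.
  exact: (qform_inv_ge0 (gramC xs) (gram_ge0 xs) e0).
have EQ : (\int[P]_w (Q e xs (X i w))%:E <= (L * M%:R)%:E)%E.
  apply: le_trans (law_le (mX i) mp p0 (@law i) L0 pL (f := fun x => (Q e xs x)%:E) _ _) _.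
  - exact/measurable_EFinP.
  - by move=> y; rewrite lee_fin.
  - by rewrite (EFin_Rintegral Qi) -EFinM lee_fin ler_pM2l.
have QXi : P.-integrable setT (fun w => (Q e xs (X i w))%:E).
  apply: (ge0_integrable (f := fun w => Q e xs (X i w))) => //.
    exact: (measurableT_comp mQ (mX i)).
  exact: (le_lt_trans EQ (ltry _)).
have qXi := L2f_law_integrable (mX i) mp p0 (@law i) L0 pL Lq.
have cXi := integrable_cstP P (L2dot q p).
have HXi := integrableDR (integrableBR QXi (integrableZR 2 qXi)) cXi.
apply: le_trans EQ.
have -> : (\int[P]_w (H e xs (X i w) (X i w))%:E =
    \int[P]_w (Q e xs (X i w) - 2 * q (X i w) + L2dot q p)%:E)%E.
  by apply: eq_integral => w _; rewrite HQ'; congr EFin; ring.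
rewrite (EFin_Rintegral HXi) (EFin_Rintegral QXi) lee_fin.
rewrite RintegralD; [|exact: measurableT|exact: (integrableBR QXi (integrableZR 2 qXi))|exact: cXi].
rewrite RintegralB; [|exact: measurableT|exact: QXi|exact: (integrableZR 2 qXi)].
rewrite (RintegralZl _ measurableT qXi) Rintegral_cstP.
rewrite (L2f_law_integral (mX i) mp p0 (@law i) Lq).
have : 0 <= L2dot q p.
  rewrite L2dot_lincombl//.
  have := qform_inv_ge0 (gramC xs) (gram_ge0 xs) e0 (\col_j L2dot (f j xs) p).
  rewrite /qform -mulmxA mxE; congr (0 <= _).
  by apply: eq_bigr => j _; rewrite !mxE mulrC.
lra.
Qed.

Let Hs e (i i' : 'I_n) (xs : XS) := H e xs (tnth xs i) (tnth xs i').

(** Resampling observation i averages the diagonal term over it with everything else fixed, where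
    [H_diag_le] applies uniformly. *)
Let Hs_diag_le e i : 0 < e -> i \in W ->
  (\int[P]_w (Hs e i i (sample X n w))%:E <= (L * M%:R)%:E)%E.
Proof.
move=> e0 iW.
rewrite (resample indepX i (F := fun xs => (Hs e i i xs)%:E)); last 2 first.
- by apply/measurable_EFinP; exact: mH.
- by move=> xs; rewrite lee_fin; exact: H_ge0.
apply: (@le_trans _ _ (\int[P]_w (L * M%:R)%:E)%E).
  apply: ge0_le_integral => //.
  - move=> w _; apply: integral_ge0 => w' _; rewrite lee_fin; exact: H_ge0.
  - apply: (measurable_fun_fubini_tonelli_F (m2 := P)
      (fun q : T * T => (Hs e i i (upd i (X i q.2) (sample X n q.1)))%:E)).
      apply/measurable_EFinP; apply: (measurableT_comp (f := Hs e i i) (mH i i e0)).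
      apply: measurable_upd.
        exact: (measurableT_comp (mX i) measurable_snd).
      exact: (measurableT_comp (@measurable_sample _ _ _ _ _ X n) measurable_fst).
    by move=> q; rewrite lee_fin; exact: H_ge0.
  - move=> w _; apply: le_trans (H_diag_le (sample X n w) i e0).
    by rewrite le_eqVlt; apply/orP; left; apply/eqP; apply: eq_integral => w' _; rewrite /Hs HU// !tnth_mktuple eqxx.
by rewrite (EFin_Rintegral (integrable_cstP P _)) Rintegral_cstP.
Qed.

Let Hs_integrable e i i' : 0 < e -> i \in W -> i' \in W ->
  P.-integrable setT (fun w => (Hs e i i' (sample X n w))%:E).
Proof.
move=> e0 iW iW'.
have ms j j' : measurable_fun setT (fun w => Hs e j j' (sample X n w)).
  exact: (measurableT_comp (f := Hs e j j') (mH j j' e0) (@measurable_sample _ _ _ _ _ X n)).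
have dg j : j \in W -> P.-integrable setT (fun w => (Hs e j j (sample X n w))%:E).
  move=> jW; apply: (ge0_integrable (f := fun w => Hs e j j (sample X n w))) => //.
    by move=> w; exact: H_ge0.
  exact: (le_lt_trans (Hs_diag_le e0 jW) (ltry _)).
apply: (dominated_integrableR (f := fun w => Hs e i i' (sample X n w)) (ms i i')
  (integrableZR 2^-1 (integrableDR (dg _ iW) (dg _ iW')))) => w.
rewrite mulrC; exact: (bilinear_bound (gramC _) (gram_ge0 _) e0).
Qed.

Let Hs_offdiag e i i' : 0 < e -> i \in W -> i' \in W -> i != i' ->
  \int[P]_w Hs e i i' (sample X n w) = 0.
Proof.
move=> e0 iW iW' ii'; have E w w' : Hs e i i' (upd i (X i w') (sample X n w)) =
    H e (sample X n w) (X i w') (X i' w).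
  by rewrite /Hs HU// !tnth_mktuple eqxx eq_sym (negbTE ii').
apply: (resample0 indepX (i := i)).
- exact: mH.
- exact: Hs_integrable.
- by move=> w; under eq_fun do rewrite E; exact: H_integrable.
- by move=> w; under eq_Rintegral do rewrite E; exact: H_centered.
Qed.

Let U_Hs e xs : U e xs = #|W|%:R^-1 ^+ 2 * \sum_(i in W) \sum_(i' in W) Hs e i i' xs.
Proof.
have zE : z xs = #|W|%:R^-1 *: \sum_(i in W) Psi xs (tnth xs i).
  apply/matrixP => j k; rewrite !mxE summxE.
  under eq_bigr do rewrite mxE.
  rewrite sumrB sumr_const mulrBr -(mulr_natl (L2dot _ _)) mulrA mulVf ?mul1r//.
  by rewrite pnatr_eq0 -lt0n.
set s := #|W|%:R^-1; have tZ (v : 'cV[R]_M) : (s *: v)^T = s *: v^T by rewrite linearZ.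
have x2 (a b : R) (A : 'M[R]_1) : (a *: (b *: A)) ord0 ord0 = a * b * A ord0 ord0.
  by rewrite !mxE mulrA.
rewrite /U zE /qform tZ -!scalemxAl -scalemxAr x2 -expr2; congr (_ * _).
have tS : (\sum_(i in W) Psi xs (tnth xs i))^T = \sum_(i in W) (Psi xs (tnth xs i))^T.
  by rewrite linear_sum.
rewrite tS !mulmx_suml summxE; apply: eq_bigr => i _.
by rewrite mulmx_sumr summxE.
Qed.

(** Off-diagonal terms have mean 0, so of #|W|^2 terms there remain #|W|, each of mean at most L M,
    divided by #|W|^2. *)
Let U_integral_le e : 0 < e ->
  (\int[P]_w (U e (sample X n w))%:E <= (L * M%:R / #|W|%:R)%:E)%E.
Proof.
move=> e0; pose s : R := #|W|%:R^-1.
pose h i i' w := if (i \in W) && (i' \in W) then Hs e i i' (sample X n w) else 0.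
have hi i i' : P.-integrable setT (fun w => (h i i' w)%:E).
  rewrite /h; have [/andP[iW iW']|_] := boolP ((i \in W) && (i' \in W)); first exact: Hs_integrable.
  exact: integrable_cstP.
have hsi i := integrable_sumR (f := fun i' w => h i i' w) (hi i) (index_enum 'I_n) xpredT.
have hhi := integrable_sumR (f := fun i w => \sum_i' h i i' w) hsi (index_enum 'I_n) xpredT.
have UE w : U e (sample X n w) = s ^+ 2 * \sum_i \sum_i' h i i' w.
  rewrite U_Hs; congr (_ * _); rewrite big_mkcond; apply: eq_bigr => i _; rewrite /h.
  case: (i \in W) => /=; last by rewrite big1.
  by rewrite big_mkcond; apply: eq_bigr.
under eq_integral do rewrite UE.
rewrite (EFin_Rintegral (integrableZR _ hhi)) lee_fin (RintegralZl _ measurableT hhi).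
rewrite (Rintegral_sumR (f := fun i w => \sum_i' h i i' w) hsi).
have hE i : \int[P]_w (\sum_i' h i i' w) <= if i \in W then L * M%:R else 0.
  rewrite (Rintegral_sumR (f := fun i' w => h i i' w) (hi i)) (bigD1 i)//= big1 ?addr0; last first.
    move=> i' ii'; rewrite /h.
    have [/andP[iW iW']|_] := boolP ((i \in W) && (i' \in W)); last exact: Rintegral_cstP.
    by apply: Hs_offdiag => //; rewrite eq_sym.
  rewrite /h andbb; have [iW|_] := boolP (i \in W); last by rewrite Rintegral_cstP.
  have := Hs_diag_le e0 iW.
  by rewrite (EFin_Rintegral (Hs_integrable e0 iW iW)) lee_fin.
apply: (@le_trans _ _ (s ^+ 2 * \sum_i if i \in W then L * M%:R else 0)).
  by rewrite ler_wpM2l ?sqr_ge0// ler_sum.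
rewrite -big_mkcond/= sumr_const -mulr_natl /s le_eqVlt; apply/orP; left; apply/eqP.
by field; rewrite pnatr_eq0 -lt0n.
Qed.

(** [Z] depends on the sample only and dominates the excess for every c, so no selection of
    coefficients has to be measurable. It is the lower limit of [U e] along e = 1/(k+1): the ridge
    penalty disappears for each fixed c, and the bound on the mean is uniform in e. *)
Lemma oracle_excess : exists Z : XS -> \bar R,
  [/\ measurable_fun setT Z, forall xs, (0 <= Z xs)%E,
      (\int[P]_w Z (sample X n w) <= (L * M%:R / #|W|%:R)%:E)%E &
      forall xs (c : 'I_M -> R), let q := lincomb (f^~ xs) c in
        ((2 * (sample_mean xs W q - L2dot q p) - L2dot q q)%:E <= Z xs)%E].
Proof.
pose e (k : nat) : R := k.+1%:R^-1.
have e0 k : 0 < e k by rewrite invr_gt0.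
have mUk k : measurable_fun setT (fun xs => (U (e k) xs)%:E).
  by apply/measurable_EFinP; exact: mU.
exists (fun xs => limn_einf (fun k => (U (e k) xs)%:E)); split.
- apply: measurableT_comp => //.
  apply: (measurable_fun_limn_esup (f := fun k xs => (- (U (e k) xs)%:E)%E)) => k.
  exact: measurableT_comp.
- move=> xs; apply: (limn_einf_ge (b := fun=> 0)) (cvg_cst _) => k.
  by rewrite lee_fin U_ge0.
- apply: (@le_trans _ _ (limn_einf (fun k => \int[P]_w (U (e k) (sample X n w))%:E)%E)).
    apply: fatou => //.
    - move=> k; exact: (measurableT_comp (mUk k) (@measurable_sample _ _ _ _ _ X n)).
    - by move=> k w _; rewrite lee_fin U_ge0.
  by apply: limn_einf_le => k; exact: U_integral_le.
- move=> xs c; cbv zeta; set q := lincomb _ c; set b := (_ - L2dot q q).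
  apply: (limn_einf_ge (b := fun k => b - e k * \sum_j c j ^+ 2)).
    by move=> k; rewrite lee_fin; exact: U_excess.
  rewrite -[X in _ --> X]subr0 -[X in _ - X](mul0r (\sum_j c j ^+ 2)).
  apply: cvgB; first exact: cvg_cst.
  by apply: cvgM; [exact: cvg_harmonic|exact: cvg_cst].
Qed.

End oracle_expectation.

(** The integral of a nonnegative function is a supremum over the simple functions below it, so it
    is monotone without measurability. The risk of an aggregate, an arbitrary selection, is bounded
    in this way. *)
Lemma ge0_le_integral_nonmeasurable d (T : measurableType d) (R : realType)
    (mu : {measure set T -> \bar R}) (f g : T -> \bar R) :
  (forall x, 0 <= f x)%E -> (forall x, f x <= g x)%E ->
  (\int[mu]_x f x <= \int[mu]_x g x)%E.
Proof.
move=> f0 fg; have g0 x : (0 <= g x)%E := le_trans (f0 x) (fg x).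
rewrite !ge0_integralTE//; apply: ereal_sup_le => _ [h hf <-]; exists h => // x.
exact: le_trans (hf x) (fg x).
Qed.

(** * Averaging over splits *)

Section averaging.
Context {R : realType} {d : nat} dT (T : measurableType dT) (P : probability T R).
Local Notation V := (d.-tuple R).
Local Notation mu := (lebesgueRd d).
Variables (X : nat -> {RV P >-> V}) (p K : V -> R) (L : R).
Hypothesis iidX : iid_with_density X p.
Hypothesis L0 : 0 < L.
Hypothesis pL : ('N[mu]_+oo[EFin \o p] <= L%:E)%E.
Hypothesis LK : L2f K.

Let mp : measurable_fun setT p. Proof. by have [] := iidX. Qed.
Let Lp : L2f p.
Proof.
have [_ _ p0 law] := iidX.
exact: (L2f_density mp p0 (law 0%N) L0 pL).
Qed.

Lemma measurable_kernel_estimator n (S : {set 'I_n}) h :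
  measurable_fun setT (fun q : n.-tuple V * V => kernel_estimator K S h q.1 q.2).
Proof.
have [mK _] := LK.
apply: measurable_funM => //; apply: measurable_sum_in => i.
apply: (measurableT_comp (f := K) mK).
apply: (measurable_kern_arg h (f := fun q : n.-tuple V * V => tnth q.1 i) (g := snd)).
  exact: (measurableT_comp (measurable_tnth i) measurable_fst).
exact: measurable_snd.
Qed.

Lemma L2f_kernel_estimator n (S : {set 'I_n}) h xs : h != 0 ->
  L2f (kernel_estimator K S h xs).
Proof.
move=> h0; have [mK K2] := LK; apply: L2f_Z.
rewrite (_ : (fun x => _) = (fun x => \sum_(i <- enum S) K (kern_arg h (tnth xs i) x))); last first.
  by apply/funext => x; rewrite big_enum.
apply: L2f_sum => i.
have -> : (fun x => K (kern_arg h (tnth xs i) x)) = K \o affv (- h^-1) (scalev h^-1 (tnth xs i)).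
  by apply/funext => x /=; rewrite kern_argE.
have a0 : - h^-1 != 0 by rewrite oppr_eq0 invr_eq0.
split; first exact: (measurableT_comp mK (measurable_affv1 _ _)).
by rewrite sqnorm_affv// lte_mul_pinfty// lee_fin invr_ge0 exprn_ge0.
Qed.

Lemma kernel_estimator_upd n (S : {set 'I_n}) h i y xs : i \notin S ->
  kernel_estimator K S h (upd i y xs) = kernel_estimator K S h xs.
Proof.
move=> iS; apply/funext => x; rewrite /kernel_estimator; congr (_ * _).
apply: eq_bigr => j jS; rewrite !tnth_mktuple; case: eqP => // ji.
by rewrite ji (negbTE iS) in jS.
Qed.

Lemma sqr_mean_le (I : finType) (A : {set I}) (a : I -> R) : (0 < #|A|)%N ->
  (#|A|%:R^-1 * \sum_(i in A) a i) ^+ 2 <= #|A|%:R^-1 * \sum_(i in A) a i ^+ 2.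
Proof.
move=> A0; set N : R := #|A|%:R; have N0 : 0 < N by rewrite ltr0n.
pose m := N^-1 * \sum_(i in A) a i.
have : 0 <= \sum_(i in A) (a i - m) ^+ 2 by apply: sumr_ge0 => i _; exact: sqr_ge0.
have -> : \sum_(i in A) (a i - m) ^+ 2 = \sum_(i in A) a i ^+ 2 - N * m ^+ 2.
  have E i : (a i - m) ^+ 2 = a i ^+ 2 - 2 * m * a i + m ^+ 2 by ring.
  under eq_bigr do rewrite E.
  rewrite big_split/= sumrB sumr_const -mulr_natl -/N -mulr_sumr.
  have -> : \sum_(i in A) a i = N * m by rewrite mulrA mulfV ?mul1r// gt_eqF.
  ring.
by rewrite subr_ge0 -/m mulrC -ler_pdivlMr// mulrC.
Qed.

Lemma sqnorm_averaged_le (I : finType) (A : {set I}) (g : I -> V -> R) :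
  (0 < #|A|)%N -> (forall i, i \in A -> L2f (g i)) ->
  (sqnorm mu (fun x => #|A|%:R^-1 * (\sum_(i in A) g i x) - p x)%R <=
   (#|A|%:R^-1)%:E * \sum_(i in A) sqnorm mu (fun x => g i x - p x)%R)%E.
Proof.
(* Set to 0 outside A, [a i] is square integrable for every index, as the summation lemmas
   require. *)
move=> A0 Lg; pose a i x := if i \in A then g i x - p x else 0.
have La i : L2f (a i).
  rewrite /a; have [iA|_] := boolP (i \in A); last exact: L2f_0.
  by apply: L2f_B => //; exact: Lg.
have -> : (\sum_(i in A) sqnorm mu (fun x => g i x - p x)%R =
    (\int[mu]_x \sum_(i in A) a i x ^+ 2)%:E)%E.
  rewrite (Rintegral_sumR (f := fun i x => a i x ^+ 2) (fun i => L2f_sqi (La i))).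
  rewrite -sumEFin; apply: eq_bigr => i iA.
  rewrite -(EFin_Rintegral (L2f_sqi (La i))); apply: eq_integral => x _.
  by rewrite /a iA.
have ai := integrable_sumR (f := fun i x => a i x ^+ 2) (fun i => L2f_sqi (La i)) (index_enum I) (mem A).
rewrite -EFinM -(RintegralZl _ measurableT ai) -(EFin_Rintegral (integrableZR _ ai)).
apply: ge0_le_integral_nonmeasurable => x; first by rewrite lee_fin sqr_ge0.
rewrite lee_fin; apply: le_trans (sqr_mean_le (a^~ x) A0).
rewrite le_eqVlt; apply/orP; left; apply/eqP; congr (_ ^+ 2).
have -> : \sum_(i in A) a i x = \sum_(i in A) g i x - #|A|%:R * p x.
  rewrite mulr_natl -sumr_const -sumrB; apply: eq_bigr => i iA.
  by rewrite /a iA.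
by field; rewrite pnatr_eq0 -lt0n.
Qed.

(** Only convexity of the squared norm links the splits, so they may overlap and depend on each
    other: each term is bounded in mean by the same constant. *)
Lemma risk_averaged_le n (SS : {set {set 'I_n}}) (kind : aggregation) (a0 : R)
    (e : {set 'I_n} -> estimator R d n) (l : nat) (j0 : 'I_(grid_size d a0 n)) (C : R) :
  (forall j, 0 < grid d a0 n j) ->
  (0 < #|SS|)%N -> (0 < l)%N ->
  (forall S, S \in SS -> #|~: S|%SET = l) ->
  (forall S, S \in SS -> is_kernel_aggregate kind a0 K S (e S)) ->
  (forall S, S \in SS -> (risk X p (kernel_estimator K S (grid d a0 n j0)) <= C%:E)%E) ->
  (risk X p (averaged_estimator SS e) <=
     (C + L * (grid_size d a0 n)%:R / l%:R)%:E)%E.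
Proof.
move=> g0 SS0 l0 Sl agg rC; set M := grid_size d a0 n.
pose f S (j : 'I_M) (xs : n.-tuple V) := kernel_estimator K S (grid d a0 n j) xs.
have Lf S xs j : L2f (f S j xs) by apply: L2f_kernel_estimator; rewrite gt_eqF.
have excess S : exists Z : n.-tuple V -> \bar R, S \in SS ->
  [/\ measurable_fun setT Z, forall xs, (0 <= Z xs)%E,
      (\int[P]_w Z (sample X n w) <= (L * M%:R / l%:R)%:E)%E &
      forall xs, L2f (e S xs) /\
        (sqnorm mu (fun x => e S xs x - p x)%R <=
         sqnorm mu (fun x => f S j0 xs x - p x)%R + Z xs)%E].
  have [SSS|] := boolP (S \in SS); last by exists (fun=> 0%E).
  have W0 : (0 < #|~: S|%SET)%N by rewrite Sl.
  have fU i y xs j : i \in ~: S%SET -> f S j (upd i y xs) = f S j xs.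
    by rewrite finset.in_setC; exact: kernel_estimator_upd.
  have [Z [mZ Z0 EZ ZU]] := oracle_excess iidX L0 pL W0
    (fun j => measurable_kernel_estimator S (grid d a0 n j)) (Lf S) fU.
  exists Z => _; split=> //; first by rewrite -(Sl _ SSS).
  move=> xs.
  have [Le [c Hc]] := aggregate_excess (Lf S xs) Lp j0 (agg S SSS xs).
  split=> //; apply: le_trans Hc _.
  by rewrite leeD2l.
have /choice[Z HZ] := excess.
pose A S w := sqnorm mu (fun x => f S j0 (sample X n w) x - p x)%R.
have A0 S w : (0 <= A S w)%E by exact: sqnorm_ge0.
have mA S : measurable_fun setT (A S).
  apply: (measurable_fun_fubini_tonelli_F (m2 := mu)
    (fun q : T * V => ((f S j0 (sample X n q.1) q.2 - p q.2) ^+ 2)%:E)).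
    apply: measurable_sqE; apply: measurable_funB.
      have ms : measurable_fun setT (fun q : T * V => (sample X n q.1, q.2)).
        apply: measurable_fun_pair; last exact: measurable_snd.
        exact: (measurableT_comp (@measurable_sample _ _ _ _ _ X n) measurable_fst).
      exact: (measurableT_comp (measurable_kernel_estimator S (grid d a0 n j0)) ms).
    exact: (measurableT_comp mp measurable_snd).
  by move=> q; rewrite lee_fin sqr_ge0.
have mZs S : S \in SS -> measurable_fun setT (fun w => Z S (sample X n w)).
  by move=> /HZ[mZ _ _ _]; exact: (measurableT_comp mZ (@measurable_sample _ _ _ _ _ X n)).
have Z0 S w : S \in SS -> (0 <= Z S (sample X n w))%E by move=> /HZ[].
(* [Z S] is controlled only for S in SS, so h is set to 0 elsewhere and is measurable and
   nonnegative for every S. *)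
pose h S w := (if S \in SS then A S w + Z S (sample X n w) else 0)%E.
have mh S : measurable_fun setT (h S).
  rewrite /h; have [SSS|_] := boolP (S \in SS); last exact: measurable_cst.
  by apply: emeasurable_funD => //; exact: mZs.
have h0 S w : (0 <= h S w)%E.
  by rewrite /h; case: ifP => // SSS; rewrite adde_ge0// Z0.
have N0 : (0 <= (#|SS|%:R^-1 : R)%:E)%E by rewrite lee_fin invr_ge0.
apply: (@le_trans _ _ (\int[P]_w ((#|SS|%:R^-1)%:E * \sum_S h S w))%E).
  apply: ge0_le_integral_nonmeasurable => w.
    by rewrite L2norm_sqr sqnorm_ge0.
  rewrite L2norm_sqr; apply: le_trans (sqnorm_averaged_le SS0 _) _.
    by move=> S /HZ[_ _ _ /(_ (sample X n w))[]].
  rewrite lee_wpmul2l// big_mkcond/=; apply: lee_sum => S _.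
  rewrite /h; case: ifP => // SSS.
  by have [_ _ _ /(_ (sample X n w))[]] := HZ S SSS.
rewrite ge0_integralZl//; last 2 first.
- exact: emeasurable_sum.
- by move=> w _; apply: sume_ge0.
rewrite ge0_integral_sum//.
set D := C + _.
have hD S : (\int[P]_w h S w <= (if S \in SS then D else 0)%:E)%E.
  rewrite /h; have [SSS|_] := boolP (S \in SS); last by rewrite integral0.
  rewrite ge0_integralD//; last 2 first.
  - by move=> w _; exact: Z0.
  - exact: mZs.
  rewrite /D EFinD; apply: leeD; last by have [] := HZ S SSS.
  apply: le_trans (rC S SSS); rewrite le_eqVlt; apply/orP; left; apply/eqP.
  by apply: eq_integral => w _; rewrite L2norm_sqr.
apply: (@le_trans _ _ ((#|SS|%:R^-1)%:E * \sum_S (if S \in SS then D else 0)%:E)%E).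
  by rewrite lee_wpmul2l// lee_sum.
rewrite sumEFin -big_mkcond/= sumr_const -(mulr_natl D) -EFinM mulrA mulVf ?mul1r//.
by rewrite pnatr_eq0 -lt0n.
Qed.

End averaging.

(** * Comparison of bandwidths *)

Section bandwidth_grid.
Context {R : realType} (d : nat) (a0 : R) (n : nat).
Local Notation geom := (grid_geom d a0 n).
Hypothesis h0_0 : 0 < grid_h0 d n :> R.
Hypothesis h0_1 : grid_h0 d n < 1 :> R.
Hypothesis a_0 : 0 < grid_a a0 n.

Lemma grid_geom_gt0 j : 0 < geom j.
Proof. by rewrite mulr_gt0// exprn_gt0// addr_gt0. Qed.

Lemma grid_gt0 j : 0 < grid d a0 n j.
Proof. by rewrite /grid; case: ifP => _ //; exact: grid_geom_gt0. Qed.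

Lemma grid_geomS j : geom j.+1 = geom j * (1 + grid_a a0 n).
Proof. by rewrite /grid_geom exprSr mulrA. Qed.

Lemma bernoulli (x : R) k : 0 <= x -> 1 + k%:R * x <= (1 + x) ^+ k.
Proof.
move=> x0; elim: k => [|k IH]; first by rewrite mul0r addr0 expr0.
rewrite exprSr -natr1; apply: (@le_trans _ _ ((1 + k%:R * x) * (1 + x))).
  have : 0 <= k%:R * x * x by rewrite !mulr_ge0.
  nra.
by rewrite ler_wpM2r// addr_ge0.
Qed.

(** Shows that [xget] in [grid_size] returns a true maximum and not its default: by Bernoulli's
    inequality the geometric sequence exceeds 1 after finitely many steps. *)
Lemma grid_size_spec : let J := (grid_size d a0 n).-2 in
  geom J < 1 /\ forall i, geom i < 1 -> (i <= J)%N.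
Proof.
rewrite /grid_size /=; set A := (X in xget _ X).
suff [J AJ] : exists J, A J by exact: (xgetPex 0%N (ex_intro _ J AJ)).
have ex0 : exists j, geom j < 1 by exists 0%N; rewrite /grid_geom expr0 mulr1.
pose k := Num.bound ((grid_h0 d n)^-1 / grid_a a0 n : R).
have ubk i : geom i < 1 -> (i <= k)%N.
  move=> i1; rewrite leqNgt; apply/negP => ki.
  have : (grid_h0 d n)^-1 / grid_a a0 n < i%:R :> R.
    apply: (lt_le_trans (y := k%:R)); last by rewrite ler_nat ltnW.
    by apply: archi_boundP; rewrite divr_ge0// ?invr_ge0 ltW.
  rewrite ltr_pdivrMr// => ia.
  have := bernoulli i (ltW a_0).
  have : (grid_h0 d n)^-1 < (1 + grid_a a0 n) ^+ i -> False.
    by rewrite -(ltr_pM2l h0_0) divff ?gt_eqF// => /(lt_trans i1); rewrite ltxx.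
  move=> H b; apply: H; apply: (lt_le_trans _ b); lra.
have [J J1 JU] := ex_maxnP ex0 ubk.
by exists J.
Qed.

Lemma grid_last : grid d a0 n (grid_size d a0 n).-1 = 1.
Proof. by rewrite /grid eqxx. Qed.

Lemma grid_bracket h : grid_h0 d n <= h -> h < 1 -> exists2 j : 'I_(grid_size d a0 n),
  grid d a0 n j <= h & h < grid d a0 n j * (1 + grid_a a0 n).
Proof.
move=> h0h h1; have [J1 JU] := grid_size_spec.
set J := (grid_size d a0 n).-2 in J1 JU.
have hJ : h < geom J.+1.
  apply: (lt_le_trans h1); rewrite leNgt; apply/negP => /JU.
  by rewrite ltnn.
have [j jh hj] : exists2 j, geom j <= h & h < geom j.+1.
  elim: {J1 JU} J hJ => [|J IH] hJ.
    by exists 0%N => //; rewrite /grid_geom expr0 mulr1.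
  have [hJ'|hJ'] := ltP h (geom J.+1); first exact: IH.
  by exists J.+1.
have jJ : (j <= J)%N by apply: JU; exact: le_lt_trans h1.
have jM : (j < grid_size d a0 n)%N by rewrite ltnS (leq_trans jJ)// leqnSn.
(* As j <= J = M - 2, the index is not the last one and [grid] takes its geometric value there. *)
exists (Ordinal jM); rewrite /grid /= ltn_eqF//; first by rewrite -grid_geomS.
Qed.

Lemma grid_size_bound : ln (1 + grid_a a0 n) * (grid_size d a0 n).-2%:R <= - ln (grid_h0 d n : R).
Proof.
have [J1 _] := grid_size_spec; set J := (grid_size d a0 n).-2 in J1 *.
have a1 : 0 < 1 + grid_a a0 n by rewrite addr_gt0.
have := ln_le0 (ltW J1).
rewrite /grid_geom lnM ?posrE ?exprn_gt0// lnXn// mulr_natr; lra.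
Qed.

End bandwidth_grid.

(** * Comparison of risks at two bandwidths, in scalar form *)

Section bandwidth_comparison.
Context {R : realType}.
(** Only numbers are left here: b h stands for the squared bias, beta h for the squared norm of the
    smoothed density, kappa for ||K||^2 and s for ||p||^2. *)
Variables (d : nat) (b beta : R -> R) (kappa s : R).
Hypothesis s0 : 0 <= s.
Hypothesis kappa0 : 0 <= kappa.
Hypothesis b0 : forall h, 0 < h -> 0 <= b h.
Hypothesis beta0 : forall h, 0 < h -> 0 <= beta h.
Hypothesis beta_var : forall h, 0 < h -> beta h <= h ^- d * kappa.
Hypothesis beta_bias : forall h, 0 < h -> beta h <= 2 * b h + 2 * s.
Hypothesis bias_beta : forall h, 0 < h -> b h <= 2 * beta h + 2 * s.
Hypothesis b_mono : forall h h', 0 < h' -> h' < h -> b h' <= b h.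
Hypothesis b_const : kappa = 0 -> forall h h', 0 < h -> 0 < h' -> b h <= b h'.

Let mise (k : nat) h := b h + k%:R^-1 * (h ^- d * kappa - beta h).

Let b_mono_le h h' : 0 < h' -> h' <= h -> b h' <= b h.
Proof. by move=> h'0; rewrite le_eqVlt => /predU1P[->//|]; exact: b_mono. Qed.

Let mise_ge_b k h : 0 < h -> b h <= mise k h.
Proof. by move=> h0; rewrite lerDl mulr_ge0 ?invr_ge0// subr_ge0 beta_var. Qed.

Let mise_le k h : 0 < h -> mise k h <= b h + k%:R^-1 * (h ^- d * kappa).
Proof. by move=> h0; rewrite lerD2l ler_wpM2l ?invr_ge0// gerBl beta0. Qed.

Let mise_one m x : b 1 <= x -> mise m 1 <= x + m%:R^-1 * kappa.
Proof.
move=> b1; apply: le_trans (mise_le m ltr01) _.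
by rewrite expr1n invr1 mul1r lerD2r.
Qed.

(** The variance term grows by n/m for the smaller sample and by at most (1 + a)^d for the smaller
    bandwidth, while the bias does not grow. The factor 1 + 2/n and the remainder come from dropping
    the term -beta/n, through beta <= 2 b + 2 s <= 2 mise + 2 s. *)
Lemma mise_step n m g h a : (0 < m <= n)%N -> 0 < a -> 0 < g -> g <= h -> h < g * (1 + a) ->
  let th := n%:R / m%:R * (1 + a) ^+ d in
  mise m g <= th * (1 + 2 * n%:R^-1) * mise n h + 2 * th * s * n%:R^-1.
Proof.
move=> /andP[m0 mn] a_0 g0 gh hg; cbv zeta; set th := _ * (1 + a) ^+ d.
have h0 : 0 < h by exact: lt_le_trans gh.
have n0 : (0 < n)%N by exact: leq_trans mn.
have n0' : 0 < n%:R :> R by rewrite ltr0n.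
have m0' : 0 < m%:R :> R by rewrite ltr0n.
have a1 : 0 < 1 + a by rewrite addr_gt0.
have th1 : 1 <= th.
  rewrite -[1]mul1r ler_pM// ?ler01//.
    by rewrite ler_pdivlMr// mul1r ler_nat.
  by apply: exprn_ege1; rewrite lerDl ltW.
apply: le_trans (mise_le m g0) _.
have gd : g ^- d <= (1 + a) ^+ d * h ^- d.
  rewrite ler_pdivlMr ?exprn_gt0// mulrC ler_pdivrMr ?exprn_gt0// -exprMn mulrC.
  by rewrite lerXn2r// ?nnegrE ltW// mulr_gt0.
have V : m%:R^-1 * (g ^- d * kappa) <= th * (n%:R^-1 * (h ^- d * kappa)).
  have -> : th * (n%:R^-1 * (h ^- d * kappa)) = m%:R^-1 * ((1 + a) ^+ d * h ^- d * kappa).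
    by rewrite /th; field; rewrite !gt_eqF// exprn_gt0.
  by rewrite ler_wpM2l ?invr_ge0// ler_wpM2r.
have bg : b g <= th * b h.
  apply: le_trans (b_mono_le g0 gh) _.
  by rewrite -{1}[b h]mul1r ler_wpM2r// b0.
have B : b h + n%:R^-1 * (h ^- d * kappa) <= (1 + 2 * n%:R^-1) * mise n h + 2 * s * n%:R^-1.
  have -> : b h + n%:R^-1 * (h ^- d * kappa) = mise n h + n%:R^-1 * beta h.
    by rewrite /mise; ring.
  have : n%:R^-1 * beta h <= n%:R^-1 * (2 * mise n h + 2 * s).
    rewrite ler_wpM2l ?invr_ge0// (le_trans (beta_bias h0))// lerD2r ler_wpM2l//.
    exact: mise_ge_b.
  lra.
apply: (@le_trans _ _ (th * (b h + n%:R^-1 * (h ^- d * kappa)))); first by rewrite mulrDr lerD.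
apply: (@le_trans _ _ (th * ((1 + 2 * n%:R^-1) * mise n h + 2 * s * n%:R^-1))).
  by rewrite ler_wpM2l// (le_trans ler01).
by rewrite le_eqVlt; apply/orP; left; apply/eqP; ring.
Qed.

Lemma mise_large n m h : 1 <= h -> mise m 1 <= mise n h + m%:R^-1 * kappa.
Proof.
move=> h1; have h0 : 0 < h by exact: lt_le_trans h1.
by apply: mise_one => //; exact: le_trans (b_mono_le ltr01 h1) (mise_ge_b n h0).
Qed.

(** The variance part is at least l kappa and, as n >= 2, the subtracted beta/n is at most b + s; so
    the risk is at least l kappa - s, hence at least 2 kappa + 2 s >= b 1. This is where 3 s comes
    from. If kappa = 0 the bias is constant in h. *)
Lemma mise_small n m h (l : R) : (2 <= n)%N -> 0 < h -> n%:R * l <= h ^- d ->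
  (0 < kappa -> 2 * kappa + 3 * s <= l * kappa) ->
  mise m 1 <= mise n h + m%:R^-1 * kappa.
Proof.
move=> n2 h0 hl ll; apply: mise_one => //.
have [k0|k0] := eqVneq kappa 0.
  by apply: le_trans (mise_ge_b n h0); exact: b_const.
have {}k0 : 0 < kappa by rewrite lt_neqAle eq_sym k0.
have n2' : 2 <= n%:R :> R by rewrite (ler_nat _ 2).
set t : R := n%:R^-1; have t0 : 0 < t by rewrite invr_gt0; lra.
have tn : t * n%:R = 1 by rewrite mulVf// gt_eqF//; lra.
have t2 : t <= 2^-1 by rewrite lef_pV2// posrE; lra.
have mb := mise_ge_b n h0.
have bb := beta_bias h0.
have V : l * kappa <= t * (h ^- d * kappa).
  have := ler_wpM2r kappa0 (ler_wpM2l (ltW t0) hl).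
  by rewrite mulrA tn mul1r -mulrA.
have E : mise n h = b h + t * (h ^- d * kappa) - t * beta h by rewrite /mise -/t; ring.
have tb : t * beta h <= 2^-1 * beta h by rewrite ler_wpM2r// beta0.
have b1 : b 1 <= 2 * kappa + 2 * s.
  apply: le_trans (bias_beta ltr01) _; rewrite lerD2r ler_wpM2l//.
  by have := beta_var (@ltr01 R); rewrite expr1n invr1 mul1r.
have := ll k0; lra.
Qed.

End bandwidth_comparison.

(** * Asymptotics in the sample size *)

Section asymptotics.
Context {R : realType}.

Lemma near_ln_ge (A : R) : \forall n \near \oo, A <= ln n%:R.
Proof.
near=> n; have : expR A <= n%:R by near: n; exact: nbhs_infty_ger.
have e0 := expR_gt0 A => en.
by rewrite -{1}(expRK A) ler_ln// posrE (lt_le_trans e0).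
Unshelve. all: by end_near. Qed.

Lemma cvg_inv_ln : (ln (n%:R : R))^-1 @[n --> \oo] --> (0 : R).
Proof.
apply/cvgrPdist_le => e e0; near=> n.
have l : e^-1 <= ln n%:R by near: n; exact: near_ln_ge.
have l0 : 0 < ln n%:R :> R by apply: lt_le_trans l; rewrite invr_gt0.
rewrite sub0r normrN gtr0_norm ?invr_gt0//.
by rewrite -[e]invrK lef_pV2// posrE invr_gt0.
Unshelve. all: by end_near. Qed.

Lemma ln_ge_div (a : R) : 0 < a -> a / (1 + a) <= ln (1 + a).
Proof.
move=> a0; have a1 : 0 < 1 + a by rewrite addr_gt0.
have := @le_ln1Dx R (- (a / (1 + a))).
have -> : 1 + - (a / (1 + a)) = (1 + a)^-1 by field; rewrite gt_eqF.
rewrite lnV// lerN2; apply.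
by rewrite ltrN2 ltr_pdivrMr// mul1r ltrDr.
Qed.

(** Truncation loses less than 1 <= n / l, which doubles the relative loss 1 / l of the training
    sample; the validation sample keeps at least n / l points. The constant 4 comes from m >= n/2 -
    1 >= n/4. *)
Lemma training_size_bounds n (l := ln (n%:R : R)) : 2 <= l -> (4 <= n)%N ->
  [/\ n%:R <= 4 * (training_size R n)%:R :> R, (0 < training_size R n < n)%N,
      n%:R * (1 - 2 * l^-1) <= (training_size R n)%:R &
      n%:R <= l * (n - training_size R n)%:R].
Proof.
move=> l2 n4; set m := training_size R n.
have n4' : 4 <= n%:R :> R by rewrite (ler_nat _ 4).
have l0 : 0 < l by exact: lt_le_trans l2.
have u0 : 0 < l^-1 by rewrite invr_gt0.
have u2 : l^-1 <= 2^-1 by rewrite lef_pV2// posrE.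
have x0 : 0 <= n%:R * (1 - l^-1) by rewrite mulr_ge0// subr_ge0; lra.
have /andP[mle mgt] : m%:R <= n%:R * (1 - l^-1) < m.+1%:R by rewrite truncn_itv.
rewrite -natr1 in mgt.
have lx : l < n%:R by apply: ln_sublinear; lra.
have xu : 1 <= n%:R * l^-1 by rewrite ler_pdivlMr// mul1r ltW.
have m4 : n%:R <= 4 * m%:R :> R by nra.
have m0 : 0 < m%:R :> R by lra.
have mn : m%:R < n%:R :> R by nra.
rewrite ltr0n in m0; rewrite ltr_nat in mn.
split=> //; [by rewrite m0|by nra|].
rewrite natrB; last exact: ltnW.
have : l * (n%:R * l^-1) <= l * (n%:R - m%:R) by rewrite ler_wpM2l// ?(ltW l0)//; lra.
by rewrite mulrCA divff ?mulr1// gt_eqF.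
Qed.

Lemma ln_le_powR (x al : R) : 0 < x -> 0 < al -> al * ln x <= x `^ al.
Proof.
by move=> x0 al0; rewrite -ln_powR; apply/ltW/ln_sublinear; exact: powR_gt0.
Qed.

Variables (d : nat) (a0 : R).
Hypothesis d0 : (0 < d)%N.
Hypothesis a0_0 : 0 < a0.

(** h_0^-d = n l, so a bandwidth below h_0 has h^-d / n at least l. The last bound uses ln l <= l
    and d >= 1. *)
Lemma grid_h0_bounds n (l := ln (n%:R : R)) : 2 <= l -> (4 <= n)%N ->
  [/\ 0 < grid_h0 d n :> R, grid_h0 d n < 1 :> R,
      (forall h, 0 < h -> h < grid_h0 d n -> n%:R * l <= h ^- d) &
      - ln (grid_h0 d n) <= 2 * l].
Proof.
move=> l2 n4.
have n4' : 4 <= n%:R :> R by rewrite (ler_nat _ 4).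
have l0 : 0 < l by exact: lt_le_trans l2.
have nl1 : 1 < n%:R * l by nra.
have nl0 : 0 < n%:R * l by exact: lt_trans nl1.
have d0' : 0 < d%:R :> R by rewrite ltr0n.
have h0 : 0 < grid_h0 d n :> R by exact: powR_gt0.
have lnh : ln (grid_h0 d n) = - d%:R^-1 * ln (n%:R * l) by rewrite ln_powR.
have lnnl : 0 < ln (n%:R * l) by exact: ln_gt0.
split=> //.
- rewrite -ltr_ln ?posrE// ln1 lnh mulNr oppr_lt0 mulr_gt0// invr_gt0//.
- move=> h hp hh; have hd : h ^+ d <= grid_h0 d n ^+ d.
    by rewrite lerXn2r// ?nnegrE ltW.
  have h0d : grid_h0 d n ^+ d = (n%:R * l)^-1.
    rewrite -powR_mulrn ?ltW// -powRrM mulNr mulVf ?gt_eqF// powR_inv1// ltW//.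
  rewrite -[_ * l]invrK -h0d lef_pV2// posrE exprn_gt0//.
- rewrite lnh mulNr opprK.
  have d1 : d%:R^-1 <= 1 :> R by rewrite invf_le1// (ler_nat _ 1).
  have : ln (n%:R * l) <= 2 * l.
    rewrite lnM ?posrE//; last lra.
    by have := ln_sublinear l0; rewrite -/l; lra.
  nra.
Qed.

(** Length of a geometric progression from h_0 to 1 with ratio 1 + a, where ln(1 + a) >= a / (1 + a)
    and a = a_0 / l. The term 4 l^2 absorbs 2 l and the two points beyond the count J. *)
Lemma grid_size_le n (l := ln (n%:R : R)) : 2 <= l -> (4 <= n)%N ->
  (grid_size d a0 n)%:R <= (2 / a0 + 4) * l ^+ 2.
Proof.
move=> l2 n4; have [h0 h1 _ lnh] := grid_h0_bounds l2 n4.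
have l0 : 0 < l by exact: lt_le_trans l2.
have a_0 : 0 < grid_a a0 n by rewrite divr_gt0.
have H := grid_size_bound h0 h1 a_0.
set a := grid_a a0 n in H a_0.
have aE : a = a0 / l by [].
set J := (grid_size d a0 n).-2%:R : R in H.
have -> : (grid_size d a0 n)%:R = J + 2 by rewrite /J /grid_size /= -natrD addn2.
have J0 : 0 <= J by [].
have a1 : 0 < 1 + a by rewrite addr_gt0.
have : a / (1 + a) * J <= 2 * l.
  by apply: le_trans lnh; apply: le_trans H; rewrite ler_wpM2r// ln_ge_div.
rewrite mulrAC ler_pdivrMr// => aJ.
have : J <= 2 * l * (1 + a) / a by rewrite ler_pdivlMr// mulrC.
have -> : 2 * l * (1 + a) / a = 2 / a0 * l ^+ 2 + 2 * l.
  by rewrite aE; field; rewrite !gt_eqF// addr_gt0.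
nra.
Qed.

Variables (b beta : R -> R) (kappa s L c alpha : R).
Hypothesis s0 : 0 <= s.
Hypothesis kappa0 : 0 <= kappa.
Hypothesis b0 : forall h, 0 < h -> 0 <= b h.
Hypothesis beta0 : forall h, 0 < h -> 0 <= beta h.
Hypothesis beta_var : forall h, 0 < h -> beta h <= h ^- d * kappa.
Hypothesis beta_bias : forall h, 0 < h -> beta h <= 2 * b h + 2 * s.
Hypothesis bias_beta : forall h, 0 < h -> b h <= 2 * beta h + 2 * s.
Hypothesis b_mono : forall h h', 0 < h' -> h' < h -> b h' <= b h.
Hypothesis b_const : kappa = 0 -> forall h h', 0 < h -> 0 < h' -> b h <= b h'.
Hypothesis L0 : 0 < L.
Hypothesis c0 : 0 < c.
Hypothesis alpha0 : 0 < alpha.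

Let mise (k : nat) h := b h + k%:R^-1 * (h ^- d * kappa - beta h).
Hypothesis mise_lower : forall n h, (0 < n)%N -> 0 < h ->
  c * n%:R `^ (- 1 + alpha) <= mise n h.

(* u stands for 1 / ln n. With y = n^(alpha/4) one has ln n <= (4 / alpha) y, so the
   aggregation cost, of order (ln n)^3 / n, is O(y^3 / n), while the oracle risk is
   at least c y^4 / n. *)
Let theta (u : R) := (1 + a0 * u) ^+ d / (1 - 2 * u).
Let rate (u : R) := theta u * (1 + 2 * u) - 1 +
  (2 * theta u * s + 4 * kappa + L * (2 / a0 + 4) * (4 / alpha) ^+ 3) / c * (4 / alpha * u).

Let cvg_rate (u : nat -> R) : u n @[n --> \oo] --> (0 : R) -> rate (u n) @[n --> \oo] --> (0 : R).
Proof.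
move=> u0.
have cc (a : R) : (fun=> a) @ \oo --> a by exact: cvg_cst.
have t1 : theta (u n) @[n --> \oo] --> (1 : R).
  have -> : 1 = (1 + a0 * 0) ^+ d / (1 - 2 * 0) :> R by rewrite !mulr0 addr0 subr0 expr1n divr1.
  apply: cvgM.
    elim: (d) => [|k IH]; first by under eq_fun do rewrite expr0; exact: cvg_cst.
    under eq_fun do rewrite exprS; rewrite exprS.
    by apply: cvgM IH; apply: cvgD (cc _) (cvgM (cc _) u0).
  apply: cvgV; first by rewrite mulr0 subr0 oner_neq0.
  by apply: cvgB (cc _) (cvgM (cc _) u0).
rewrite [X in _ --> X](_ : 0 = 1 * (1 + 2 * 0) - 1 +
  (2 * 1 * s + 4 * kappa + L * (2 / a0 + 4) * (4 / alpha) ^+ 3) / c * (4 / alpha * 0)); last by ring.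
apply: cvgD.
  by apply: cvgB (cc _); apply: cvgM t1 (cvgD (cc _) (cvgM (cc _) u0)).
apply: cvgM (cvgM (cc _) u0); apply: cvgM (cc _).
by apply: cvgD (cc _); apply: cvgD (cc _); apply: cvgM (cc _); exact: cvgM (cc _) t1.
Qed.

(** The grid index may depend on h but [rate] may not, as the infimum over h is taken afterwards.
    The additive errors are of order at most (ln n)^3 / n and are absorbed multiplicatively into the
    risk through its lower bound. *)
Lemma mise_grid n (l := ln (n%:R : R)) (m := training_size R n) (M := grid_size d a0 n) :
  3 <= l -> (4 <= n)%N -> (0 < kappa -> 2 * kappa + 3 * s <= l * kappa) ->
  forall h, 0 < h -> exists j : 'I_M,
    mise m (grid d a0 n j) + L * M%:R / (n - m)%:R <= mise n h * (1 + rate l^-1).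
Proof.
move=> l3 n4 kl h hp.
have l2 : 2 <= l by lra.
have [h0 h1 hsm _] := grid_h0_bounds l2 n4.
have [m4 /andP[m0 mn] mlo lhi] := training_size_bounds l2 n4.
rewrite -/m -/l in m4 m0 mn mlo lhi hsm.
have Ml := grid_size_le l2 n4; rewrite -/M -/l in Ml.
have l0 : 0 < l by exact: lt_le_trans l2.
have a_0 : 0 < grid_a a0 n by rewrite divr_gt0.
have aE : grid_a a0 n = a0 * l^-1 by [].
have n0 : (0 < n)%N by exact: leq_trans n4.
set x := n%:R : R; have x0 : 0 < x by rewrite ltr0n.
have m0' : 0 < m%:R :> R by rewrite ltr0n.
set u := l^-1; have u0 : 0 < u by rewrite invr_gt0.
have u3 : u <= 3^-1 by rewrite lef_pV2// posrE.
set y := x `^ (alpha / 4); have y0 : 0 < y by exact: powR_gt0.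
have ly : l <= 4 / alpha * y.
  have -> : 4 / alpha * y = (alpha / 4)^-1 * y by rewrite invf_div.
  by rewrite ler_pdivlMl ?divr_gt0//; apply: ln_le_powR => //; exact: divr_gt0.
have yu : y^-1 <= 4 / alpha * u.
  have := ler_wpM2l (ltW (mulr_gt0 u0 (etrans (invr_gt0 y) y0))) ly.
  have -> : u / y * l = y^-1 by rewrite /u; field; rewrite !gt_eqF.
  by have -> : u / y * (4 / alpha * y) = 4 / alpha * u by field; rewrite !gt_eqF.
have r_lo := mise_lower n0 hp; set r := mise n h in r_lo *.
have E : x `^ (- 1 + alpha) = y ^+ 4 / x.
  rewrite powRD; last by apply/implyP => _; rewrite gt_eqF.
  rewrite (powR_inv1 (ltW x0)) mulrC -(powR_mulrn 4 (ltW y0)) -powRrM.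
  by rewrite (_ : alpha / 4 * 4%:R = alpha)//; field.
rewrite -/x E in r_lo.
have r0 : 0 < r by apply: lt_le_trans r_lo; rewrite mulr_gt0// divr_gt0// exprn_gt0.
have y1 : 1 <= y.
  have : 1 <= x by rewrite (ler_nat _ 1).
  by move=> x1; rewrite -(powRr0 x) ler_powR// divr_ge0// ltW.
(* 1/n measured in units of the risk: the lower bound r >= c y^4 / n, inverted. *)
have xr : x^-1 <= r / c * y^-1 ^+ 4.
  rewrite -[r / c * _]mulrA -ler_pdivrMr ?mulr_gt0 ?invr_gt0 ?exprn_gt0 ?invr_gt0//.
  rewrite (le_trans _ r_lo)// le_eqVlt; apply/orP; left; apply/eqP.
  by field; rewrite !gt_eqF.
have v0 : 0 < y^-1 by rewrite invr_gt0.
have v1 : y^-1 <= 1 by rewrite invf_le1.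
have xr1 : x^-1 <= r / c * y^-1.
  apply: le_trans xr _; rewrite ler_wpM2l//; first by rewrite divr_ge0// ltW.
  by rewrite exprS ger_pMr// exprn_ile1// ltW.
have rc0 : 0 < r / c by rewrite divr_gt0.
have rcy : r / c * y^-1 <= r / c * (4 / alpha * u) by rewrite ler_wpM2l// ltW.
have xu : x^-1 <= u.
  by rewrite lef_pV2 ?posrE// ltW// ln_sublinear.
have minv : m%:R^-1 <= 4 * x^-1.
  by rewrite -ler_pdivrMl// -invfM lef_pV2 ?posrE// ?mulr_gt0.
have th0 : 1 <= theta u.
  rewrite /theta ler_pdivlMr ?mul1r; last lra.
  apply: (@le_trans _ _ 1); first lra.
  by apply: exprn_ege1; rewrite lerDl mulr_ge0 ?ltW.
have th00 : 0 <= theta u := le_trans ler01 th0.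
have ts0 : 0 <= 2 * theta u * s by rewrite mulr_ge0// mulr_ge0.
have thE : x / m%:R * (1 + grid_a a0 n) ^+ d <= theta u.
  rewrite aE /theta mulrC ler_wpM2l//; first by rewrite exprn_ge0// addr_ge0// mulr_ge0// ltW.
  rewrite -[X in _ <= X]mul1r ler_pdivlMr; last lra.
  by rewrite mulrAC ler_pdivrMr// mul1r.
have agg : L * M%:R / (n - m)%:R <= L * (2 / a0 + 4) * (4 / alpha) ^+ 3 * (r / c * y^-1).
  have nm0 : 0 < (n - m)%:R :> R by rewrite ltr0n subn_gt0.
  have C0 : 0 < 2 / a0 + 4 by rewrite addr_gt0// divr_gt0.
  have nminv : (n - m)%:R^-1 <= l * x^-1.
    by rewrite ler_pdivlMr// mulrC ler_pdivrMr.
  apply: (@le_trans _ _ (L * ((2 / a0 + 4) * l ^+ 2) * (l * x^-1))).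
    by apply: ler_pM => //; [rewrite mulr_ge0// ltW|rewrite ler_wpM2l// ltW].
  have -> : L * ((2 / a0 + 4) * l ^+ 2) * (l * x^-1) = L * (2 / a0 + 4) * (l ^+ 3 * x^-1) by ring.
  rewrite -[X in _ <= X]mulrA ler_wpM2l//; first by rewrite mulr_ge0// ltW.
  (* Three powers of l are paid by three of the four powers of y gained in [xr]; the remaining y^-1
     tends to 0 and becomes (4 / alpha) u by [yu]. *)
  apply: (@le_trans _ _ ((4 / alpha * y) ^+ 3 * (r / c * y^-1 ^+ 4))).
    by apply: ler_pM => //; [rewrite exprn_ge0// ltW|rewrite invr_ge0 ltW|rewrite lerXn2r// nnegrE ltW// mulr_gt0// divr_gt0].
  rewrite le_eqVlt; apply/orP; left; apply/eqP.
  by field; rewrite !gt_eqF.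
(* All three ranges of h reach this form: the s-term and the factor of r come from [mise_step], the
   kappa-term from the comparison with bandwidth 1. *)
have main j : mise m (grid d a0 n j) <= theta u * (1 + 2 * x^-1) * r + 2 * theta u * s * x^-1 + m%:R^-1 * kappa ->
   mise m (grid d a0 n j) + L * M%:R / (n - m)%:R <= r * (1 + rate u).
  move=> H.
  have A1 : theta u * (1 + 2 * x^-1) * r <= theta u * (1 + 2 * u) * r.
    rewrite ler_wpM2r ?(ltW r0)// ler_wpM2l//; lra.
  have A2 : 2 * theta u * s * x^-1 <= 2 * theta u * s * (r / c * y^-1).
    by rewrite ler_wpM2l.
  have A3 : m%:R^-1 * kappa <= 4 * kappa * (r / c * y^-1).
    rewrite mulrC -mulrA [X in _ <= X]mulrCA ler_wpM2l//.
    by apply: le_trans minv _; rewrite ler_wpM2l.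
  set K3 := L * (2 / a0 + 4) * (4 / alpha) ^+ 3 in agg.
  have K30 : 0 <= K3.
    by apply: ltW; rewrite mulr_gt0 ?exprn_gt0 ?divr_gt0// mulr_gt0// addr_gt0// divr_gt0.
  have S0 : 0 <= 2 * theta u * s + 4 * kappa + K3.
    by rewrite addr_ge0// addr_ge0// mulr_ge0.
  have := ler_wpM2l S0 rcy.
  have -> : r * (1 + rate u) = theta u * (1 + 2 * u) * r + (2 * theta u * s + 4 * kappa + K3) * (r / c * (4 / alpha * u)).
    by rewrite /rate -/K3; field; rewrite !gt_eqF.
  lra.
have last_ : (M.-1 < M)%N by rewrite /M /grid_size.
have big : mise m 1 <= r + m%:R^-1 * kappa ->
  exists j : 'I_M, mise m (grid d a0 n j) + L * M%:R / (n - m)%:R <= r * (1 + rate u).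
  move=> H; exists (Ordinal last_); apply: main => /=; rewrite grid_last.
  apply: le_trans H _; rewrite lerD2r.
  apply: ler_wpDr; first by rewrite mulr_ge0// invr_ge0 ltW.
  rewrite ler_peMl ?(ltW r0)// mulr_ege1//.
  by rewrite lerDl mulr_ge0// invr_ge0 ltW.
have [hge1|hlt1] := leP 1 h.
  by apply: big; exact: mise_large.
have [hge|hlt] := leP (grid_h0 d n) h; last first.
  apply: big; apply: (mise_small kappa0 beta0 beta_var beta_bias bias_beta b_const _ _ hp (hsm _ hp hlt) kl).
  exact: leq_trans n4.
have [j jh hj] := grid_bracket h0 h1 a_0 hge hlt1.
exists j; apply: main.
have mn' : (0 < m <= n)%N by rewrite m0 ltnW.
apply: le_trans (mise_step kappa0 b0 beta0 beta_var beta_bias b_mono mn' a_0 (grid_gt0 h0 a_0 j) jh hj) _.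
rewrite -/x -/r; set th := x / m%:R * _.
have th'0 : 0 <= th by rewrite mulr_ge0 ?exprn_ge0 ?addr_ge0 ?divr_ge0// ltW.
have ix : 0 <= x^-1 by rewrite invr_ge0 ltW.
apply: ler_wpDr; first by rewrite mulr_ge0// invr_ge0.
apply: lerD.
  by rewrite ler_wpM2r ?(ltW r0)// ler_wpM2r// addr_ge0// mulr_ge0.
by rewrite ler_wpM2r// ler_wpM2r// ler_wpM2l.
Qed.

Lemma mise_oracle_rate : exists eps : nat -> R, eps n @[n --> \oo] --> (0 : R) /\
  \forall n \near \oo, let m := training_size R n in
    [/\ (0 < m < n)%N, forall j, 0 < grid d a0 n j &
    forall h, 0 < h -> exists j : 'I_(grid_size d a0 n),
      mise m (grid d a0 n j) + L * (grid_size d a0 n)%:R / (n - m)%:R <=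
      mise n h * (1 + eps n)].
Proof.
exists (fun n => rate (ln n%:R)^-1); split; first by apply: cvg_rate; exact: cvg_inv_ln.
near=> n.
have l3 : 3 <= ln n%:R :> R by near: n; exact: near_ln_ge.
have n4 : (4 <= n)%N by near: n; exact: nbhs_infty_ge.
(* For kappa = 0 the quotient is 0 by convention; the consequence drawn from it is claimed for kappa
   > 0 only. *)
have kl : 2 + 3 * s / kappa <= ln n%:R by near: n; exact: near_ln_ge.
have l2 : 2 <= ln n%:R :> R by lra.
have [h0 h1 _ _] := grid_h0_bounds l2 n4.
have [_ mn _ _] := training_size_bounds l2 n4.
have a_0 : 0 < grid_a a0 n by rewrite divr_gt0//; lra.
split=> //; first by move=> j; exact: grid_gt0.
apply: mise_grid => // k0.
have := ler_wpM2r kappa0 kl; congr (_ <= _).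
by field; rewrite gt_eqF.
Unshelve. all: by end_near. Qed.

End asymptotics.

Theorem corollary5p1 (R : realType) (d : nat) (a0 L : R)
    (dT : measure_display) (T : measurableType dT) (P : probability T R)
    (X : nat -> {RV P >-> d.-tuple R}) (p K : d.-tuple R -> R)
    (FK : d.-tuple R -> R[i]) (c alpha : R) (kind : aggregation)
    (SS : forall n : nat, {set {set 'I_n}})
    (agg : forall n : nat, {set 'I_n} -> estimator R d n) :
  (1 <= d)%N -> 0 < a0 -> 0 < L ->
  iid_with_density X p ->
  ('N[lebesgueRd d]_+oo[EFin \o p] <= L%:E)%E ->
  K \in Lfun (lebesgueRd d) 2%:E ->
  is_fourierL2 K FK ->
  (forall t, 0 <= FK t <= 1) ->
  (forall t (h h' : R), 0 < h' -> h' < h ->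
     FK (scalev h t) <= FK (scalev h' t)) ->
  0 < c -> 0 < alpha ->
  (forall n : nat, (0 < n)%N ->
     ((c * n%:R `^ (- 1 + alpha))%:E <= kernel_oracle_risk X p K n)%E) ->
  (\forall n \near \oo, (0 < #|SS n|)%N /\
     forall S, S \in SS n -> #|S| = training_size R n) ->
  (\forall n \near \oo, forall S, S \in SS n ->
     is_kernel_aggregate kind a0 K S (agg n S)) ->
  exists eps : nat -> R,
    eps n @[n --> \oo] --> 0 /\
    \forall n \near \oo,
      (risk X p (averaged_estimator (SS n) (agg n))
         <= kernel_oracle_risk X p K n * (1 + eps n)%:E)%E.
Proof.
move=> d1 a0_0 L0 iidX pL K2 KF F01 Fmono c0 alpha0 oracle_lower nearSS nearagg.
have [mK sK] := Lfun2_sqnorm K2.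
have LK : L2f K by split.
have [indepX mp p0 lawX] := iidX.
have mY : measurable_fun setT (X 0%N) := @measurable_X _ _ _ _ _ X 0%N.
have law A (mA : measurable A) : P (X 0%N @^-1` A) = (\int[lebesgueRd d]_(x in A) (p x)%:E)%E := lawX 0%N A mA.
have [_ sp] := L2f_density mp p0 law L0 pL.
pose mu := lebesgueRd d : {sigma_finite_measure set (d.-tuple R) -> \bar R}.
have [kappa kappa0 kappaE] := ge0_lty_real (sqnorm_ge0 mu K) sK.
have [s s0 sE] := ge0_lty_real (sqnorm_ge0 mu p) sp.
pose S h := smooth P (X 0%N) h K.
have mS h : measurable_fun setT (S h) := measurable_smooth P mY h mK.
have Sle h : 0 < h -> (sqnorm mu (S h) <= (h ^- d * kappa)%:E)%E.
  by move=> h0; rewrite EFinM -kappaE; exact: (sqnorm_smooth_le mY mp p0 law L0 pL h0 mK sK).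
pose beta h := fine (sqnorm mu (S h)).
have betaE h : 0 < h -> sqnorm mu (S h) = (beta h)%:E.
  move=> h0; rewrite fineK// ge0_fin_numE ?sqnorm_ge0//.
  exact: (le_lt_trans (Sle h h0) (ltry _)).
pose b h := fine (bias P (X 0%N) p h K).
have bE h : 0 < h -> bias P (X 0%N) p h K = (b h)%:E.
  move=> h0; rewrite fineK// ge0_fin_numE; last exact: sqnorm_ge0.
  exact: (bias_lty mY mp p0 law L0 pL h0 mK sK).
have bSE h : 0 < h -> sqnorm mu (fun x => S h x - p x) = (b h)%:E by move=> /bE.
have mSp h : measurable_fun setT (fun x => S h x - p x) by exact: measurable_funB.
have mNp : measurable_fun setT (fun x => - p x) by exact: measurableT_comp.
have b0 h : 0 < h -> 0 <= b h.
  by move=> h0; rewrite -lee_fin -bE//; exact: sqnorm_ge0.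
have beta0 h : 0 < h -> 0 <= beta h.
  by move=> h0; rewrite -lee_fin -betaE// sqnorm_ge0.
have beta_var h : 0 < h -> beta h <= h ^- d * kappa.
  by move=> h0; rewrite -lee_fin -betaE//; exact: Sle.
have SpE h : S h = (fun x => (S h x - p x) + p x).
  by apply/funext => x; rewrite subrK.
have pSE h : p = (fun x => S h x + - (S h x - p x)).
  by apply/funext => x; rewrite opprB addrC subrK.
have beta_bias h : 0 < h -> beta h <= 2 * b h + 2 * s.
  move=> h0; rewrite -lee_fin -betaE// {1}SpE.
  apply: le_trans (sqnormD_le mu (mSp h) mp) _.
  by rewrite bSE// sE -!EFinM -EFinD.
have bias_beta h : 0 < h -> b h <= 2 * beta h + 2 * s.
  move=> h0; rewrite -lee_fin -bSE//.
  apply: le_trans (sqnormD_le mu (mS h) mNp) _.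
  by rewrite sqnormN betaE// sE -!EFinM -EFinD.
have b_mono h h' : 0 < h' -> h' < h -> b h' <= b h.
  move=> h'0 hh; have h0 : 0 < h by exact: lt_trans hh.
  by rewrite -lee_fin -!bE//; exact: (bias_mono mY mp p0 law L0 pL K2 KF F01 Fmono).
(* If kappa = 0 the smoothed density has norm 0 and the bias is s at every bandwidth; both
   inequalities are obtained with a factor 1 + e and e -> 0. *)
have b_const : kappa = 0 -> forall h h', 0 < h -> 0 < h' -> b h <= b h'.
  move=> k0.
  have bz h : 0 < h -> beta h = 0.
    by move=> h0; apply/le_anti; rewrite beta0// andbT (le_trans (beta_var h h0))// k0 mulr0.
  have bs h e : 0 < h -> 0 < e -> b h <= (1 + e) * s.
    move=> h0 e0; rewrite -lee_fin -bSE//.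
    have -> : (fun x => S h x - p x) = (fun x => - p x + S h x).
      by apply/funext => x; rewrite addrC.
    apply: le_trans (sqnormD_delta mu e0 mNp (mS h)) _.
    by rewrite sqnormN betaE// bz// mule0 adde0 sE -EFinM.
  have sb h e : 0 < h -> 0 < e -> s <= (1 + e) * b h.
    move=> h0 e0; rewrite -lee_fin -sE {1}(pSE h).
    have -> : (fun x => S h x + - (S h x - p x)) = (fun x => - (S h x - p x) + S h x).
      by apply/funext => x; rewrite addrC.
    have mN : measurable_fun setT (fun x => - (S h x - p x)) by exact: measurableT_comp.
    apply: le_trans (sqnormD_delta mu e0 mN (mS h)) _.
    by rewrite sqnormN betaE// bz// mule0 adde0 bSE// -EFinM.
  have lim (x y : R) : 0 <= y -> (forall e, 0 < e -> x <= (1 + e) * y) -> x <= y.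
    move=> y0 H; apply/ler_addgt0Pr => e e0.
    apply: le_trans (H (e / (y + 1)) _) _; first by rewrite divr_gt0// ltr_wpDl.
    rewrite mulrDl mul1r lerD2l mulrAC ler_pdivrMr ?ltr_wpDl// ler_pM2l//.
    by rewrite lerDl.
  move=> h h' h0 h'0; apply: (@le_trans _ _ s).
    by apply: lim => // e e0; exact: bs.
  by apply: lim => [|e e0]; [exact: b0|exact: sb].
pose mise (k : nat) h := b h + k%:R^-1 * (h ^- d * kappa - beta h).
have riskE n (A : {set 'I_n}) h : 0 < h -> (0 < #|A|)%N ->
    risk X p (kernel_estimator K A h) = (mise #|A| h)%:E.
  move=> h0 A0; have := risk_kernel iidX L0 pL mK sK h0 A0.
  rewrite -/(S h) betaE// bE// kappaE -!EFinM -EFinD => /(congr1 (fun x => x - (#|A|%:R^-1 * beta h)%:E)%E).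
  by rewrite addeK// -EFinB => ->; congr EFin; rewrite /mise; ring.
have oracleE n : (0 < n)%N -> kernel_oracle_risk X p K n =
    ereal_inf [set (mise n h)%:E | h in [set h : R | 0 < h]].
  move=> n0; congr ereal_inf; apply/seteqP; split => _ [h /= h0 <-]; exists h => //=;
  by rewrite riskE// ?cardsT ?card_ord.
have mise_lower n h : (0 < n)%N -> 0 < h -> c * n%:R `^ (- 1 + alpha) <= mise n h.
  move=> n0 h0; rewrite -lee_fin; apply: le_trans (oracle_lower n n0) _.
  by rewrite oracleE//; apply: ereal_inf_lbound; exists h.
have [eps [eps0 near_mise]] := mise_oracle_rate d1 a0_0 s0 kappa0 b0 beta0 beta_var
  beta_bias bias_beta b_mono b_const L0 c0 alpha0 mise_lower.
exists eps; split=> //; near=> n.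
have n0 : (0 < n)%N by near: n; exact: nbhs_infty_gt.
have [SS0 SSm] : (0 < #|SS n|)%N /\ forall A, A \in SS n -> #|A| = training_size R n.
  by near: n.
have aggn : forall A, A \in SS n -> is_kernel_aggregate kind a0 K A (agg n A).
  by near: n.
(* Positivity allows dividing by 1 + eps n, so that the target becomes a lower bound of the
   infimum. *)
have eps1 : 0 < 1 + eps n.
  have : `|0 - eps n| < 1.
    by near: n; move/cvgrPdist_lt : eps0; apply.
  by rewrite sub0r normrN ltr_norml => /andP[e _]; lra.
have [/andP[m0 mn] g0 grid_le] : [/\ (0 < training_size R n < n)%N,
    forall j, 0 < grid d a0 n j &
    forall h, 0 < h -> exists j : 'I_(grid_size d a0 n),
      mise (training_size R n) (grid d a0 n j) +
        L * (grid_size d a0 n)%:R / (n - training_size R n)%:R <=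
      mise n h * (1 + eps n)] by near: n.
(* The infimum need not be attained, so the bound is proved for each h, with a grid point depending
   on h. *)
rewrite oracleE// -lee_pdivrMr//; apply: le_ereal_inf_tmp => _ [h /= h0 <-].
rewrite lee_pdivrMr// -EFinM.
have [j jle] := grid_le h h0.
apply: (@le_trans _ _ (mise (training_size R n) (grid d a0 n j) +
  L * (grid_size d a0 n)%:R / (n - training_size R n)%:R)%:E); last by rewrite lee_fin.
apply: (risk_averaged_le iidX L0 pL LK g0 SS0 _ _ aggn).
- by rewrite subn_gt0.
- by move=> A /SSm <-; rewrite cardsCs finset.setCK card_ord.
- by move=> A AS; rewrite riskE ?(SSm A AS)//.
Unshelve. all: by end_near. Qed.
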